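(* Let $\mathcal{T}_h$ be a regular triangulation of a bounded polyhedral Lipschitz domain $\Omega\subset\mathbb{R}^d$ with boundary partition $\partial\Omega=\Gamma_D\cup\Gamma_N$. Within the spaces of elementwise constant vector fields $\mathcal{L}^0(\mathcal{T}_h)^d$ and elementwise constant functions $\mathcal{L}^0(\mathcal{T}_h)$, equipped with the $L^2$ inner product, we have $$\big(\Pi_h\, \mathcal{R}T^0_N(\mathcal{T}_h)\big)^\perp = \nabla_h\big(\ker \Pi_h|_{\mathcal{S}^{1,cr}_D(\mathcal{T}_h)}\big),$$ $$\operatorname{div}\big(\ker \Pi_h|_{\mathcal{R}T^0_N(\mathcal{T}_h)}\big) = \big(\Pi_h\, \mathcal{S}^{1,cr}_D(\mathcal{T}_h)\big)^\perp,$$ where the orthogonal complement in the first identity is taken in $\mathcal{L}^0(\mathcal{T}_h)^d$ and the one in the second identity is taken in $\mathcal{L}^0(\mathcal{T}_h)$.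
   Context: Let $d$ be a positive integer and $\Omega\subset\mathbb{R}^d$ a bounded polyhedral Lipschitz domain (in particular connected). Let $\mathcal{T}_h$ be a regular (conforming, finite) triangulation of $\Omega$ into closed nondegenerate $d$-simplices, called elements. $\mathcal{S}_h$ is the set of sides ($(d-1)$-dimensional faces) of elements; $x_S$ and $x_T$ are the barycenters (midpoints) of a side $S$ and an element $T$. The boundary $\partial\Omega$ is partitioned into $\Gamma_D$ and $\Gamma_N$: $\Gamma_D$ is a (possibly empty) union of boundary sides and $\Gamma_N$ is the union of the remaining boundary sides (possibly empty). $n$ is the outer unit normal on $\partial\Omega$. $P_k(T)$ is the set of polynomials of total degree at most $k$ on $T$, and $\mathcal{L}^k(\mathcal{T}_h)^\ell=\{w_h\in L^\infty(\Omega;\mathbb{R}^\ell): w_h|_T\in P_k(T)$ (componentwise) for all $T\in\mathcal{T}_h\}$; the superscript $\ell$ is omitted if $\ell=1$. $\Pi_h:L^1(\Omega;\mathbb{R}^\ell)\to\mathcal{L}^0(\mathcal{T}_h)^\ell$ is the $L^2$ projection onto elementwise constants, i.e. $\Pi_h v|_T=|T|^{-1}\int_T v\,dx$. Crouzeix--Raviart space: $\mathcal{S}^{1,cr}(\mathcal{T}_h)=\{v_h\in\mathcal{L}^1(\mathcal{T}_h): v_h$ is continuous at $x_S$ for all $S\in\mathcal{S}_h\}$ (for an interior side, the values at $x_S$ from the two adjacent elements agree), and $\mathcal{S}^{1,cr}_D(\mathcal{T}_h)=\{v_h\in\mathcal{S}^{1,cr}(\mathcal{T}_h): v_h(x_S)=0$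 for all $S\in\mathcal{S}_h$ with $S\subset\Gamma_D\}$. The elementwise gradient $\nabla_h v_h\in\mathcal{L}^0(\mathcal{T}_h)^d$ is defined by $\nabla_h v_h|_T=\nabla(v_h|_T)$. Raviart--Thomas space: $\mathcal{R}T^0(\mathcal{T}_h)=\{y_h\in H(\operatorname{div};\Omega): y_h|_T(x)=a_T+b_T(x-x_T),\ a_T\in\mathbb{R}^d,\ b_T\in\mathbb{R},$ for all $T\in\mathcal{T}_h\}$, where $H(\operatorname{div};\Omega)$ is the set of $L^2$ vector fields with distributional divergence in $L^2(\Omega)$, and $\mathcal{R}T^0_N(\mathcal{T}_h)=\{y_h\in\mathcal{R}T^0(\mathcal{T}_h): y_h\cdot n=0$ on $\Gamma_N\}$. $\ker\Pi_h|_V$ denotes $\{v\in V:\Pi_h v=0\}$. *)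

(* Defs.v *)
From HB Require Import structures.
From mathcomp Require Import all_boot all_order all_algebra finmap.
From mathcomp Require Import all_classical all_reals all_analysis.

Set Implicit Arguments.
Unset Strict Implicit.
Unset Printing Implicit Defensive.

Import Order.TTheory GRing.Theory Num.Theory.
Import numFieldNormedType.Exports.

Local Open Scope classical_set_scope.
Local Open Scope ring_scope.

Definition measure_rV_display : measure_display.
Proof. exact. Qed.

Section measurable_rV.
Variables (R : realType) (n : nat).

Let coors : 'I_n -> 'rV[R]_n -> measurableTypeR R := fun i x => x ord0 i.

Let rV_set0 : g_sigma_preimage coors set0.
Proof. exact: sigma_algebra0. Qed.

Let rV_setC A : g_sigma_preimage coors A -> g_sigma_preimage coors (~` A).
Proof. exact: sigma_algebraC. Qed.

Let rV_bigcup (F : (set 'rV[R]_n)^nat) :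
  (forall i, g_sigma_preimage coors (F i)) ->
  g_sigma_preimage coors (\bigcup_i (F i)).
Proof. exact: sigma_algebra_bigcup. Qed.

(* The product (= Borel) sigma-algebra of R^n, generated by the coordinates,
   as the library does for n.-tuple *)
HB.instance Definition _ := @isMeasurable.Build measure_rV_display
  'rV[R]_n (g_sigma_preimage coors) rV_set0 rV_setC rV_bigcup.

End measurable_rV.

Section measurable_fun_rV.
Context d (T : measurableType d) (R : realType).

Lemma measurable_fun_rVP n (f : T -> 'rV[R]_n) :
  (forall i, measurable_fun [set: T] (fun x => f x ord0 i : measurableTypeR R))
  -> measurable_fun [set: T] f.
Proof.
move=> mf.
suff H : g_sigma_preimage
    (fun i (x : T) => (f x ord0 i : measurableTypeR R)) `<=` measurable.
  have := @g_sigma_preimage_comp _ (measurableTypeR R) n 'rV[R]_n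
    (fun i (x : 'rV[R]_n) => x ord0 i : measurableTypeR R) T f.
  rewrite /comp => E; rewrite E in H.
  by move=> _ A mA; apply: H; exists A.
apply: smallest_sub; first exact: sigma_algebra_measurable.
elim/big_ind : _ => //=.
- by move=> A B HA HB C [/HA|/HB].
- by move=> i _ A [B mB <-]; exact: mf.
Qed.

Lemma measurable_coord n (i : 'I_n) :
  measurable_fun [set: 'rV[R]_n] (fun x => x ord0 i : measurableTypeR R).
Proof.
move=> _ Y mY; rewrite setTI; apply: sub_sigma_algebra => /=.
rewrite -bigcup_seq/=; exists i => /=; first by rewrite mem_index_enum.
by exists Y => //; rewrite setTI.
Qed.

End measurable_fun_rV.

Definition rV_cons (R : realType) n (p : measurableTypeR R * 'rV[R]_n) :
  'rV[R]_n.+1 := @row_mx R 1 1 n (p.1)%:M p.2.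

(* Lebesgue measure on R^n: the n-fold product of the Lebesgue measure of R *)
Fixpoint lebesgue_measure_rV (R : realType) (n : nat) :
    set 'rV[R]_n -> \bar R :=
  match n with
  | 0 => \d_(0 : 'rV[R]_0)
  | n'.+1 => pushforward (lebesgue_measure \x @lebesgue_measure_rV R n')%E
               (@rV_cons R n')
  end.
Arguments lebesgue_measure_rV : clear implicits.

Section lebesgue_measure_rV_measure.
Variable R : realType.

Let rV_uncons n (x : 'rV[R]_n.+1) : measurableTypeR R * 'rV[R]_n :=
  (x ord0 ord0, @rsubmx R 1 1 n x).

Let rV_cons0 n (p : measurableTypeR R * 'rV[R]_n) :
  rV_cons p ord0 ord0 = p.1.
Proof.
have -> : ord0 = lshift n (ord0 : 'I_1) :> 'I_n.+1 by apply/val_inj.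
by rewrite /rV_cons (@row_mxEl R 1 1 n) mxE eqxx mulr1n.
Qed.

Let rV_consS n (p : measurableTypeR R * 'rV[R]_n) (i : 'I_n) :
  rV_cons p ord0 (rshift 1 i) = p.2 ord0 i.
Proof. by rewrite /rV_cons (@row_mxEr R 1 1 n). Qed.

Let rV_consK n : cancel (@rV_cons R n) (@rV_uncons n).
Proof.
move=> p; rewrite /rV_uncons rV_cons0 [RHS]surjective_pairing; congr pair.
by apply/rowP => i; rewrite mxE rV_consS.
Qed.

Let measurable_rV_cons n : measurable_fun setT (@rV_cons R n).
Proof.
apply: measurable_fun_rVP => i.
case: (@split_ordP 1 n i) => j ->.
  rewrite [X in measurable_fun _ X](_ : _ = fst); first exact: measurable_fst.
  apply/funext => p; rewrite -rV_cons0; congr (rV_cons p _ _).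
  by apply/val_inj => /=; rewrite ord1.
rewrite [X in measurable_fun _ X](_ : _ =
   (fun v : 'rV[R]_n => v ord0 j : measurableTypeR R) \o snd); last first.
  by apply/funext => p; rewrite rV_consS.
exact: measurableT_comp (measurable_coord _) measurable_snd.
Qed.

Let measurable_rV_uncons n : measurable_fun setT (@rV_uncons n).
Proof.
apply/measurable_fun_pairP; split; first exact: measurable_coord.
apply: measurable_fun_rVP => i.
rewrite [X in measurable_fun _ X](_ : _ =
   (fun v : 'rV[R]_n.+1 => v ord0 (rshift 1 i) : measurableTypeR R)).
  exact: measurable_coord.
by apply/funext => x /=; rewrite mxE.
Qed.

Section step.
Variables (n : nat) (m : {sigma_finite_measure set 'rV[R]_n -> \bar R}).

Let step := pushforward (lebesgue_measure \x m)%E (@rV_cons R n).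

Let step0 : step set0 = 0%E.
Proof. by rewrite /step /pushforward preimage_set0 measure0. Qed.

Let step_ge0 A : (0 <= step A)%E.
Proof. by rewrite /step /pushforward measure_ge0. Qed.

Let step_sigma_additive : semi_sigma_additive step.
Proof.
have mf := @measurable_rV_cons n.
move=> F mF tF mUF; rewrite /step /pushforward preimage_bigcup.
apply: measure_semi_sigma_additive.
- by move=> k; rewrite -[X in measurable X]setTI; exact: mf.
- apply/trivIsetP => /= i j _ _ ij; rewrite -preimage_setI.
  by move/trivIsetP : tF => /(_ _ _ _ _ ij) ->//; rewrite preimage_set0.
- by rewrite -preimage_bigcup -[X in measurable X]setTI; exact: mf.
Qed.

HB.instance Definition _ := @isMeasure.Build _ _ _ step
  step0 step_ge0 step_sigma_additive.

Let step_sigma_finite : sigma_finite setT step.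
Proof.
have /sigma_finiteP[F [TF ndF Foo]] :=
  sigma_finiteT (@lebesgue_measure R : {sigma_finite_measure set _ -> \bar R}).
have /sigma_finiteP[G [TG ndG Goo]] := sigma_finiteT m.
exists (fun k => @rV_uncons n @^-1` (F k `*` G k)).
  rewrite -preimage_bigcup (_ : \bigcup_k _ = setT) ?preimage_setT//.
  rewrite -setXTT TF TG predeqE => -[x y]; split.
    by move=> [k _ []/= ? ?]; split; exists k.
  move=> [/= [i _ Fx] [k _ Gy]]; exists (maxn i k) => //; split.
  - by move: x Fx; exact/subsetPset/ndF/leq_maxl.
  - by move: y Gy; exact/subsetPset/ndG/leq_maxr.
move=> k; have [mF Fk] := Foo k; have [mG Gk] := Goo k; split.
  rewrite -[X in measurable X]setTI; apply: measurable_rV_uncons => //.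
  exact: measurableX.
rewrite /step /pushforward -comp_preimage (_ : _ \o _ = id).
  by rewrite preimage_id product_measure1E// lte_mul_pinfty// ge0_fin_numE.
by apply/funext => x; exact: rV_consK.
Qed.

HB.instance Definition _ :=
  @Measure_isSigmaFinite.Build _ _ _ step step_sigma_finite.

Definition lebesgue_measure_rV_step :
  {sigma_finite_measure set 'rV[R]_n.+1 -> \bar R} := step.
End step.

Let lebesgue_measure_rV_ex n :
  exists m : {sigma_finite_measure set 'rV[R]_n -> \bar R},
    lebesgue_measure_rV R n = m.
Proof.
elim: n => [|n [m mE]]; first by exists (\d_(0 : 'rV[R]_0)).
by exists (lebesgue_measure_rV_step m); rewrite /= mE.
Qed.

Variable n : nat.

Let lebesgue0 : lebesgue_measure_rV R n set0 = 0%E.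
Proof. by have [m ->] := lebesgue_measure_rV_ex n; exact: measure0. Qed.

Let lebesgue_ge0 A : (0 <= lebesgue_measure_rV R n A)%E.
Proof. by have [m ->] := lebesgue_measure_rV_ex n; exact: measure_ge0. Qed.

Let lebesgue_sigma_additive : semi_sigma_additive (lebesgue_measure_rV R n).
Proof.
have [m ->] := lebesgue_measure_rV_ex n; exact: measure_semi_sigma_additive.
Qed.

HB.instance Definition _ := @isMeasure.Build _ _ _ (lebesgue_measure_rV R n)
  lebesgue0 lebesgue_ge0 lebesgue_sigma_additive.

Let lebesgue_sigma_finite : sigma_finite setT (lebesgue_measure_rV R n).
Proof. by have [m ->] := lebesgue_measure_rV_ex n; exact: sigma_finiteT. Qed.

HB.instance Definition _ := @Measure_isSigmaFinite.Build _ _ _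
  (lebesgue_measure_rV R n) lebesgue_sigma_finite.

End lebesgue_measure_rV_measure.

Section euclidean_space.
Variables (R : realType) (d : nat).
Implicit Types (Omega : set 'rV[R]_d) (x y e : 'rV[R]_d).

Definition dot x y : R := \sum_i x ord0 i * y ord0 i.

Definition boundary Omega : set 'rV[R]_d := closure Omega `\` interior Omega.

(* Near each boundary point, and up to a rotation sending e to a coordinate
   axis, Omega is the strict epigraph of a Lipschitz function; gamma is
   constant along e, i.e. a function of the d-1 remaining coordinates. *)
Definition lipschitz_boundary Omega := forall x, boundary Omega x ->
  exists e (gamma : 'rV[R]_d -> R) (r : R),
    [/\ dot e e = 1,
        forall y t, gamma (y + t *: e) = gamma y,
        exists L : R, forall y z, `|gamma y - gamma z| <= L * `|y - z|,
        0 < r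
      & forall y, ball x r y -> (Omega y <-> gamma y < dot e y)].

Definition bounded_lipschitz_domain Omega :=
  [/\ Omega !=set0, open Omega, connected Omega, bounded_set Omega
    & lipschitz_boundary Omega].

Definition grad (f : 'rV[R]_d -> R) x : 'rV[R]_d :=
  \row_i 'D_(delta_mx ord0 i) f x.

Fixpoint Ck (k : nat) (f : 'rV[R]_d -> R) : Prop :=
  match k with
  | 0 => continuous f
  | k'.+1 => continuous f /\ forall i : 'I_d,
      (forall x, derivable f x (delta_mx ord0 i)) /\
      Ck k' (fun x => 'D_(delta_mx ord0 i) f x)
  end.

(* C_c^infty(Omega), extended by zero to R^d *)
Definition test_function Omega (phi : 'rV[R]_d -> R) :=
  [/\ forall k, Ck k phi, compact (closure [set x | phi x != 0])
    & closure [set x | phi x != 0] `<=` Omega].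

Definition polynomial_le (k : nat) (p : 'rV[R]_d -> R) :=
  exists c : {ffun 'I_d -> 'I_k.+1} -> R, forall x,
    p x = \sum_(alpha : {ffun 'I_d -> 'I_k.+1} | (\sum_i alpha i <= k)%N)
            c alpha * \prod_i x ord0 i ^+ alpha i.

End euclidean_space.

Section triangulation.
Variables (R : realType) (d : nat).
(* simplices are given by their finite sets of vertices *)
Local Notation simplex := {fset 'rV[R]_d}.
Implicit Types (Omega : set 'rV[R]_d) (S T : simplex) (Th : {fset simplex}).
Implicit Types (GammaD GammaN : set 'rV[R]_d).

Definition hull S : set 'rV[R]_d := [set x | exists c : 'rV[R]_d -> R,
  [/\ forall p, p \in S -> 0 <= c p, \sum_(p <- S) c p = 1
    & x = \sum_(p <- S) c p *: p]].

Definition barycenter S : 'rV[R]_d := (#|` S|%:R)^-1 *: \sum_(p <- S) p.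

Definition affinely_independent S := forall c : 'rV[R]_d -> R,
  \sum_(p <- S) c p = 0 -> \sum_(p <- S) c p *: p = 0 ->
  forall p, p \in S -> c p = 0.

(* The second condition makes the closure of Omega a polyhedron; the third one
   says that two elements meet in the (possibly empty) face spanned by their
   common vertices. *)
Definition regular_triangulation Omega Th :=
  [/\ forall T, T \in Th -> #|` T| = d.+1 /\ affinely_independent T,
      closure Omega = \bigcup_(T in [set` Th]) hull T
    & forall T T', T \in Th -> T' \in Th ->
        hull T `&` hull T' = hull (T `&` T')%fset].

Definition is_side_of S T := (S `<=` T)%fset /\ #|` S| = d.

Definition is_side Th S := exists2 T, T \in Th & is_side_of S T.

Definition is_boundary_side Omega Th S :=
  is_side Th S /\ hull S `<=` boundary Omega.

Definition boundary_partition Omega Th GammaD GammaN :=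
  exists D : {fset simplex},
    [/\ forall S, S \in D -> is_boundary_side Omega Th S,
        GammaD = \bigcup_(S in [set` D]) hull S
      & GammaN =
        \bigcup_(S in [set S | is_boundary_side Omega Th S /\ S \notin D])
          hull S].

(* The outer unit normal of the element T on its side S; for a boundary side
   it is the outer unit normal of the domain. *)
Definition outer_normal T S (n : 'rV[R]_d) :=
  [/\ dot n n = 1, forall x z, hull S x -> hull S z -> dot n (x - z) = 0
    & forall x z, hull T x -> hull S z -> dot n (x - z) <= 0].

End triangulation.

(* An element of L^p(Omega) is represented by the measurable functions on R^d
   which coincide with it almost everywhere on Omega: all the spaces below are
   sets of functions saturated with respect to equality almost everywhere on
   Omega. *)
Section finite_elements.
Variables (R : realType) (d : nat).
Variables (Omega : set 'rV[R]_d) (Th : {fset {fset 'rV[R]_d}}).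
Variables (GammaD GammaN : set 'rV[R]_d).
Local Notation mu := (lebesgue_measure_rV R d).
Implicit Types (T S : {fset 'rV[R]_d}).

Definition component (l : nat) (w : 'rV[R]_d -> 'rV[R]_l) (j : 'I_l) :
  'rV[R]_d -> R := fun x => w x ord0 j.

Definition Linfty (w : 'rV[R]_d -> R) :=
  measurable_fun setT w /\
  exists M : R, {ae mu, forall x, Omega x -> `|w x| <= M}.

Definition L2 (w : 'rV[R]_d -> R) :=
  measurable_fun setT w /\
  mu.-integrable Omega (fun x => (w x ^+ 2)%:E).

Definition inner (v w : 'rV[R]_d -> R) : R :=
  \int[mu]_(x in Omega) (v x * w x).

Definition innerv (v w : 'rV[R]_d -> 'rV[R]_d) : R :=
  \int[mu]_(x in Omega) dot (v x) (w x).

(* [restricts k w T p]: p is the representative in P_k(T) of w|_T *)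
Definition restricts (k : nat) (w : 'rV[R]_d -> R) T (p : 'rV[R]_d -> R) :=
  polynomial_le k p /\ w = p %[ae mu in hull T].

Definition Lk (k : nat) : set ('rV[R]_d -> R) :=
  [set w | Linfty w /\ forall T, T \in Th -> exists p, restricts k w T p].

Definition Lkv (k l : nat) : set ('rV[R]_d -> 'rV[R]_l) :=
  [set w | forall j, Lk k (component w j)].

Definition average T (v : 'rV[R]_d -> R) : R :=
  (fine (mu (hull T)))^-1 * \int[mu]_(x in hull T) v x.

(* The elements overlap only in a null set, on which the value is irrelevant *)
Definition Pi_h (v : 'rV[R]_d -> R) : 'rV[R]_d -> R :=
  fun x => \sum_(T <- Th) \1_(hull T) x * average T v.

Definition Pi_hv (l : nat) (v : 'rV[R]_d -> 'rV[R]_l) : 'rV[R]_d -> 'rV[R]_l :=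
  fun x => \row_j Pi_h (component v j) x.

Definition ker_Pi_h (V : set ('rV[R]_d -> R)) : set ('rV[R]_d -> R) :=
  [set v | V v /\ Pi_h v = cst 0 %[ae mu in Omega]].

Definition ker_Pi_hv (l : nat) (V : set ('rV[R]_d -> 'rV[R]_l)) :
  set ('rV[R]_d -> 'rV[R]_l) :=
  [set v | V v /\ Pi_hv v = cst 0 %[ae mu in Omega]].

Definition CR : set ('rV[R]_d -> R) :=
  [set v | Lk 1 v /\
    forall S T T' p p', T \in Th -> T' \in Th ->
      is_side_of S T -> is_side_of S T' ->
      restricts 1 v T p -> restricts 1 v T' p' ->
      p (barycenter S) = p' (barycenter S)].

Definition CR_D : set ('rV[R]_d -> R) :=
  [set v | CR v /\
    forall S T p, T \in Th -> is_side_of S T -> hull S `<=` GammaD ->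
      restricts 1 v T p -> p (barycenter S) = 0].

(* z = nabla_h v *)
Definition is_grad_h (v : 'rV[R]_d -> R) (z : 'rV[R]_d -> 'rV[R]_d) :=
  Lkv 0 z /\ forall T, T \in Th ->
    exists2 p, restricts 1 v T p & z = grad p %[ae mu in hull T].

(* g = div y in the sense of distributions, with g in L^2(Omega) *)
Definition is_div (y : 'rV[R]_d -> 'rV[R]_d) (g : 'rV[R]_d -> R) :=
  L2 g /\ forall phi, test_function Omega phi ->
    \int[mu]_(x in Omega) dot (y x) (grad phi x) =
    - \int[mu]_(x in Omega) (g x * phi x).

Definition Hdiv : set ('rV[R]_d -> 'rV[R]_d) :=
  [set y | (forall j, L2 (component y j)) /\ exists g, is_div y g].

Definition RT_shape T (a : 'rV[R]_d) (b : R) : 'rV[R]_d -> 'rV[R]_d :=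
  fun x => a + b *: (x - barycenter T).

Definition RT : set ('rV[R]_d -> 'rV[R]_d) :=
  [set y | Hdiv y /\ forall T, T \in Th ->
    exists a b, y = RT_shape T a b %[ae mu in hull T]].

Definition RT_N : set ('rV[R]_d -> 'rV[R]_d) :=
  [set y | RT y /\
    forall S T a b n, T \in Th -> is_side_of S T ->
      is_boundary_side Omega Th S -> hull S `<=` GammaN ->
      y = RT_shape T a b %[ae mu in hull T] -> outer_normal T S n ->
      forall x, hull S x -> dot (RT_shape T a b x) n = 0].

End finite_elements.

Arguments Lkv {R d} Omega Th k l _.

(* the orthogonal complement of W in V *)
Definition orth_complement (R : realType) (E : Type) (ip : E -> E -> R) (V W : set E) :
  set E := [set z | V z /\ forall w, W w -> ip z w = 0].

(* Main.v *)
Require Import Defs.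
From HB Require Import structures.
From mathcomp Require Import all_boot all_order all_algebra finmap.
From mathcomp Require Import all_classical all_reals all_analysis.
From mathcomp Require Import measurable_realfun ring lra.

(** Both identities rest on one pairing. On an element T with barycenter x_T, a
    Raviart--Thomas shape y = a + b (x - x_T) is the combination of the fields
    x - p, for p a vertex of T, whose coefficient c_p ([RT_flux]) is up to the
    factor d |T| the outward flux through the side opposite to p. For an affine
    function q with gradient g, integration by parts on T is the algebraic
    identity [local_integration_by_parts]
      g . a + d b q(x_T) = d sum_p c_p q(x_p),
    with x_p the midpoint of the side opposite to p. Multiply by |T| and sum
    over the elements. When the fluxes of y are opposite across interior sides
    and zero on Neumann sides, and the midpoint values of the piecewise affine
    function v agree across interior sides and vanish on Dirichlet sides, the
    right-hand side cancels ([pairing_eq0]):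
      sum_T |T| (g_T . a_T + d b_T v_T(x_T)) = 0.
    Here a_T and v_T(x_T) are the averages of y and v, and d b_T is div y. If v
    has zero averages, nabla_h v is orthogonal to Pi_h y; if y has zero
    averages, div y is orthogonal to Pi_h v.

    The converse inclusions use the same identity with basis functions. Given z
    orthogonal to Pi_h RT_N, the only candidate for v is z_T . (x - x_T) on T,
    and the Raviart--Thomas basis field of a side turns orthogonality into the
    midpoint condition on that side ([orthogonal_is_grad]). Given g orthogonal
    to Pi_h CR_D, the only candidate for y is (g_T / d) (x - x_T), and the
    Crouzeix--Raviart basis function 1 - d lambda_p turns orthogonality into
    the flux condition ([orthogonal_is_div]).

    The remaining work is to express the function spaces by these coefficients.
    The divergence of y is a distributional one, so it has to be shown that an
    elementwise Raviart--Thomas field has a divergence in L^2 if and only if its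
    fluxes are compatible ([is_div_of_compatible_fluxes],
    [compatible_fluxes_of_div]), the divergence then being d b_T
    ([div_on_element], by the fundamental lemma [du_bois_reymond]). This needs
    Gauss' theorem for a test function psi on a simplex. The fields x - p have
    no flux through the sides containing p, so it suffices to compare psi with
    its contractions towards p ([gauss_cone]); the average of psi over a side
    is represented as the average over T of psi composed with the central
    projection from p, and it is the same from both elements sharing the side
    ([average_side_trace_eq]), because affine maps preserve averages
    ([average_amap], from the change of variables [scales_affine] for the
    product measure).

    Finally the cancellation along sides uses that a side is either on the
    boundary and belongs to one element, or belongs to exactly two elements,
    which lie on opposite sides of it ([flag_dichotomy], [neighbour_unique]).
    Conformity of the triangulation gives this once it is known that Omega is
    the interior of its closure, which holds for Lipschitz domains
    ([interior_closure]). *)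

Set Implicit Arguments.
Unset Strict Implicit.
Unset Printing Implicit Defensive.

Import Order.TTheory GRing.Theory Num.Theory.
Import numFieldNormedType.Exports.

Local Open Scope classical_set_scope.
Local Open Scope ring_scope.

(** * The Lebesgue measure of R^n under affine maps *)

Section lebesgue_rV.
Variable R : realType.
Local Notation mu n := (lebesgue_measure_rV R n).
Local Notation leb := (@lebesgue_measure R).

Lemma preimage_measurable d1 d2 (T1 : measurableType d1)
    (T2 : measurableType d2) (f : T1 -> T2) A :
  measurable_fun setT f -> measurable A -> measurable (f @^-1` A).
Proof. by move=> mf mA; rewrite -[X in measurable X]setTI; exact: mf. Qed.

(** Both sides are measures of A which agree on half-open intervals. *)
Lemma lebesgue_measure_affine (a b : R) (A : set (measurableTypeR R)) :
  a != 0 -> measurable A ->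
  leb ((fun x => a * x + b) @^-1` A) = (`|a|^-1%:E * leb A)%E.
Proof.
move=> a0 mA.
have mf : measurable_fun [set: measurableTypeR R]
    ((fun x => a * x + b) : _ -> measurableTypeR R).
  by apply: measurable_funD => //; apply: measurable_funM.
have k0 : 0 <= `|a| by [].
pose pm := measure_function_pushforward__canonical__measure_function_Measure
  leb mf.
pose ms : {measure set (measurableTypeR R) -> \bar R} := mscale (NngNum k0) pm.
have -> : leb A = ms A; last first.
  by rewrite /ms /= /mscale /= muleA -EFinM mulVf ?normr_eq0// mul1e.
apply: lebesgue_measure_unique => //= _ [[l r] _ <-].
rewrite /ms/= /mscale/= /pm/= /pushforward/=.
have [a1|a1|/eqP] := ltgtP a 0; last by rewrite (negPf a0).
  rewrite (_ : _ @^-1` _ = `[(r - b) / a, (l - b) / a[%classic); last first.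
    apply/seteqP; split => x/=; rewrite !in_itv/= => /andP[h1 h2].
      by rewrite ler_ndivrMr// ltr_ndivlMr// mulrC; apply/andP; split; lra.
    move: h1 h2; rewrite ler_ndivrMr// ltr_ndivlMr// mulrC => h1 h2.
    by apply/andP; split; lra.
  rewrite !lebesgue_measure_itv/= !lte_fin.
  have -> : ((r - b) / a < (l - b) / a) = (l < r).
    by rewrite ltr_nM2r ?invr_lt0//; apply/idP/idP; lra.
  case: ifP => _; last by rewrite mule0.
  by rewrite -!EFinB -EFinM; congr EFin; rewrite ltr0_norm//; field.
rewrite (_ : _ @^-1` _ = `](l - b) / a, (r - b) / a]%classic); last first.
  apply/seteqP; split => x/=; rewrite !in_itv/= => /andP[h1 h2].
    by rewrite ltr_pdivrMr// ler_pdivlMr// mulrC; apply/andP; split; lra.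
  move: h1 h2; rewrite ltr_pdivrMr// ler_pdivlMr// mulrC => h1 h2.
  by apply/andP; split; lra.
rewrite !lebesgue_measure_itv/= !lte_fin.
have -> : ((l - b) / a < (r - b) / a) = (l < r).
  by rewrite ltr_pM2r ?invr_gt0//; apply/idP/idP; lra.
case: ifP => _; last by rewrite mule0.
by rewrite -!EFinB -EFinM; congr EFin; rewrite gtr0_norm//; field.
Qed.

Lemma rV_cons0 n (p : measurableTypeR R * 'rV[R]_n) : rV_cons p ord0 ord0 = p.1.
Proof.
have -> : ord0 = lshift n (ord0 : 'I_1) :> 'I_n.+1 by apply/val_inj.
by rewrite /rV_cons (@row_mxEl R 1 1 n) mxE eqxx mulr1n.
Qed.

Lemma rV_consS n (p : measurableTypeR R * 'rV[R]_n) (i : 'I_n) :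
  rV_cons p ord0 (lift ord0 i) = p.2 ord0 i.
Proof.
rewrite (_ : lift _ _ = rshift 1 i); last exact/val_inj.
by rewrite /rV_cons (@row_mxEr R 1 1 n).
Qed.

Lemma rV_consP n (x : 'rV[R]_n.+1) :
  exists (a : measurableTypeR R) v, x = rV_cons (a, v).
Proof.
exists (x ord0 ord0), (\row_i x ord0 (lift ord0 i)); apply/rowP => i.
by case: (unliftP ord0 i) => [j|] ->; rewrite ?rV_consS ?rV_cons0//= mxE.
Qed.

Lemma measurable_rV_cons n : measurable_fun setT (@rV_cons R n).
Proof.
apply: measurable_fun_rVP => i; case: (unliftP ord0 i) => [j|] -> /=.
  under eq_fun do rewrite rV_consS.
  exact: (measurableT_comp (measurable_coord _) measurable_snd).
by under eq_fun do rewrite rV_cons0; exact: measurable_fst.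
Qed.

Lemma lebesgue_measure_rVS n (A : set 'rV[R]_n.+1) :
  mu n.+1 A = (leb \x mu n)%E (@rV_cons R n @^-1` A).
Proof. by []. Qed.

(** The pushforward of the Lebesgue measure by f is c times itself. Stating it
    with preimages avoids the measurability of images; c is the inverse of the
    Jacobian of f. *)
Definition scales n (f : 'rV[R]_n -> 'rV[R]_n) (c : R) :=
  measurable_fun setT f /\
  forall A, measurable A -> mu n (f @^-1` A) = (c%:E * mu n A)%E.

Lemma scales_comp n (f g : 'rV[R]_n -> 'rV[R]_n) c c' :
  scales f c -> scales g c' -> scales (g \o f) (c * c').
Proof.
move=> [mf sf] [mg sg]; split; first exact: measurableT_comp.
move=> A mA; rewrite comp_preimage sf; last exact: preimage_measurable.
by rewrite sg// muleA EFinM.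
Qed.

(** Fubini, slicing along the first coordinate, which f preserves. *)
Lemma scales_fibre_tail n (f : 'rV[R]_n.+1 -> 'rV[R]_n.+1)
    (g : R -> 'rV[R]_n -> 'rV[R]_n) c : measurable_fun setT f -> 0 <= c ->
  (forall x v, f (rV_cons (x, v)) = rV_cons (x, g x v)) ->
  (forall x, scales (g x) c) -> scales f c.
Proof.
move=> mf c0 fE sg; split=> // A mA; rewrite !lebesgue_measure_rVS.
have mA' := preimage_measurable (@measurable_rV_cons n) mA.
rewrite /product_measure1 -ge0_integralZl//; last first.
  exact: measurable_fun_xsection.
apply: eq_integral => x _ /=; rewrite -(sg x).2; last first.
  exact: measurable_xsection.
by congr (mu n _); apply/seteqP; split=> v;
  rewrite /xsection/= !inE/= fE.
Qed.

(** Fubini in the other order, slicing along the last coordinates. *)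
Lemma scales_fibre_head n (f : 'rV[R]_n.+1 -> 'rV[R]_n.+1)
    (g : 'rV[R]_n -> R -> R) c : measurable_fun setT f -> 0 <= c ->
  (forall x v, f (rV_cons (x, v)) = rV_cons (g v x, v)) ->
  (forall v (A : set (measurableTypeR R)), measurable A ->
     leb (g v @^-1` A) = (c%:E * leb A)%E) -> scales f c.
Proof.
move=> mf c0 fE sg; split=> // A mA; rewrite !lebesgue_measure_rVS.
have mA' := preimage_measurable (@measurable_rV_cons n) mA.
have mfA' := preimage_measurable (@measurable_rV_cons n)
  (preimage_measurable mf mA).
have swap (X : set (measurableTypeR R * 'rV[R]_n)) : measurable X ->
    (leb \x mu n)%E X = (leb \x^ mu n)%E X.
  by move=> mX; apply: product_measure_unique => // B C mB mC;
    exact: product_measure2E.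
rewrite (swap _ mA') (swap _ mfA') /product_measure2 -ge0_integralZl//; last first.
  exact: measurable_fun_ysection.
apply: eq_integral => v _ /=; rewrite -(sg v); last exact: measurable_ysection.
by congr leb; apply/seteqP; split=> x;
  rewrite /ysection/= !inE/= fE.
Qed.

Lemma measurable_rV_affine n (A : 'M[R]_n) (t : 'rV[R]_n) :
  measurable_fun setT (fun x : 'rV[R]_n => x *m A + t).
Proof.
apply: measurable_fun_rVP => i; under eq_fun do rewrite !mxE.
apply: measurable_funD => //; apply: measurable_sum => j.
by apply: measurable_funM => //; exact: measurable_coord.
Qed.

Lemma measurable_rV_translation n (t : 'rV[R]_n) :
  measurable_fun setT (fun x : 'rV[R]_n => x + t).
Proof.
have := measurable_rV_affine 1%:M t.
by under eq_fun do rewrite mulmx1.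
Qed.

Lemma scales_translation n (t : 'rV[R]_n) : scales (fun x => x + t) 1.
Proof.
elim: n t => [|n IH] t.
  split=> [|A mA]; first exact: measurable_rV_translation.
  rewrite mul1e; congr (mu 0 _).
  by apply/seteqP; split=> x /=; rewrite (thinmx0 (x + t)) (thinmx0 x).
have [a [v ->]] := rV_consP t.
rewrite (_ : (fun x => _) =
  (fun x => x + rV_cons (a, 0)) \o (fun x => x + rV_cons (0, v))); last first.
  apply/funext => x /=; rewrite -addrA; congr (_ + _); apply/rowP => i.
  rewrite [RHS]mxE; case: (unliftP ord0 i) => [j|] ->.
    by rewrite !rV_consS/= mxE addr0.
  by rewrite !rV_cons0/= add0r.
rewrite -[X in scales _ X]mulr1; apply: scales_comp.
- apply: (@scales_fibre_tail _ _ (fun _ u => u + v)) => //.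
    exact: measurable_rV_translation.
  move=> x u; apply/rowP => i; rewrite [LHS]mxE.
  case: (unliftP ord0 i) => [j|] ->; first by rewrite !rV_consS/= mxE.
  by rewrite !rV_cons0/= addr0.
- apply: (@scales_fibre_head _ _ (fun _ y => 1 * y + a)) => //.
  + exact: measurable_rV_translation.
  + move=> x u; apply/rowP => i; rewrite [LHS]mxE.
    case: (unliftP ord0 i) => [j|] ->; first by rewrite !rV_consS/= mxE addr0.
    by rewrite !rV_cons0/= mul1r.
  + by move=> u B mB; rewrite lebesgue_measure_affine ?oner_neq0// normr1 invr1.
Qed.

Lemma mul_rV_cons n (x a : R) (v b : 'rV[R]_n) c D :
  rV_cons (x, v) *m (block_mx a%:M b c D : 'M[R]_(1 + n)) =
  rV_cons (x * a + (v *m c) ord0 ord0, x *: b + v *m D).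
Proof.
rewrite /rV_cons/= (@mul_row_block _ 1 1 n 1 n) -mul_scalar_mx.
congr row_mx; apply/matrixP => i j; rewrite !ord1 [in RHS]mxE eqxx mulr1n.
by rewrite -scalar_mxM !mxE eqxx mulr1n.
Qed.

(** Multiplication by an invertible matrix is a composition of a shear adding
    to the first coordinate a linear form of the others, a shear adding to the
    others a multiple of the first, and a block diagonal map; by Fubini these
    reduce to the line and to one dimension less. *)
Lemma scales_shear_head n (u : 'cV[R]_n) :
  scales (fun x : 'rV[R]_n.+1 => x *m (block_mx 1%:M 0 u 1%:M : 'M[R]_(1 + n))) 1.
Proof.
apply: (@scales_fibre_head _ _ (fun v y => 1 * y + (v *m u) ord0 ord0)) => //.
- rewrite (_ : (fun x => _) = (fun x : 'rV[R]_n.+1 =>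
     x *m (block_mx 1%:M 0 u 1%:M : 'M[R]_(1 + n)) + 0)).
    exact: measurable_rV_affine.
  by apply/funext => x; rewrite addr0.
- by move=> x v; rewrite mul_rV_cons scaler0 add0r mulmx1 mulr1 mul1r.
- by move=> v B mB; rewrite lebesgue_measure_affine ?oner_neq0// normr1 invr1.
Qed.

Lemma scales_shear_tail n (u : 'rV[R]_n) :
  scales (fun x : 'rV[R]_n.+1 => x *m (block_mx 1%:M u 0 1%:M : 'M[R]_(1 + n))) 1.
Proof.
apply: (@scales_fibre_tail _ _ (fun x v => v + x *: u)) => //.
- rewrite (_ : (fun x => _) = (fun x : 'rV[R]_n.+1 =>
     x *m (block_mx 1%:M u 0 1%:M : 'M[R]_(1 + n)) + 0)).
    exact: measurable_rV_affine.
  by apply/funext => x; rewrite addr0.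
- by move=> x v; rewrite mul_rV_cons mulmx0 mxE mulmx1 mulr1 addr0 addrC.
- by move=> x; exact: scales_translation.
Qed.

Lemma scales_block_diag n (a : R) (A : 'M[R]_n) (c : R) : a != 0 -> 0 <= c ->
  scales (fun v => v *m A) c ->
  scales (fun x : 'rV[R]_n.+1 => x *m (block_mx a%:M 0 0 A : 'M[R]_(1 + n)))
    (`|a|^-1 * c).
Proof.
move=> a0 c0 sA.
have E (x : R) (v : 'rV[R]_n) (b : R) (B : 'M[R]_n) :
    rV_cons (x, v) *m (block_mx b%:M 0 0 B : 'M[R]_(1 + n)) =
    rV_cons (b * x, v *m B).
  by rewrite mul_rV_cons mulmx0 mxE scaler0 addr0 add0r mulrC.
have m (B : 'M[R]_n.+1) : measurable_fun setT (fun x => x *m B).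
  rewrite (_ : (fun x => _) = (fun x => x *m B + 0)).
    exact: measurable_rV_affine.
  by apply/funext => x; rewrite addr0.
rewrite (_ : (fun x => _) =
    (fun x : 'rV[R]_n.+1 => x *m (block_mx 1%:M 0 0 A : 'M[R]_(1 + n))) \o
    (fun x : 'rV[R]_n.+1 => x *m (block_mx a%:M 0 0 1%:M : 'M[R]_(1 + n)))).
  apply: scales_comp.
    apply: (@scales_fibre_head _ _ (fun _ y => a * y + 0)) => //.
      by move=> x v; rewrite E mulmx1 addr0.
    by move=> v B mB; rewrite lebesgue_measure_affine.
  by apply: (@scales_fibre_tail _ _ (fun _ v => v *m A)) => // x v;
    rewrite E mul1r.
apply/funext => x /=; have [b [v ->]] := rV_consP x.
by rewrite !E mulmx1 mul1r.
Qed.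

(** Block elimination by a nonzero corner entry; when that entry is zero, a
    shear adding a suitable row to the first one makes it nonzero, the first
    column being nonzero. *)
Theorem scales_mulmx n (A : 'M[R]_n) : A \in unitmx ->
  scales (fun x => x *m A) `|\det A|^-1.
Proof.
have mulC m (B C : 'M[R]_m) c c' : scales (fun x => x *m B) c ->
    scales (fun x => x *m C) c' -> scales (fun x => x *m (B *m C)) (c * c').
  move=> sB sC; rewrite (_ : (fun x => _) =
    (fun x => x *m C) \o (fun x => x *m B)); first exact: scales_comp.
  by apply/funext => x /=; rewrite mulmxA.
elim: n A => [|n IH] A uA.
  split; first by apply: measurable_fun_rVP => -[].
  move=> B mB; rewrite det_mx00 normr1 invr1 mul1e; congr (mu 0 _).
  by apply/seteqP; split=> x /=; rewrite (thinmx0 (x *m A)) (thinmx0 x).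
have pivot (B : 'M[R]_n.+1) : B \in unitmx -> B ord0 ord0 != 0 ->
    scales (fun x => x *m B) `|\det B|^-1.
  move=> uB B0.
  pose B' : 'M[R]_(1 + n) := B; pose a := B ord0 ord0.
  pose b := ursubmx B'; pose c := dlsubmx B'; pose D := drsubmx B'.
  pose D' := D - c *m (a^-1 *: b).
  have BE : B = (block_mx 1%:M 0 (a^-1 *: c) 1%:M : 'M[R]_(1 + n)) *m
      (block_mx a%:M 0 0 D' : 'M[R]_(1 + n)) *m
      (block_mx 1%:M (a^-1 *: b) 0 1%:M : 'M[R]_(1 + n)).
    have Ba : ulsubmx B' = a%:M.
      by apply/matrixP => i j; rewrite !ord1 !mxE eqxx; congr (B _ _);
        apply/val_inj.
    rewrite !mulmx_block !mulmx0 !mul0mx !mulmx1 !mul1mx !addr0 !add0r.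
    rewrite -[LHS](@submxK _ 1 n 1 n B') Ba -/b -/c -/D.
    rewrite -/(1%:M : 'M[R]_1) mul_scalar_mx scalerA divff// scale1r.
    rewrite mul_mx_scalar scalerA divff// scale1r.
    by rewrite /D' addrCA subrr addr0.
  have dB : \det B = a * \det D'.
    rewrite BE !det_mulmx !(@det_lblock _ 1 n) !(@det_ublock _ 1 n) !det1.
    rewrite det_scalar1.
    by rewrite ?mulr1 ?mul1r ?mulr1.
  have uD : D' \in unitmx.
    by move: uB; rewrite !unitmxE !unitfE dB mulf_eq0 negb_or => /andP[].
  rewrite [X in scales (fun x => x *m X)]BE.
  rewrite [X in scales _ X](_ : _ = 1 * (`|a|^-1 * `|\det D'|^-1) * 1).
    apply: (mulC _ _ _ _ _ _ (scales_shear_tail _)).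
    apply: (mulC _ _ _ _ _ (scales_shear_head _)).
    exact: (scales_block_diag _ _ (IH _ uD)).
  by rewrite mul1r mulr1 dB normrM invfM.
have [A0|] := eqVneq (A ord0 ord0) 0; last exact: pivot.
have [i Ai] : exists i, A (lift ord0 i) ord0 != 0.
  apply/existsP/negbNE/negP => /existsPn Ai.
  suff : \det A = 0 by move: uA; rewrite unitmxE unitfE => /eqP.
  rewrite (expand_det_col A ord0) big1// => k _.
  case: (unliftP ord0 k) => [j|] ->; last by rewrite A0 mul0r.
  by have := Ai j; rewrite negbK => /eqP ->; rewrite mul0r.
pose u : 'rV[R]_n := delta_mx ord0 i.
pose S (w : 'rV[R]_n) : 'M[R]_(1 + n) := block_mx 1%:M w 0 1%:M.
have SK : S (- u) *m S u = 1%:M.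
  rewrite /S mulmx_block !mulmx0 !mul0mx !mulmx1 !mul1mx !addr0 add0r subrr.
  by rewrite -scalar_mx_block.
have dS w : \det (S w) = 1 by rewrite /S (@det_ublock _ 1 n) !det1 mulr1.
rewrite -[X in scales (fun x => x *m X)]mul1mx -SK -mulmxA -[X in scales _ X]mul1r.
apply: mulC; first exact: scales_shear_tail.
rewrite (_ : \det A = \det (S u *m A)); last by rewrite det_mulmx dS mul1r.
apply: pivot.
  by rewrite unitmx_mul uA andbT unitmxE dS unitr1.
rewrite mxE (big_ord_recl n) A0 mulr0 add0r (bigD1 i)//= big1 ?addr0.
  rewrite (_ : S u _ _ = 1) ?mul1r//.
  rewrite (_ : lift ord0 i = rshift 1 i) /S; last exact/val_inj.
  rewrite (_ : ord0 = lshift n (ord0 : 'I_1)); last exact/val_inj.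
  by rewrite block_mxEur mxE !eqxx.
move=> j ji; rewrite (_ : S u _ _ = 0) ?mul0r//.
rewrite (_ : lift ord0 j = rshift 1 j) /S; last exact/val_inj.
rewrite (_ : ord0 = lshift n (ord0 : 'I_1)); last exact/val_inj.
by rewrite block_mxEur mxE eqxx (negPf ji).
Qed.

Corollary scales_affine n (A : 'M[R]_n) t : A \in unitmx ->
  scales (fun x => x *m A + t) `|\det A|^-1.
Proof.
move=> uA; rewrite -[X in scales _ X]mulr1.
exact: (scales_comp (scales_mulmx uA) (scales_translation t)).
Qed.

Definition box n (a b : 'rV[R]_n) : set 'rV[R]_n :=
  [set x | forall i, a ord0 i < x ord0 i < b ord0 i].

Definition closed_box n (a b : 'rV[R]_n) : set 'rV[R]_n :=
  [set x | forall i, a ord0 i <= x ord0 i <= b ord0 i].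

Lemma box_closed_box n (a b : 'rV[R]_n) : box a b `<=` closed_box a b.
Proof. by move=> x h i; have /andP[/ltW -> /ltW ->] := h i. Qed.

Lemma measurable_box n (a b : 'rV[R]_n) : measurable (box a b).
Proof.
rewrite (_ : box a b = \bigcap_(i in [set: 'I_n])
    [set x : 'rV[R]_n | x ord0 i \in `]a ord0 i, b ord0 i[]); last first.
  apply/seteqP; split=> [x xab i _|x xab i] /=; first by rewrite in_itv/= xab.
  by have := xab i I; rewrite /= in_itv.
apply: fin_bigcap_measurable => // i _.
apply: (@preimage_measurable _ _ _ _ (fun x : 'rV[R]_n => x ord0 i : measurableTypeR R)
  `]a ord0 i, b ord0 i[%classic); last exact: measurable_itv.
exact: measurable_coord.
Qed.

Lemma lebesgue_measure_box n (a b : 'rV[R]_n) :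
  (forall i, a ord0 i <= b ord0 i) ->
  mu n (box a b) = (\prod_i (b ord0 i - a ord0 i))%:E.
Proof.
elim: n a b => [|n IH] a b ab.
  by rewrite big_ord0 /= diracE mem_set// => -[].
have [a0 [a' aE]] := rV_consP a; have [b0 [b' bE]] := rV_consP b.
have ab0 : a0 <= b0 by have := ab ord0; rewrite aE bE !rV_cons0.
have ab' i : a' ord0 i <= b' ord0 i.
  by have := ab (lift ord0 i); rewrite aE bE !rV_consS.
rewrite lebesgue_measure_rVS (_ : _ @^-1` _ = `]a0, b0[%classic `*` box a' b').
  transitivity (leb `]a0, b0[%classic * mu n (box a' b'))%E.
    by apply: product_measure1E => //; exact: measurable_box.
  rewrite (IH _ _ ab') lebesgue_measure_itv/= lte_fin big_ord_recl aE bE !rV_cons0/=.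
  rewrite EFinM; congr (_ * _)%E.
    by case: ltP => // ba; rewrite (_ : a0 = b0) ?subrr//; apply: le_anti; rewrite ab0.
  by congr EFin; apply: eq_bigr => i _; rewrite !rV_consS.
apply/seteqP; split=> -[y v] /=; rewrite aE bE in_itv/=.
  move=> h; split; first by have := h ord0; rewrite !rV_cons0.
  by move=> i; have := h (lift ord0 i); rewrite !rV_consS.
move=> [h h'] i; case: (unliftP ord0 i) => [j|] ->; rewrite ?rV_consS ?rV_cons0//=.
Qed.

End lebesgue_rV.

(** * Norms, Borel sets and integrals of locally bounded functions *)

Section norm_rV.
Variables (R : realType) (n : nat).
Implicit Types x y : 'rV[R]_n.

Lemma normr_coord x i : `|x ord0 i| <= `|x|.
Proof.
rewrite [leRHS]/Num.norm/= mx_normrE; apply/bigmax_geP; right => /=.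
by exists (ord0, i).
Qed.

Lemma ler_norm_rV x r : 0 <= r -> (forall i, `|x ord0 i| <= r) -> `|x| <= r.
Proof.
move=> r0 h; rewrite [leLHS]/Num.norm/= mx_normrE; apply/bigmax_leP; split=> //=.
by move=> [i j] _ /=; rewrite ord1.
Qed.

Lemma ltr_norm_rV x r : 0 < r -> (forall i, `|x ord0 i| < r) -> `|x| < r.
Proof.
move=> r0 h; rewrite [ltLHS]/Num.norm/= mx_normrE; apply/bigmax_ltP; split=> //=.
by move=> [i j] _ /=; rewrite ord1.
Qed.

Lemma ball_rVE x r y : ball x r y <-> `|x - y| < r.
Proof. by rewrite -ball_normE. Qed.

Lemma open_rVP (U : set 'rV[R]_n) x : open U -> U x ->
  exists2 r, 0 < r & forall y, `|x - y| < r -> U y.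
Proof.
move=> oU Ux; have : nbhs x U by exact: open_nbhs_nbhs.
by move=> /nbhs_ballP[r /= r0 rU]; exists r => // y xy; apply: rU; apply/ball_rVE.
Qed.

Lemma nbhs_rVP (U : set 'rV[R]_n) x r : 0 < r ->
  (forall y, `|x - y| < r -> U y) -> nbhs x U.
Proof. by move=> r0 h; apply/nbhs_ballP; exists r => // y /ball_rVE /h. Qed.

Lemma box_ball x (r : R) y : 0 < r ->
  box (x - const_mx r) (x + const_mx r) y <-> `|x - y| < r.
Proof.
move=> r0; split=> [h|h i].
  apply: ltr_norm_rV => // i; have := h i; rewrite !mxE ltr_norml => /andP[? ?].
  by apply/andP; split; lra.
have := le_lt_trans (normr_coord _ i) h.
by rewrite !mxE ltr_norml => /andP[? ?]; apply/andP; split; lra.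
Qed.

(** Countably many boxes suffice to approximate points from within open sets. *)
Lemma rational_box x r : 0 < r -> exists q : 'rV[rat]_n * 'rV[rat]_n,
  box (map_mx ratr q.1) (map_mx ratr q.2) x /\
  forall y, closed_box (map_mx ratr q.1) (map_mx ratr q.2) y -> `|x - y| < r.
Proof.
move=> r0.
have /choice[q qP] (i : 'I_n) : exists q : rat * rat,
    x ord0 i - r < ratr q.1 < x ord0 i /\ x ord0 i < ratr q.2 < x ord0 i + r.
  have [|q1 h1] := @rat_in_itvoo R (x ord0 i - r) (x ord0 i); first by lra.
  have [|q2 h2] := @rat_in_itvoo R (x ord0 i) (x ord0 i + r); first by lra.
  by exists (q1, q2); move: h1 h2; rewrite !in_itv/=.
exists (\row_i (q i).1, \row_i (q i).2); split=> [i|y yB].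
  by rewrite !mxE; have [/andP[_ ->] /andP[-> _]] := qP i.
apply/box_ball => // i; have := yB i; rewrite !mxE => /andP[? ?].
by have [/andP[? ?] /andP[? ?]] := qP i; apply/andP; split; lra.
Qed.

End norm_rV.

Section borel_rV.
Variables (R : realType) (n : nat).
Local Notation mu := (lebesgue_measure_rV R n).
Implicit Types (x y : 'rV[R]_n) (D : set 'rV[R]_n) (f g : 'rV[R]_n -> R).

Lemma open_measurable_rV (U : set 'rV[R]_n) : open U -> measurable U.
Proof.
move=> oU.
pose F (q : 'rV[rat]_n * 'rV[rat]_n) : set 'rV[R]_n :=
  let B := box (map_mx ratr q.1) (map_mx ratr q.2) in
  if `[< B `<=` U >] then B else set0.
rewrite (_ : U = \bigcup_q F q).
  apply: countable_bigcupT_measurable; first exact: countableP.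
  by move=> q; rewrite /F; case: ifP => _ //; exact: measurable_box.
apply/seteqP; split=> [x Ux|x [q _]]; last first.
  by rewrite /F; case: ifPn => [/asboolP BU /BU //|_ []].
have [r r0 rU] := open_rVP oU Ux.
have [q [qx qU]] := rational_box x r0; exists q => //; rewrite /F.
by case: ifPn => // /asboolPn[] y /box_closed_box/qU; exact: rU.
Qed.

Lemma continuous_measurable_rV f : continuous f -> measurable_fun setT f.
Proof.
move=> cf; apply: (measurability _ (RGenOInfty.measurableE R)) => //.
move=> /= _ [_ [a ->] <-]; rewrite setTI; apply: open_measurable_rV.
apply: open_comp => [x _|]; first exact: cf.
rewrite (_ : [set` _] = [set x | a < x]); first exact: open_gt.
by apply/seteqP; split=> x; rewrite /= in_itv/= andbT.
Qed.

(** A half-space bounding one coordinate is a countable union of boxes. *)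
Lemma measurable_generated_by_boxes :
  @measurable _ 'rV[R]_n = <<s [set B | exists a b : 'rV[R]_n, B = box a b] >>.
Proof.
set G := [set B | _].
apply/seteqP; split; last first.
  apply: smallest_sub; first exact: sigma_algebra_measurable.
  by move=> _ [a [b ->]]; exact: measurable_box.
move=> A mA.
pose id' : g_sigma_algebraType G -> 'rV[R]_n := id.
suff /preimage_measurable : measurable_fun setT id' by exact.
apply: measurable_fun_rVP => i.
apply: (measurability _ (RGenOInfty.measurableE R)) => //.
move=> /= _ [_ [a ->] <-]; rewrite setTI.
pose lo k : 'rV[R]_n := \row_j (if j == i then a else - k%:R).
rewrite (_ : _ @^-1` _ = \bigcup_k (box (lo k) (const_mx k%:R) : set (g_sigma_algebraType G))).
  apply: bigcupT_measurable => k; apply: sub_sigma_algebra.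
  by exists (lo k), (const_mx k%:R).
apply/seteqP; split=> [x /=|x [k _ /(_ i)] /=]; rewrite in_itv/= andbT; last first.
  by rewrite !mxE eqxx => /andP[].
move=> ax; exists (Num.truncn `|x : 'rV[R]_n|).+1 => // j; rewrite !mxE.
have h := le_lt_trans (normr_coord (x : 'rV[R]_n) j) (truncnS_gt _).
move: h; rewrite ltr_norml => /andP[h ->].
by case: eqP => [->|]; rewrite andbT.
Qed.

(** Locally bounded measurable functions: stable under all the constructions
    used below, and integrable over bounded sets. *)
Definition tame f :=
  measurable_fun setT f /\ forall r, exists M, forall x, `|x| <= r -> `|f x| <= M.

Lemma tame_bounded f M : measurable_fun setT f -> (forall x, `|f x| <= M) ->
  tame f.
Proof. by move=> mf fM; split=> // r; exists M. Qed.

Lemma tame_cst c : tame (fun=> c).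
Proof. exact: (@tame_bounded _ `|c|). Qed.

Lemma tameD f g : tame f -> tame g -> tame (fun x => f x + g x).
Proof.
move=> [mf bf] [mg bg]; split=> [|r]; first exact: measurable_funD.
have [M fM] := bf r; have [N gN] := bg r; exists (M + N) => x xr.
by apply: le_trans (ler_normD _ _) _; apply: lerD; [exact: fM|exact: gN].
Qed.

Lemma tameM f g : tame f -> tame g -> tame (fun x => f x * g x).
Proof.
move=> [mf bf] [mg bg]; split=> [|r]; first exact: measurable_funM.
have [M fM] := bf r; have [N gN] := bg r; exists (M * N) => x xr.
by rewrite normrM; apply: ler_pM => //; [exact: fM|exact: gN].
Qed.

Lemma tameZ c f : tame f -> tame (fun x => c * f x).
Proof. exact/tameM/tame_cst. Qed.

Lemma tameN f : tame f -> tame (fun x => - f x).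
Proof.
by move=> /(tameZ (-1)); under eq_fun do rewrite mulN1r.
Qed.

Lemma tameB f g : tame f -> tame g -> tame (fun x => f x - g x).
Proof. by move=> tf tg; apply: tameD => //; exact: tameN. Qed.

Lemma tame_sum (I : Type) (s : seq I) (P : pred I) (F : I -> 'rV[R]_n -> R) :
  (forall i, tame (F i)) -> tame (fun x => \sum_(i <- s | P i) F i x).
Proof.
move=> tF; elim: s => [|i s IH].
  by under eq_fun do rewrite big_nil; exact: tame_cst.
under eq_fun do rewrite big_cons; case: (P i) => //.
exact: tameD.
Qed.

Lemma tame_indic D : measurable D -> tame (\1_D : _ -> R).
Proof.
move=> mD; apply: (@tame_bounded _ 1); first exact: measurable_indic.
by move=> x; rewrite indicE ger0_norm// lern1 leq_b1.
Qed.

Lemma tame_continuous f : continuous f -> tame f.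
Proof.
move=> cf; split=> [|r]; first exact: continuous_measurable_rV.
pose K := [set x : 'rV[R]_n | `|x| <= r].
have cK : compact K.
  apply: bounded_closed_compact.
    by exists r; split=> [|M rM x xr]; [exact: num_real|exact: le_trans xr (ltW rM)].
  rewrite /K (_ : [set x | _] = (fun x : 'rV[R]_n => `|x|) @^-1` [set t | t <= r])//.
  by apply: closed_comp; [move=> x _; exact: norm_continuous|exact: closed_le].
have /compact_bounded[M [_ hM]] : compact (f @` K).
  by apply: continuous_compact => //; exact: continuous_subspaceT.
by exists (M + 1) => x xr; apply: (hM (M + 1)); rewrite ?ltrDl//; exists x.
Qed.

Lemma tame_coord i : tame (fun x => x ord0 i).
Proof. by apply: tame_continuous; exact: coord_continuous. Qed.

Lemma tame_dot (F G : 'rV[R]_n -> 'rV[R]_n) :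
  (forall i, tame (fun x => F x ord0 i)) ->
  (forall i, tame (fun x => G x ord0 i)) -> tame (fun x => dot (F x) (G x)).
Proof. by move=> tF tG; apply: tame_sum => i; exact: tameM. Qed.

Definition bounded_measurable D :=
  measurable D /\ exists r, forall x, D x -> `|x| <= r.

Lemma bounded_measurableS D D' :
  measurable D' -> D' `<=` D -> bounded_measurable D -> bounded_measurable D'.
Proof. by move=> mD' D'D [_ [r rD]]; split=> //; exists r => x /D'D /rD. Qed.

Lemma bounded_measurable_lty D : bounded_measurable D -> (mu D < +oo)%E.
Proof.
move=> [mD [r rD]].
pose a : 'rV[R]_n := const_mx (`|r| + 1).
apply: (@le_lt_trans _ _ (mu (box (- a) a))).
  apply: le_measure; rewrite ?inE//; first exact: measurable_box.
  move=> x /rD xr i; rewrite !mxE -ltr_norml.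
  by apply: le_lt_trans (normr_coord _ _) _; have := ler_norm r; lra.
rewrite lebesgue_measure_box ?ltry// => i; rewrite !mxE.
by have := normr_ge0 r; lra.
Qed.

Lemma tame_integrable D f :
  bounded_measurable D -> tame f -> mu.-integrable D (EFin \o f).
Proof.
move=> bD [mf bf]; have [mD [r rD]] := bD.
apply: measurable_bounded_integrable => //.
- exact: bounded_measurable_lty.
- exact: measurable_funTS.
- have [M fM] := bf r; exists M; split; first exact: num_real.
  by move=> N MN x /rD xr; apply: le_trans (ltW MN); exact: fM.
Qed.

Section linearity.
Variable D : set 'rV[R]_n.
Hypothesis bD : bounded_measurable D.

Lemma IntD f g : tame f -> tame g ->
  \int[mu]_(x in D) (f x + g x) = \int[mu]_(x in D) f x + \int[mu]_(x in D) g x.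
Proof.
by move=> tf tg; apply: RintegralD; [exact: bD.1| |]; exact: tame_integrable.
Qed.

Lemma IntZ c f : tame f ->
  \int[mu]_(x in D) (c * f x) = c * \int[mu]_(x in D) f x.
Proof. by move=> tf; apply: RintegralZl; [exact: bD.1|exact: tame_integrable]. Qed.

Lemma IntB f g : tame f -> tame g ->
  \int[mu]_(x in D) (f x - g x) = \int[mu]_(x in D) f x - \int[mu]_(x in D) g x.
Proof.
by move=> tf tg; apply: RintegralB; [exact: bD.1| |]; exact: tame_integrable.
Qed.

Lemma Int_cst c : \int[mu]_(x in D) c = c * fine (mu D).
Proof. by apply: Rintegral_cst; case: bD. Qed.

Lemma Int_sum (I : Type) (s : seq I) (P : pred I) (F : I -> 'rV[R]_n -> R) :
  (forall i, tame (F i)) ->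
  \int[mu]_(x in D) (\sum_(i <- s | P i) F i x) =
  \sum_(i <- s | P i) \int[mu]_(x in D) F i x.
Proof.
move=> tF; elim: s => [|i s IH].
  rewrite big_nil; under eq_Rintegral do rewrite big_nil.
  by rewrite Int_cst mul0r.
rewrite big_cons; under eq_Rintegral do rewrite big_cons.
by case: (P i) => //; rewrite IntD ?IH//; exact: tame_sum.
Qed.

Lemma le_Int f g : tame f -> tame g -> (forall x, D x -> f x <= g x) ->
  \int[mu]_(x in D) f x <= \int[mu]_(x in D) g x.
Proof.
by move=> tf tg fg; apply: le_Rintegral => //; [exact: bD.1| |]; exact: tame_integrable.
Qed.

Lemma norm_Int_le f M : tame f -> (forall x, D x -> `|f x| <= M) ->
  `|\int[mu]_(x in D) f x| <= M * fine (mu D).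
Proof.
move=> tf fM; rewrite ler_norml -mulNr -!Int_cst; apply/andP; split.
  by apply: le_Int => //; [exact: tame_cst|move=> x /fM; rewrite ler_norml => /andP[]].
by apply: le_Int => //; [exact: tame_cst|move=> x /fM; rewrite ler_norml => /andP[]].
Qed.

End linearity.

Lemma eq_Int D f g : (forall x, D x -> f x = g x) ->
  \int[mu]_(x in D) f x = \int[mu]_(x in D) g x.
Proof. by move=> fg; apply: eq_Rintegral => x; rewrite inE; exact: fg. Qed.

(** Change of variables, separately for the positive and negative parts. *)
Lemma integral_scales (F : 'rV[R]_n -> 'rV[R]_n) c D f : 0 < c -> scales F c ->
  bounded_measurable D -> tame f ->
  \int[mu]_(x in F @^-1` D) f (F x) = c * \int[mu]_(x in D) f x.
Proof.
move=> c0 [mF sF] bD tf; rewrite /Rintegral.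
have mD := bD.1; have mf := tf.1.
have ifD := tame_integrable bD tf.
have mEf : measurable_fun setT (EFin \o f) by exact/measurable_EFinP.
have c0' := ltW c0.
have pos (h : 'rV[R]_n -> \bar R) : measurable_fun setT h -> (forall x, 0 <= h x)%E ->
    (\int[mu]_(x in F @^-1` D) h (F x) = c%:E * \int[mu]_(x in D) h x)%E.
  move=> mh h0.
  have mhD : measurable_fun D h by exact: measurable_funTS.
  have E1 := @ge0_integral_pushforward _ _ _ _ _ F mF mu D h mD mhD
    (fun x _ => h0 x).
  have E2 := @ge0_integral_mscale _ _ _ mu D mD (NngNum c0') h mhD
    (fun x _ => h0 x).
  apply: etrans (esym E1) (etrans _ E2).
  apply: (@eq_measure_integral _ _ _ _ (mscale (NngNum c0') mu)
    (measure_function_pushforward__canonical__measure_function_Measure mu mF)).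
  by move=> A mA _; exact: sF.
have -> : (\int[mu]_(x in F @^-1` D) (f (F x))%:E =
    c%:E * \int[mu]_(x in D) (f x)%:E)%E.
  rewrite integralE [in RHS]integralE muleBr//; last first.
    by rewrite fin_num_adde_defr// integrable_pos_fin_num.
  rewrite -(pos _ (measurable_funepos mEf))// -(pos _ (measurable_funeneg mEf))//.
  by congr (_ - _)%E; apply: eq_integral => x _; rewrite ?funeposE ?funenegE.
by rewrite fineM//; exact: integrable_fin_num.
Qed.

End borel_rV.

(** * Barycentric coordinates and Raviart--Thomas shape functions *)

Section dot_product.
Variables (R : realType) (d : nat).
Implicit Types x y z : 'rV[R]_d.

Lemma dotC x y : dot x y = dot y x.
Proof. by apply: eq_bigr => i _; rewrite mulrC. Qed.

Lemma dotDr x y z : dot x (y + z) = dot x y + dot x z.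
Proof. by rewrite -big_split; apply: eq_bigr => i _; rewrite mxE mulrDr. Qed.

Lemma dotZr c x y : dot x (c *: y) = c * dot x y.
Proof. by rewrite mulr_sumr; apply: eq_bigr => i _; rewrite mxE mulrCA. Qed.

Lemma dotNr x y : dot x (- y) = - dot x y.
Proof. by rewrite -scaleN1r dotZr mulN1r. Qed.

Lemma dotBr x y z : dot x (y - z) = dot x y - dot x z.
Proof. by rewrite dotDr dotNr. Qed.

Lemma dot0r x : dot x 0 = 0.
Proof. by rewrite -(scale0r 0) dotZr mul0r. Qed.

Lemma dot_sumr (I : Type) (s : seq I) (P : pred I) (F : I -> 'rV[R]_d) x :
  dot x (\sum_(i <- s | P i) F i) = \sum_(i <- s | P i) dot x (F i).
Proof.
elim/big_rec2: _ => [|i _ y _ <-]; first exact: dot0r.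
by rewrite dotDr.
Qed.

Lemma dotDl x y z : dot (x + y) z = dot x z + dot y z.
Proof. by rewrite dotC dotDr !(dotC z). Qed.

Lemma dotZl c x y : dot (c *: x) y = c * dot x y.
Proof. by rewrite dotC dotZr dotC. Qed.

Lemma dotNl x y : dot (- x) y = - dot x y.
Proof. by rewrite dotC dotNr dotC. Qed.

Lemma dotBl x y z : dot (x - y) z = dot x z - dot y z.
Proof. by rewrite dotDl dotNl. Qed.

Lemma dot0l x : dot 0 x = 0.
Proof. by rewrite dotC dot0r. Qed.

Lemma dot_suml (I : Type) (s : seq I) (P : pred I) (F : I -> 'rV[R]_d) x :
  dot (\sum_(i <- s | P i) F i) x = \sum_(i <- s | P i) dot (F i) x.
Proof. by rewrite dotC dot_sumr; apply: eq_bigr => i _; rewrite dotC. Qed.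

Lemma dot_delta x i : dot x (delta_mx ord0 i) = x ord0 i.
Proof.
rewrite /dot (bigD1 i)//= mxE !eqxx mulr1 big1 ?addr0// => j ji.
by rewrite mxE (negPf ji) andbF mulr0.
Qed.

Lemma dot_ge0 x : 0 <= dot x x.
Proof. by apply: sumr_ge0 => i _; rewrite -expr2 sqr_ge0. Qed.

Lemma dot_eq0 x : dot x x = 0 -> x = 0.
Proof.
move=> /eqP; rewrite psumr_eq0; last by move=> i _; rewrite -expr2 sqr_ge0.
move=> /allP h; apply/rowP => i; rewrite mxE; apply/eqP.
by have := h i (mem_index_enum _); rewrite /= mulf_eq0 orbb.
Qed.

Lemma norm_dot_le x y : `|dot x y| <= d%:R * (`|x| * `|y|).
Proof.
apply: le_trans (ler_norm_sum _ _ _) _.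
apply: (@le_trans _ _ (\sum_(i < d) `|x| * `|y|)).
  by apply: ler_sum => i _; rewrite normrM ler_pM// normr_coord.
by rewrite sumr_const card_ord -[leLHS]mulr_natl.
Qed.

End dot_product.

Section barycentric_coordinates.
Variables (R : realType) (d : nat).
Implicit Types (x y p q z : 'rV[R]_d) (T F : {fset 'rV[R]_d}).

Definition nondegenerate T := #|` T| = d.+1 /\ affinely_independent T.

(** The coordinates vanish at points p that are not vertices of T, so that
    statements on all coordinates need no membership condition. *)
Definition bary T x : 'rV[R]_d -> R := xget (fun=> 0)
  [set c | [/\ \sum_(p <- T) c p = 1, \sum_(p <- T) c p *: p = x
             & forall p, p \notin T -> c p = 0]].

(** The gradient of the affine function bary T ^~ p, read off from the values
    at the origin and at the basis vectors. *)
Definition bary_grad T p : 'rV[R]_d :=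
  \row_i (bary T (delta_mx ord0 i) p - bary T 0 p).

Lemma big_enum_vertices (V : nmodType) T (G : 'rV[R]_d -> V) :
  #|` T| = d.+1 -> \sum_(p <- T) G p = \sum_(i < d.+1) G (enum_fset T)`_i.
Proof. by move=> cT; rewrite (big_nth 0) [size _]cT big_mkord. Qed.

(** Affine independence makes the square matrix with rows (1, p), p a vertex
    of T, invertible; the coordinates of x solve the system with right-hand
    side (1, x). *)
Lemma bary_ex T x : nondegenerate T ->
  exists c : 'rV[R]_d -> R, [/\ \sum_(p <- T) c p = 1,
    \sum_(p <- T) c p *: p = x & forall p, p \notin T -> c p = 0].
Proof.
move=> [cT aT].
pose s := enum_fset T.
pose M : 'M[R]_(d.+1, 1 + d) := \matrix_(i < d.+1) row_mx 1%:M s`_i.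
pose coef (u : 'rV[R]_d.+1) p :=
  if p \in T then u ord0 (inord (index p s)) else 0.
have us : uniq s by exact: fset_uniq.
have coefE u (i : 'I_d.+1) : coef u s`_i = u ord0 i.
  rewrite /coef -[in X in if X then _ else _]/(_ \in s) mem_nth ?[size _]cT//.
  by rewrite index_uniq ?[size _]cT// inord_val.
have uM u : u *m M = row_mx (\sum_(p <- T) coef u p)%:M
                            (\sum_(p <- T) coef u p *: p).
  rewrite !big_enum_vertices// mulmx_sum_row.
  under eq_bigr do rewrite rowK -coefE scale_row_mx.
  elim/big_rec3: _ => [|i a b c _ ->]; first by rewrite raddf0 row_mx0.
  rewrite add_row_mx; congr row_mx; apply/rowP => j.
  by rewrite !ord1 !mxE eqxx !mulr1n mulr1.
have fM : row_free M.
  apply: inj_row_free => u uM0; apply/rowP => i; rewrite [RHS]mxE -coefE.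
  have := uM u; rewrite uM0 -[X in X = _]row_mx0 => /eq_row_mx[h1 h2].
  have {}h1 : \sum_(p <- T) coef u p = 0.
    by move/matrixP/(_ ord0 ord0): h1; rewrite !mxE eqxx.
  by apply: (aT _ h1 (esym h2)); apply: mem_nth; rewrite [size _]cT.
pose u := (row_mx 1%:M x : 'rV[R]_(1 + d)) *m invmx (M : 'M[R]_d.+1).
have uME : u *m M = row_mx 1%:M x.
  by rewrite /u mulmxKV//; move: fM; rewrite row_free_unit.
exists (coef u); split; last by move=> p pT; rewrite /coef (negPf pT).
  move: uME; rewrite uM => /eq_row_mx[/matrixP/(_ ord0 ord0)].
  by rewrite !mxE eqxx.
by move: uME; rewrite uM => /eq_row_mx[].
Qed.

Section nondegenerate_simplex.
Variable T : {fset 'rV[R]_d}.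
Hypothesis nT : nondegenerate T.

Lemma bary_spec x : [/\ \sum_(p <- T) bary T x p = 1,
  \sum_(p <- T) bary T x p *: p = x & forall p, p \notin T -> bary T x p = 0].
Proof.
have [c cP] := bary_ex x nT.
exact: (@xgetPex _ (fun=> 0) [set c | [/\ \sum_(p <- T) c p = 1,
  \sum_(p <- T) c p *: p = x & forall p, p \notin T -> c p = 0]]
  (ex_intro _ c cP)).
Qed.

Lemma sum_bary x : \sum_(p <- T) bary T x p = 1.
Proof. by case: (bary_spec x). Qed.

Lemma bary_comb x : \sum_(p <- T) bary T x p *: p = x.
Proof. by case: (bary_spec x). Qed.

Lemma bary_off x p : p \notin T -> bary T x p = 0.
Proof. by case: (bary_spec x) => _ _; exact. Qed.

Lemma bary_unique c x : \sum_(p <- T) c p = 1 -> \sum_(p <- T) c p *: p = x ->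
  forall p, p \in T -> c p = bary T x p.
Proof.
move=> c1 cx p pT; apply/eqP; rewrite -subr_eq0; apply/eqP.
apply: (nT.2 (fun p => c p - bary T x p)) => //.
  by rewrite sumrB c1 sum_bary subrr.
by under eq_bigr do rewrite scalerBl; rewrite sumrB cx bary_comb subrr.
Qed.

Lemma bary_affine x p : bary T x p = bary T 0 p + dot (bary_grad T p) x.
Proof.
have [pT|pT] := boolP (p \in T); last first.
  rewrite !bary_off// add0r /dot big1// => i _.
  by rewrite mxE !bary_off// subrr mul0r.
apply/esym; move: p pT; apply: bary_unique.
  rewrite big_split/= sum_bary (exchange_big_dep xpredT)//= big1 ?addr0// => i _.
  by rewrite -mulr_suml; under eq_bigr do rewrite mxE; rewrite sumrB !sum_bary subrr mul0r.
under eq_bigr do rewrite scalerDl scaler_suml.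
rewrite big_split/= bary_comb add0r exchange_big/= [RHS]row_sum_delta.
apply: eq_bigr => i _.
under eq_bigr do rewrite mulrC -scalerA mxE scalerBl.
by rewrite -scaler_sumr sumrB !bary_comb subr0.
Qed.

Lemma bary_sub x y p : bary T x p - bary T y p = dot (bary_grad T p) (x - y).
Proof. by rewrite bary_affine (bary_affine y) dotBr; lra. Qed.

Lemma sum_bary_grad : \sum_(p <- T) bary_grad T p = 0.
Proof.
apply/rowP => i; rewrite summxE mxE; under eq_bigr do rewrite mxE.
by rewrite sumrB !sum_bary subrr.
Qed.

(** The linear part of the identity x = sum_p bary p x *: p. *)
Lemma sum_bary_grad_vertex x : \sum_(p <- T) dot (bary_grad T p) x *: p = x.
Proof.
rewrite -[RHS]subr0 -[X in X - _]bary_comb -[X in _ - X]bary_comb -sumrB.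
by apply: eq_bigr => p _; rewrite -scalerBl bary_sub subr0.
Qed.

Lemma bary_vertex p q : p \in T -> bary T p q = (p == q)%:R.
Proof.
move=> pT; have [qT|qT] := boolP (q \in T); last first.
  by rewrite bary_off//; case: eqP => // pq; move: qT; rewrite -pq pT.
apply/esym; move: q qT; apply: bary_unique.
  rewrite (big_fsetD1 p)//= eqxx big_seq big1 ?addr0// => q.
  by rewrite in_fsetD1 eq_sym => /andP[/negPf ->].
rewrite (big_fsetD1 p)//= eqxx scale1r big_seq big1 ?addr0// => q.
by rewrite in_fsetD1 eq_sym => /andP[/negPf ->]; rewrite scale0r.
Qed.

Lemma bary_lin (I : Type) (s : seq I) (w : I -> R) (X : I -> 'rV[R]_d) p :
  \sum_(i <- s) w i = 1 ->
  bary T (\sum_(i <- s) w i *: X i) p = \sum_(i <- s) w i * bary T (X i) p.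
Proof.
move=> w1; rewrite bary_affine dot_sumr -[X in X + _]mul1r -w1 mulr_suml -big_split.
by apply: eq_bigr => i _ /=; rewrite dotZr -mulrDr -bary_affine.
Qed.

Lemma bary_line x y t p :
  bary T (x + t *: (y - x)) p = (1 - t) * bary T x p + t * bary T y p.
Proof. by rewrite bary_affine (bary_affine x) (bary_affine y) dotDr dotZr dotBr; ring. Qed.

Lemma bary_inj x y : (forall p, p \in T -> bary T x p = bary T y p) -> x = y.
Proof.
move=> h; rewrite -(bary_comb x) -(bary_comb y) !big_seq.
by apply: eq_bigr => p /h ->.
Qed.

(** Affine functions are interpolated exactly from the vertices. *)
Lemma affine_bary (f : 'rV[R]_d -> R) c g x : (forall x, f x = c + dot g x) ->
  f x = \sum_(p <- T) bary T x p * f p.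
Proof.
move=> fE; under eq_bigr do rewrite fE mulrDr -dotZr.
by rewrite big_split/= -mulr_suml sum_bary -dot_sumr bary_comb mul1r fE.
Qed.

Lemma hullE x : hull T x <-> forall p, 0 <= bary T x p.
Proof.
split=> [[c [c0 c1 cx]] p|h]; last first.
  by exists (bary T x); split; rewrite ?sum_bary ?bary_comb.
have [pT|/bary_off ->//] := boolP (p \in T).
by rewrite -(bary_unique c1 (esym cx)) ?c0.
Qed.

Lemma sum_sub_fset (V : nmodType) F (G : 'rV[R]_d -> V) : (F `<=` T)%fset ->
  (forall p, p \notin F -> G p = 0) -> \sum_(p <- F) G p = \sum_(p <- T) G p.
Proof.
by move=> FT GF; apply: big_fset_incl => // p _; exact: GF.
Qed.

Lemma hull_faceE F x : (F `<=` T)%fset ->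
  hull F x <-> hull T x /\ forall p, p \notin F -> bary T x p = 0.
Proof.
move=> FT; split=> [[c [c0 c1 cx]]|[/hullE h0 h]]; last first.
  exists (bary T x); split=> //; rewrite sum_sub_fset ?sum_bary ?bary_comb//.
  by move=> p /h ->; rewrite scale0r.
pose c' p := if p \in F then c p else 0.
have E p : p \in T -> c' p = bary T x p.
  apply: bary_unique.
    rewrite -(@sum_sub_fset _ F)//; last by move=> q /negPf qF; rewrite /c' qF.
    by rewrite -c1 !big_seq; apply: eq_bigr => q qF; rewrite /c' qF.
  rewrite -(@sum_sub_fset _ F)//; last first.
    by move=> q /negPf qF; rewrite /c' qF scale0r.
  by rewrite cx !big_seq; apply: eq_bigr => q qF; rewrite /c' qF.
split; last first.
  move=> p pF; have [pT|/bary_off ->//] := boolP (p \in T).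
  by rewrite -E// /c' (negPf pF).
apply/hullE => p; have [pT|/bary_off ->//] := boolP (p \in T).
by rewrite -E// /c'; case: ifP => // /c0.
Qed.

Lemma bary_barycenter p : p \in T -> bary T (barycenter T) p = d.+1%:R^-1.
Proof.
move=> pT; rewrite /barycenter nT.1 scaler_sumr bary_lin; last first.
  rewrite big_const_seq count_predT [size _]nT.1 iter_addr addr0.
  by rewrite -[LHS]mulr_natr mulVf// pnatr_eq0.
rewrite (big_fsetD1 p)//= bary_vertex// eqxx mulr1 big_seq big1 ?addr0// => q.
by rewrite in_fsetD1 => /andP[/negPf qp qT]; rewrite bary_vertex// qp mulr0.
Qed.

Section side.
Variable z : 'rV[R]_d.
Hypotheses (zT : z \in T) (d0 : (0 < d)%N).

Lemma card_side : #|` (T `\ z)%fset| = d.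
Proof. by have := cardfsD1 z T; rewrite zT nT.1 => -[]. Qed.

(** The midpoint of the side lies on the median from z, beyond the barycenter. *)
Lemma barycenter_sideE : barycenter (T `\ z)%fset =
  barycenter T + d%:R^-1 *: (barycenter T - z).
Proof.
have dn0 : d%:R != 0 :> R by rewrite pnatr_eq0 -lt0n.
have dn1 : d.+1%:R != 0 :> R by rewrite pnatr_eq0.
rewrite /barycenter card_side nT.1.
have -> : \sum_(p <- (T `\ z)%fset) p = \sum_(p <- T) p - z.
  by rewrite [in RHS](big_fsetD1 z)//= addrC addrK.
rewrite !scalerBr addrA; congr (_ - _); rewrite !scalerA -scalerDl; congr (_ *: _).
by rewrite -natr1; field; rewrite ?natr1 ?dn0 ?dn1.
Qed.

Lemma bary_barycenter_side p : p \in T ->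
  bary T (barycenter (T `\ z)%fset) p = if p == z then 0 else d%:R^-1.
Proof.
have dn0 : d%:R != 0 :> R by rewrite pnatr_eq0 -lt0n.
have dn1 : d.+1%:R != 0 :> R by rewrite pnatr_eq0.
move=> pT; rewrite barycenter_sideE bary_affine dotDr.
rewrite [dot _ (d%:R^-1 *: _)]dotZr.
rewrite [LHS]addrA -bary_affine -bary_sub bary_barycenter// bary_vertex//.
rewrite (eq_sym z); case: (p == z); rewrite -natr1 ?mulr1n ?mulr0n.
  by field; rewrite ?natr1 ?dn0 ?dn1.
by field; rewrite ?natr1 ?dn0 ?dn1.
Qed.

Lemma hull_sideE x : hull (T `\ z)%fset x <-> hull T x /\ bary T x z = 0.
Proof.
rewrite (hull_faceE _ (fsubD1set _ _)); split=> -[h h']; split=> //.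
  by apply: h'; rewrite in_fsetD1 eqxx.
move=> p; rewrite in_fsetD1 negb_and negbK => /orP[/eqP -> //|]; exact: bary_off.
Qed.

Lemma hull_barycenter_side : hull (T `\ z)%fset (barycenter (T `\ z)%fset).
Proof.
apply/hull_sideE; split; last by rewrite bary_barycenter_side// eqxx.
apply/hullE => p; have [pT|/bary_off ->//] := boolP (p \in T).
by rewrite bary_barycenter_side//; case: eqP.
Qed.

Lemma bary_grad_neq0 : bary_grad T z != 0.
Proof.
have [q qS] : exists q, q \in (T `\ z)%fset.
  by apply/fset0Pn; rewrite -cardfs_gt0 card_side.
move: qS; rewrite in_fsetD1 => /andP[qz qT].
apply/eqP => g0; have := bary_sub z q z.
rewrite !bary_vertex// eqxx (negPf qz) g0 dot0l subr0 => /eqP.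
by rewrite oner_eq0.
Qed.

(** The outer normal is the normalised opposite of the gradient of the
    coordinate at z, which is nonnegative in T and zero on the side. *)
Lemma outer_normal_ex : exists n, outer_normal T (T `\ z)%fset n.
Proof.
set g := bary_grad T z.
have g0 : 0 < dot g g.
  rewrite lt_neqAle dot_ge0 andbT eq_sym; apply/eqP => /dot_eq0 g0.
  by have := bary_grad_neq0; rewrite -/g g0 eqxx.
exists (- (Num.sqrt (dot g g))^-1 *: g); split.
- rewrite dotZl dotZr -[in X in _ * (_ * X)](sqr_sqrtr (ltW g0)) expr2.
  by field; rewrite sqrtr_eq0 -ltNge.
- move=> x y /hull_sideE[_ x0] /hull_sideE[_ y0].
  by rewrite dotZl -bary_sub x0 y0 subrr mulr0.
- move=> x y /hullE hx /hull_sideE[_ y0].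
  by rewrite dotZl -bary_sub y0 subr0 mulNr oppr_le0 mulr_ge0.
Qed.

(** Otherwise n would be orthogonal to the differences of all vertices, hence
    to everything. *)
Lemma dot_outer_normal_neq0 n x : outer_normal T (T `\ z)%fset n ->
  hull (T `\ z)%fset x -> dot (x - z) n != 0.
Proof.
move=> [n1 n2 _] hx; apply/eqP => xz0.
have vert q : q \in T -> dot n (x - q) = 0.
  move=> qT; have [->|qz] := eqVneq q z; first by rewrite dotC.
  apply: n2 => //; apply/hull_sideE; rewrite bary_vertex// (negPf qz); split=> //.
  by apply/hullE => p; rewrite bary_vertex.
suff : dot n n = 0 by rewrite n1 => /eqP; rewrite oner_eq0.
rewrite -[X in dot _ X](subKr x) -[X in dot n (x - X)]bary_comb.
rewrite -[X in X - _]scale1r -(sum_bary (x - n)) scaler_suml -sumrB dot_sumr.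
rewrite big_seq big1// => q qT.
by rewrite -scalerBr dotZr vert// mulr0.
Qed.

End side.

(** The coefficients of an element of RT_0(T) in the basis of the fields
    x - p, one for each vertex p: up to the factor d|T|, the total outward
    flux across the side opposite to p. *)
Definition RT_flux (a : 'rV[R]_d) (b : R) p := b / d.+1%:R - dot (bary_grad T p) a.

Lemma sum_RT_flux a b : \sum_(p <- T) RT_flux a b p = b.
Proof.
rewrite sumrB -dot_suml sum_bary_grad dot0l subr0.
rewrite big_const_seq count_predT [size _]nT.1 iter_addr addr0.
by rewrite -[LHS]mulr_natr mulfVK// pnatr_eq0.
Qed.

(** The fields x - p span RT_0(T); the field x - p has zero normal component on
    all sides through p. *)
Lemma RT_shapeE a b x :
  RT_shape T a b x = \sum_(p <- T) RT_flux a b p *: (x - p).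
Proof.
under eq_bigr do rewrite scalerBr.
rewrite sumrB -scaler_suml sum_RT_flux.
under [X in _ - X]eq_bigr do rewrite scalerBl -scalerA.
rewrite sumrB sum_bary_grad_vertex -scaler_sumr /RT_shape /barycenter nT.1.
by rewrite -scaler_sumr scalerBr opprB addrC addrA addrAC.
Qed.

Lemma RT_shape_barycenter a b : RT_shape T a b (barycenter T) = a.
Proof. by rewrite /RT_shape subrr scaler0 addr0. Qed.

(** Integration by parts on T divided by |T|, where only the values of the
    affine function at the midpoints of the sides and of T matter. *)
Lemma local_integration_by_parts (q : 'rV[R]_d -> R) c g a b : (0 < d)%N ->
  (forall x, q x = c + dot g x) ->
  dot g a + d%:R * b * q (barycenter T) =
  d%:R * \sum_(p <- T) RT_flux a b p * q (barycenter (T `\ p)%fset).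
Proof.
move=> d0 qE; have dn0 : d%:R != 0 :> R by rewrite pnatr_eq0 -lt0n.
have E p : p \in T -> q (barycenter (T `\ p)%fset) =
    q (barycenter T) + d%:R^-1 * dot g (barycenter T - p).
  by move=> pT; rewrite barycenter_sideE// !qE dotDr [dot _ (d%:R^-1 *: _)]dotZr addrA.
rewrite big_seq; under eq_bigr => p pT do rewrite E// mulrDr mulrCA -dotZr.
rewrite -big_seq big_split/= -mulr_suml sum_RT_flux -mulr_sumr -dot_sumr -RT_shapeE.
by rewrite RT_shape_barycenter; field.
Qed.

(** On the side opposite to z only the field x - z has a normal component. *)
Lemma dot_RT_shape_normal a b z n x : z \in T -> (0 < d)%N ->
  outer_normal T (T `\ z)%fset n -> hull (T `\ z)%fset x ->
  dot (RT_shape T a b x) n = RT_flux a b z * dot (x - z) n.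
Proof.
move=> zT d0 [_ n2 _] hx; rewrite RT_shapeE dot_suml (big_fsetD1 z)//= dotZl.
rewrite big_seq big1 ?addr0// => q; rewrite in_fsetD1 => /andP[qz qT].
rewrite dotZl dotC n2 ?mulr0//; apply/hull_sideE => //.
by rewrite bary_vertex// (negPf qz); split=> //; apply/hullE => p; rewrite bary_vertex.
Qed.

End nondegenerate_simplex.
End barycentric_coordinates.

(** * Volumes of simplices and averages over them *)

Lemma seq_lower_bound (R : realType) (A : eqType) (s : seq A) (f : A -> R) :
  (forall p, p \in s -> 0 < f p) ->
  exists2 e, 0 < e & forall p, p \in s -> e <= f p.
Proof.
elim: s => [_|p s IH h]; first by exists 1.
have [q qs|e e0 he] := IH; first by apply: h; rewrite inE qs orbT.
exists (Num.min e (f p)); first by rewrite lt_min e0 h// mem_head.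
move=> q; rewrite inE => /predU1P[->|/he]; rewrite ge_min ?lexx ?orbT//.
by move=> ->.
Qed.

Section simplex_volume.
Variables (R : realType) (d : nat).
Local Notation mu := (lebesgue_measure_rV R d).
Implicit Types (x y z p : 'rV[R]_d) (T : {fset 'rV[R]_d}).

Lemma tame_affine c (g : 'rV[R]_d) : tame (fun x => c + dot g x).
Proof.
apply: tameD; first exact: tame_cst.
by apply: tame_dot => i; [exact: tame_cst|exact: tame_coord].
Qed.

Lemma measurable_le_tame (f g : 'rV[R]_d -> R) : tame f -> tame g ->
  measurable [set x | f x <= g x].
Proof.
move=> [mf _] [mg _].
have := @preimage_measurable _ _ _ _ _ [set true] (measurable_fun_ler mf mg).
by rewrite preimage_true; apply.
Qed.

Section nondegenerate.
Variable T : {fset 'rV[R]_d}.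
Hypothesis nT : nondegenerate T.

Lemma tame_bary p : tame (fun x => bary T x p).
Proof.
by under eq_fun do rewrite (bary_affine nT); exact: tame_affine.
Qed.

Lemma bary_le1 x p : hull T x -> bary T x p <= 1.
Proof.
move=> /(hullE nT) h; have [pT|/(bary_off nT) ->//] := boolP (p \in T).
by rewrite -(sum_bary nT x) (big_fsetD1 p)//= lerDl sumr_ge0.
Qed.

Lemma measurable_hull : measurable (hull T).
Proof.
rewrite (_ : hull T = \bigcap_(p in [set` T]) [set x | 0 <= bary T x p]).
  apply: fin_bigcap_measurable; first exact: finite_fset.
  by move=> p _; apply: measurable_le_tame; [exact: tame_cst|exact: tame_bary].
apply/seteqP; split=> [x /(hullE nT) h p _|x h]; first exact: h.
apply/(hullE nT) => p; have [pT|/(bary_off nT) ->//] := boolP (p \in T).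
exact: h.
Qed.

Lemma bounded_measurable_hull : bounded_measurable (hull T).
Proof.
split; first exact: measurable_hull.
exists (\sum_(p <- T) `|p|) => x hx; rewrite -(bary_comb nT x).
apply: le_trans (ler_norm_sum _ _ _) _; apply: ler_sum => p _.
have := bary_le1 p hx; have /(hullE nT)/(_ p) := hx => ? ?.
by rewrite normrZ ger0_norm// ler_piMl.
Qed.

Lemma diameter_hull z : exists2 D, 0 <= D & forall x, hull T x -> `|x - z| <= D.
Proof.
have [_ [r hr]] := bounded_measurable_hull.
exists (`|r| + `|z|); first by rewrite addr_ge0.
move=> x /hr xr; apply: le_trans (ler_normB _ _) _; rewrite lerD2r.
exact: le_trans xr (ler_norm _).
Qed.

Lemma bary_near x e : 0 < e -> exists2 r, 0 < r &
  forall y, `|x - y| < r -> forall p, `|bary T x p - bary T y p| < e.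
Proof.
move=> e0; pose K := d%:R * (\sum_(p <- T) `|bary_grad T p|) + 1.
have K0 : 0 < K by rewrite ltr_wpDl// mulr_ge0// sumr_ge0.
exists (e / K) => [|y xy p]; first exact: divr_gt0.
have [pT|pT] := boolP (p \in T); last by rewrite !(bary_off nT)// subrr normr0.
rewrite (bary_sub nT); apply: le_lt_trans (norm_dot_le _ _) _.
rewrite mulrA; apply: (@le_lt_trans _ _ (K * `|x - y|)).
  apply: ler_wpM2r => //; apply: (@le_trans _ _ (K - 1)); last by rewrite gerBl.
  rewrite /K addrK ler_wpM2l// (big_fsetD1 p)//= lerDl.
  exact: sumr_ge0.
by rewrite -ltr_pdivlMl// mulrC.
Qed.

(** Positivity of the finitely many coordinates is an open condition. *)
Lemma hull_nbhs x : (forall p, p \in T -> 0 < bary T x p) ->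
  exists2 r, 0 < r & forall y, `|x - y| < r -> hull T y.
Proof.
move=> hx.
have [e e0 eT] : exists2 e, 0 < e & forall p, p \in T -> e <= bary T x p.
  exact: seq_lower_bound hx.
have [r r0 hr] := bary_near x e0; exists r => // y xy; apply/(hullE nT) => p.
have [pT|/(bary_off nT) ->//] := boolP (p \in T).
by have := hr y xy p; have := eT p pT; rewrite ltr_norml => ? /andP[? ?]; lra.
Qed.

Definition volume := fine (mu (hull T)).

Lemma volumeE : mu (hull T) = volume%:E.
Proof.
by rewrite /volume fineK// ge0_fin_numE// bounded_measurable_lty//;
  exact: bounded_measurable_hull.
Qed.

Lemma measure_ball_gt0 (x : 'rV[R]_d) r (U : set 'rV[R]_d) : 0 < r -> measurable U ->
  (forall y, `|x - y| < r -> U y) -> (0 < mu U)%E.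
Proof.
move=> r0 mU h.
apply: (@lt_le_trans _ _ (mu (box (x - const_mx r) (x + const_mx r)))).
  rewrite lebesgue_measure_box; last by move=> i; rewrite !mxE; lra.
  rewrite lte_fin; apply: prodr_gt0 => i _; rewrite !mxE; lra.
apply: le_measure; rewrite ?inE//; first exact: measurable_box.
by move=> y /box_ball-/(_ r0); exact: h.
Qed.

Lemma volume_gt0 : 0 < volume.
Proof.
rewrite -lte_fin -volumeE.
have [|r r0 hr] := @hull_nbhs (barycenter T).
  by move=> p pT; rewrite (bary_barycenter nT)// invr_gt0.
exact: measure_ball_gt0 r0 measurable_hull hr.
Qed.

Lemma averageZ c f : tame f -> average T (fun x => c * f x) = c * average T f.
Proof.
move=> tf; rewrite /average (IntZ bounded_measurable_hull)//.
by rewrite mulrCA.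
Qed.

Lemma averageB f g : tame f -> tame g ->
  average T (fun x => f x - g x) = average T f - average T g.
Proof.
by move=> tf tg; rewrite /average (IntB bounded_measurable_hull)// mulrBr.
Qed.

Lemma average_sum (I : Type) (s : seq I) (F : I -> 'rV[R]_d -> R) :
  (forall i, tame (F i)) -> average T (fun x => \sum_(i <- s) F i x) =
  \sum_(i <- s) average T (F i).
Proof.
by move=> tF; rewrite /average (Int_sum bounded_measurable_hull)// mulr_sumr.
Qed.

Lemma average_cst c : average T (fun=> c) = c.
Proof.
rewrite /average (Int_cst bounded_measurable_hull) mulrCA mulVf ?mulr1//.
exact: lt0r_neq0 volume_gt0.
Qed.

Lemma eq_average f g : (forall x, hull T x -> f x = g x) ->
  average T f = average T g.
Proof. by move=> fg; congr (_ * _); exact: eq_Int. Qed.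

Lemma norm_average_le f M : tame f -> (forall x, hull T x -> `|f x| <= M) ->
  `|average T f| <= M.
Proof.
move=> tf fM; rewrite /average normrM normfV (gtr0_norm volume_gt0).
rewrite ler_pdivrMl ?volume_gt0// mulrC.
by apply: norm_Int_le => //; exact: bounded_measurable_hull.
Qed.

Lemma Int_average f : \int[mu]_(x in hull T) f x = volume * average T f.
Proof. by rewrite /average mulrA mulfV ?mul1r// lt0r_neq0 ?volume_gt0. Qed.

End nondegenerate.

Section affine_map.
Variables (T T' : {fset 'rV[R]_d}) (s : 'rV[R]_d -> 'rV[R]_d).
Hypotheses (nT : nondegenerate T) (nT' : nondegenerate T').
Hypothesis sT : perm_eq (map s T) T'.

(** An affine map of simplices is determined by the images of the vertices. It
    serves for permutations of the vertices of one simplex and for the map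
    between two elements sharing a side. *)
Definition amap x := \sum_(p <- T) bary T x p *: s p.

Let sum_s (V : nmodType) (G : 'rV[R]_d -> V) :
  \sum_(q <- T') G q = \sum_(p <- T) G (s p).
Proof. by rewrite -(perm_big _ sT) big_map. Qed.

Let s_inj p q : p \in T -> q \in T -> s p = s q -> p = q.
Proof.
have : uniq (map s T) by rewrite (perm_uniq sT) fset_uniq.
move=> us pT qT E.
have [ip iq] : (index p T < size T)%N /\ (index q T < size T)%N.
  by rewrite !index_mem.
have /eqP := E; rewrite -{1}(nth_index 0 pT) -{1}(nth_index 0 qT).
rewrite -!(nth_map 0 (s 0) s)// nth_uniq ?size_map// => /eqP.
exact: index_inj.
Qed.

Lemma bary_amap x p : p \in T -> bary T' (amap x) (s p) = bary T x p.
Proof.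
move=> pT.
have cE q : q \in T -> \sum_(r <- T | s r == s q) bary T x r = bary T x q.
  move=> qT; rewrite big_mkcond (big_fsetD1 q)//= eqxx big_seq big1 ?addr0// => r.
  rewrite in_fsetD1 => /andP[rq rT]; case: eqP => // /(s_inj rT qT) E.
  by rewrite E eqxx in rq.
rewrite -(cE p pT); apply/esym.
apply: (@bary_unique _ _ _ nT' (fun q => \sum_(r <- T | s r == q) bary T x r)).
- rewrite sum_s -(sum_bary nT x) big_seq [RHS]big_seq.
  by apply: eq_bigr => q; exact: cE.
- rewrite sum_s /amap big_seq [RHS]big_seq.
  by apply: eq_bigr => q qT; rewrite cE.
- by rewrite -(perm_mem sT) map_f.
Qed.

Lemma preimage_hull_amap : amap @^-1` hull T' = hull T.
Proof.
apply/seteqP; split=> x /= /hullE h; apply/hullE => // p.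
  have [pT|/(bary_off nT) ->//] := boolP (p \in T).
  by rewrite -bary_amap//; exact: h.
have [pT'|/(bary_off nT') ->//] := boolP (p \in T').
move: pT'; rewrite -(perm_mem sT) => /mapP[q qT ->].
by rewrite bary_amap//; exact: h.
Qed.

Lemma scales_amap : exists2 c, 0 < c & scales amap c.
Proof.
pose M : 'M[R]_d := \sum_(p <- T) (bary_grad T p)^T *m s p.
have xM x : x *m M = \sum_(p <- T) dot (bary_grad T p) x *: s p.
  rewrite mulmx_sumr; apply: eq_bigr => p _; rewrite mulmxA.
  rewrite (_ : x *m _ = (dot (bary_grad T p) x)%:M) ?mul_scalar_mx//.
  apply/matrixP => i j; rewrite !ord1 !mxE eqxx mulr1n; apply: eq_bigr => k _.
  by rewrite [_^T _ _]mxE mulrC.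
have aE x : amap x = x *m M + amap 0.
  rewrite xM /amap -big_split/=; apply: eq_bigr => p _.
  by rewrite -scalerDl addrC -(bary_affine nT).
have uM : M \in unitmx.
  rewrite -row_free_unit; apply: inj_row_free => x x0.
  apply: (bary_inj nT) => p pT; rewrite -!bary_amap// aE x0 add0r.
  by [].
exists `|\det M|^-1.
  by rewrite invr_gt0 normr_gt0 -unitfE -unitmxE.
rewrite (_ : amap = fun x => x *m M + amap 0); last by apply/funext => x.
exact: scales_affine.
Qed.

(** The constant Jacobian cancels in the quotient defining the average. *)
Lemma average_amap f : tame f -> average T' f = average T (f \o amap).
Proof.
move=> tf; have [c c0 sc] := scales_amap.
rewrite /average -/(volume T) -/(volume T').
have vE : volume T = c * volume T'.
  rewrite /volume -preimage_hull_amap sc.2; last exact: measurable_hull.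
  by rewrite volumeE.
rewrite -preimage_hull_amap (integral_scales c0 sc)//; last exact: bounded_measurable_hull.
rewrite vE invfM mulrACA mulVf ?mul1r//; exact: lt0r_neq0.
Qed.

End affine_map.

(** Exchanging two vertices preserves T, so all coordinates have the same
    average, and they sum to 1. *)
Lemma average_bary T p : nondegenerate T -> p \in T ->
  average T (fun x => bary T x p) = d.+1%:R^-1.
Proof.
move=> nT pT.
have E q : q \in T -> average T (fun x => bary T x q) = average T (fun x => bary T x p).
  move=> qT.
  pose s := fun r => if r == p then q else if r == q then p else r.
  have sK : involutive s.
    move=> r; rewrite /s; case: (eqVneq r p) => [->|rp].
      by case: (eqVneq q p) => [->//|_]; rewrite eqxx.
    case: (eqVneq r q) => [->|rq]; first by rewrite eqxx.
    by rewrite (negPf rp) (negPf rq).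
  have sT r : r \in T -> s r \in T by rewrite /s; case: ifP => // _; case: ifP.
  have pe : perm_eq (map s T) T.
    apply: uniq_perm; rewrite ?map_inj_uniq ?fset_uniq//; first exact: inv_inj.
    move=> r; apply/mapP/idP => [[r' /sT + ->]//|/sT rT].
    by exists (s r); rewrite ?sK.
  rewrite (average_amap nT nT pe); last exact: tame_bary.
  apply: eq_average => x _ /=; rewrite -[in LHS](_ : s p = q).
    exact: (bary_amap nT nT pe).
  by rewrite /s eqxx.
have : \sum_(q <- T) average T (fun x => bary T x q) = 1.
  rewrite -average_sum//; last by move=> q; exact: tame_bary.
  by rewrite (_ : (fun _ => _) = fun=> 1) ?average_cst//;
    apply/funext => x; rewrite sum_bary.
rewrite big_seq; under eq_bigr => q qT do rewrite E//.
rewrite -big_seq big_const_seq count_predT [size _]nT.1 iter_addr addr0.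
have d0 : d.+1%:R != 0 :> R by rewrite pnatr_eq0.
by move=> h; apply: (mulIf d0); rewrite mulr_natr h mulVf.
Qed.

Lemma average_affine T (q : 'rV[R]_d -> R) c g : nondegenerate T ->
  (forall x, q x = c + dot g x) -> average T q = q (barycenter T).
Proof.
move=> nT qE; rewrite (affine_bary nT (barycenter T) qE).
rewrite (_ : average T q = average T (fun x => \sum_(p <- T) q p * bary T x p)).
  rewrite average_sum//; last by move=> p; apply: tameZ; exact: tame_bary.
  rewrite big_seq [RHS]big_seq; apply: eq_bigr => p pT.
  rewrite averageZ//; last exact: tame_bary.
  by rewrite average_bary// (bary_barycenter nT)// mulrC.
apply: eq_average => x _; rewrite (affine_bary nT x qE).
by apply: eq_bigr => p _; rewrite mulrC.
Qed.

End simplex_volume.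

(** * Gauss' theorem on a cone *)

Section cone.
Variables (R : realType) (d : nat).
Local Notation mu := (lebesgue_measure_rV R d).
Implicit Types (x y z p : 'rV[R]_d) (T : {fset 'rV[R]_d}).

Lemma measurable_invr : measurable_fun setT (fun x : R => x^-1).
Proof.
have -> : [set: R] = [set x | x != 0] `|` [set 0].
  by apply/seteqP; split=> x //= _; case: (eqVneq x 0) => [->|]; [right|left].
have o : open [set x : R | x != 0].
  exact: open_neq.
apply/measurable_funU => //; first exact: open_measurable.
split.
  apply: open_continuous_measurable_fun => // x; rewrite inE /= => x0.
  exact: inv_continuous.
exact: measurable_fun_set1.
Qed.

(** Central projection of a simplex from its vertex z onto the opposite side,
    extended by 0 to points with unit coordinate at z, so that it is invariant
    under the homotheties of centre z. *)
Definition cone_proj T z x :=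
  \sum_(p <- (T `\ z)%fset) (bary T x p / (1 - bary T x z)) *: p.

(** The values of psi on the side opposite to z, as a function on the cone. Its
    average over T is the average of psi over that side. *)
Definition side_trace T z (psi : 'rV[R]_d -> R) x :=
  (bary T x z != 1)%:R * psi (cone_proj T z x).

Definition homothety z t x := z + t *: (x - z).

Lemma scales_homothety z t : t != 0 -> scales (homothety z t) (`|t| ^+ d)^-1.
Proof.
move=> t0; rewrite (_ : homothety z t = fun x => x *m t%:M + (1 - t) *: z).
  rewrite -normrX -det_scalar; apply: scales_affine.
  by rewrite unitmxE det_scalar unitrX// unitfE.
apply/funext => x; rewrite /homothety mul_mx_scalar scalerBr scalerBl scale1r.
by rewrite addrCA addrA.
Qed.

Section one_simplex.
Variables (T : {fset 'rV[R]_d}) (z : 'rV[R]_d).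
Hypotheses (nT : nondegenerate T) (zT : z \in T).

Lemma bary_homothety t x p :
  bary T (homothety z t x) p = (1 - t) * (z == p)%:R + t * bary T x p.
Proof. by rewrite (bary_line nT) (bary_vertex nT). Qed.

Definition cone t := hull T `&` [set x | 1 - bary T x z <= t].

Lemma measurable_cone t : measurable (cone t).
Proof.
apply: measurableI; first exact: measurable_hull.
apply: measurable_le_tame; last exact: tame_cst.
by apply: tameB; [exact: tame_cst|exact: tame_bary].
Qed.

Lemma bounded_measurable_cone t : bounded_measurable (cone t).
Proof.
by apply: bounded_measurableS (bounded_measurable_hull nT);
  [exact: measurable_cone|move=> x []].
Qed.

(** The cone of ratio t is the image of T under the homothety. *)
Lemma preimage_cone t : 0 < t <= 1 -> homothety z t @^-1` cone t = hull T.
Proof.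
move=> /andP[t0 t1]; apply/seteqP; split=> x.
  move=> [/(hullE nT) h]; rewrite /= bary_homothety eqxx mulr1 => hz.
  apply/(hullE nT) => p; have := h p; rewrite bary_homothety.
  have [zp|] := eqVneq z p; last by rewrite mulr0 add0r pmulr_rge0.
  move: hz; rewrite zp => hz _.
  have {hz} : (1 - bary T x p) <= 1.
    by rewrite -(ler_pM2l t0); lra.
  by rewrite gerBl.
move=> hx; have /(hullE nT) h := hx; split.
  apply/(hullE nT) => p; rewrite bary_homothety.
  by rewrite addr_ge0 ?mulr_ge0 ?subr_ge0// ltW.
rewrite /= bary_homothety eqxx mulr1.
have : t * (1 - bary T x z) <= t * 1 by rewrite ler_pM2l// gerBl.
lra.
Qed.

Lemma expr_onem_bounds n (t : R) : 0 <= t <= 1 ->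
  0 <= 1 - t ^+ n <= n%:R * (1 - t).
Proof.
move=> /andP[t0 t1]; elim: n => [|n /andP[h0 h1]]; first by rewrite expr0 subrr mul0r lexx.
have tn0 : 0 <= t ^+ n by exact: exprn_ge0.
have tn1 : t ^+ n <= 1 by rewrite -subr_ge0.
have e0 : 0 <= 1 - t by rewrite subr_ge0.
have := mulr_ge0 tn0 e0; have : 0 <= (1 - t ^+ n) * (1 - t) by apply: mulr_ge0.
by rewrite exprSr -natr1 => ? ?; apply/andP; split; lra.
Qed.

Lemma expr_onem_linear n (t : R) : 0 <= t <= 1 ->
  `|1 - t ^+ n - n%:R * (1 - t)| <= n%:R ^+ 2 * (1 - t) ^+ 2.
Proof.
move=> t01; elim: n => [|n IH].
  by rewrite expr0 subrr mul0r subrr normr0 expr0n mul0r.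
have /andP[h0 h1] := expr_onem_bounds n t01; have /andP[t0 t1] := t01.
have e0 : 0 <= 1 - t by rewrite subr_ge0.
rewrite (_ : _ - _ = (1 - t ^+ n - n%:R * (1 - t)) - (1 - t ^+ n) * (1 - t)).
  apply: le_trans (ler_normB _ _) _.
  apply: (@le_trans _ _ (n%:R ^+ 2 * (1 - t) ^+ 2 + n%:R * (1 - t) * (1 - t))).
    by apply: lerD => //; rewrite ger0_norm ?mulr_ge0// ler_wpM2r.
  have n0 : 0 <= n%:R :> R by [].
  have : 0 <= (n%:R + 1) * (1 - t) ^+ 2 by rewrite mulr_ge0 ?sqr_ge0// addr_ge0.
  by rewrite -natr1; nra.
by rewrite exprSr -natr1; ring.
Qed.

Lemma eq0_of_norm_le (a K : R) :
  (forall e, 0 < e <= 2^-1 -> `|a| <= K * e) -> a = 0.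
Proof.
move=> h; apply/eqP/negPn/negP => a0.
have na : 0 < `|a| by rewrite normr_gt0.
pose k := `|K| + 1.
have k0 : 0 < k by rewrite /k ltr_wpDl.
pose e := Num.min 2^-1 (`|a| / (2 * k)).
have e0 : 0 < e by rewrite lt_min invr_gt0 ltr0n/= divr_gt0// mulr_gt0.
have /h ae : 0 < e <= 2^-1 by rewrite e0/= ge_min lexx.
have : e <= `|a| / (2 * k) by rewrite ge_min lexx orbT.
rewrite ler_pdivlMr ?mulr_gt0// => ek.
have Kk : K <= k by rewrite /k; have := ler_norm K; lra.
have : K * e <= k * e by rewrite ler_pM2r.
by nra.
Qed.

(** Change of variables; the factor t ^ d is the volume ratio of the cone. *)
Lemma average_homothety f t : tame f -> 0 < t <= 1 ->
  t ^+ d * average T (f \o homothety z t) =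
  (volume T)^-1 * \int[mu]_(x in cone t) f x.
Proof.
move=> tf t01; have /andP[t0 t1] := t01.
have td0 : t ^+ d != 0 by rewrite expf_neq0// lt0r_neq0.
have sh := scales_homothety z (lt0r_neq0 t0).
rewrite /average -/(volume T) -[in X in Rintegral _ X _](preimage_cone t01).
rewrite (integral_scales _ sh)//; first last.
- exact: bounded_measurable_cone.
- by rewrite invr_gt0 exprn_gt0// normr_gt0 lt0r_neq0.
rewrite gtr0_norm// mulrCA; congr (_ * _).
by rewrite mulrA mulfV// mul1r.
Qed.

Lemma measure_cone t : 0 < t <= 1 -> fine (mu (cone t)) = t ^+ d * volume T.
Proof.
move=> t01; have := average_homothety (@tame_cst R d 1) t01.
rewrite (_ : (fun=> 1) \o _ = fun=> 1)// average_cst// mulr1 => ->.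
rewrite (Int_cst (bounded_measurable_cone t)) mul1r mulrAC mulVf ?mul1r//.
by rewrite lt0r_neq0// volume_gt0.
Qed.

Lemma measure_off_cone t : 0 < t <= 1 ->
  fine (mu (hull T `\` cone t)) = (1 - t ^+ d) * volume T.
Proof.
move=> t01; have mh := measurable_hull nT; have mc := measurable_cone t.
have bc := bounded_measurable_cone t.
have fh := bounded_measurable_lty (bounded_measurable_hull nT).
have fc := bounded_measurable_lty bc.
rewrite measureD// (_ : hull T `&` cone t = cone t); last first.
  by apply/setIidPr => x [].
by rewrite fineB ?ge0_fin_numE// -/(volume T) measure_cone// mulrBl mul1r.
Qed.

Lemma bounded_measurable_off_cone t : bounded_measurable (hull T `\` cone t).
Proof.
apply: bounded_measurableS (bounded_measurable_hull nT); last by move=> x [].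
by apply: measurableD; [exact: measurable_hull|exact: measurable_cone].
Qed.

(** A face meets the homothetic copies with ratio t < 1 from the opposite
    vertex in the empty set, while these exhaust the volume as t tends to 1. *)
Lemma measure_face0 : mu (hull T `&` [set x | bary T x z = 0]) = 0%E.
Proof.
set F := _ `&` _.
have mF : measurable F.
  apply: measurableI; first exact: measurable_hull.
  rewrite (_ : [set x | _] = [set x | bary T x z <= 0] `&` [set x | 0 <= bary T x z]).
    by apply: measurableI; apply: measurable_le_tame;
      (exact: tame_bary || exact: tame_cst).
  apply/seteqP; split=> x /=; first by move=> ->.
  by move=> [? ?]; apply/eqP; rewrite eq_le; apply/andP.
have bF : bounded_measurable F.
  by apply: bounded_measurableS mF _ (bounded_measurable_hull nT) => x [].
have fF : mu F \is a fin_num by rewrite ge0_fin_numE// bounded_measurable_lty.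
rewrite -(fineK fF); congr EFin.
apply: (@eq0_of_norm_le _ (d%:R * volume T)) => e /andP[e0 e2].
rewrite ger0_norm ?fine_ge0//.
have t01 : 0 < 1 - e <= 1 by lra.
apply: (@le_trans _ _ (fine (mu (hull T `\` cone (1 - e))))).
  apply: fine_le => //.
    rewrite ge0_fin_numE// bounded_measurable_lty//.
    exact: bounded_measurable_off_cone.
  apply: le_measure; rewrite ?inE//; first exact: (bounded_measurable_off_cone _).1.
  move=> x [hx /= x0]; split=> // -[_ /=]; rewrite x0 subr0.
  by apply/negP; rewrite -ltNge; lra.
rewrite measure_off_cone// mulrAC ler_pM2r ?volume_gt0//.
have /andP[_] : 0 <= 1 - (1 - e) ^+ d <= d%:R * (1 - (1 - e)).
  by apply: expr_onem_bounds; lra.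
by rewrite subKr.
Qed.

Lemma cone_projE x : bary T x z != 1 ->
  cone_proj T z x = z + (1 - bary T x z)^-1 *: (x - z).
Proof.
move=> x1; have u0 : 1 - bary T x z != 0 by rewrite subr_eq0 eq_sym.
rewrite /cone_proj; under eq_bigr do rewrite mulrC -scalerA.
rewrite -scaler_sumr.
have -> : \sum_(p <- (T `\ z)%fset) bary T x p *: p =
    (1 - bary T x z) *: z + (x - z).
  rewrite -[X in _ = _ + (X - _)](bary_comb nT x) (big_fsetD1 z zT)/=.
  by rewrite scalerBl scale1r [RHS]addrA [X in _ = X - _]addrA subrK [RHS]addrC addKr.
by rewrite scalerDr scalerA mulVf// scale1r.
Qed.

Lemma cone_proj_hull x : hull T x -> bary T x z != 1 ->
  hull (T `\ z)%fset (cone_proj T z x).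
Proof.
move=> hx x1; have u0 : 1 - bary T x z != 0 by rewrite subr_eq0 eq_sym.
have u1 : 0 < 1 - bary T x z.
  by rewrite lt_neqAle eq_sym u0 subr_ge0 bary_le1.
have /(hullE nT) h := hx.
exists (fun p => bary T x p / (1 - bary T x z)); split=> //.
  by move=> p _; apply: divr_ge0 => //; exact: ltW.
rewrite -mulr_suml (_ : \sum_(p <- _) _ = 1 - bary T x z) ?divff//.
by rewrite -[X in _ = X - _](sum_bary nT x) (big_fsetD1 z zT)/= addrC addrK.
Qed.

Lemma side_trace_homothety psi t x : t != 0 ->
  side_trace T z psi (homothety z t x) = side_trace T z psi x.
Proof.
move=> t0; rewrite /side_trace.
have E : 1 - bary T (homothety z t x) z = t * (1 - bary T x z).
  by rewrite bary_homothety eqxx mulr1; ring.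
congr ((nat_of_bool (~~ _))%:R * psi _).
  by rewrite -[LHS]subr_eq0 -[RHS]subr_eq0 -oppr_eq0 opprB E mulf_eq0 (negPf t0)/= -oppr_eq0 opprB.
rewrite /cone_proj E big_seq [RHS]big_seq; apply: eq_bigr => p.
rewrite in_fsetD1 => /andP[pz _]; rewrite bary_homothety eq_sym (negPf pz).
rewrite mulr0 add0r invfM mulrACA; congr (_ *: _).
by rewrite divff// mul1r.
Qed.

Lemma tame_side_trace (psi : 'rV[R]_d -> R) M : measurable_fun setT psi ->
  (forall x, `|psi x| <= M) -> tame (side_trace T z psi).
Proof.
move=> mpsi psiM.
have mb p : measurable_fun setT (fun x => bary T x p) := (tame_bary nT p).1.
apply: (@tame_bounded _ _ _ M).
  apply: measurable_funM.
    apply: (measurableT_comp (f := fun b : bool => (~~ b)%:R : R)) => //.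
    by apply: measurable_fun_eqr => //; exact: mb.
  apply: measurableT_comp => //.
  apply: measurable_fun_rVP => i.
  under eq_fun do rewrite /cone_proj summxE.
  apply: measurable_sum => p; under eq_fun do rewrite mxE.
  apply: measurable_funM => //; apply: measurable_funM; first exact: mb.
  apply: measurableT_comp; first exact: measurable_invr.
  by apply: measurable_funB => //; exact: mb.
move=> x; rewrite /side_trace normrM; case: (_ == _); rewrite ?normr0 ?mul0r ?normr1 ?mul1r//.
exact: le_trans (psiM 0).
Qed.

(** The difference is an integral over T minus the cone of ratio t, of relative
    volume 1 - t ^ d. *)
Lemma average_sub_homothety f t m : tame f -> 0 < t <= 1 ->
  (forall x, hull T x -> t < 1 - bary T x z -> `|f x| <= m) ->
  `|average T f - t ^+ d * average T (f \o homothety z t)| <= m * (1 - t ^+ d).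
Proof.
move=> tf t01 fm; rewrite average_homothety//.
have bo := bounded_measurable_off_cone t.
rewrite /average -/(volume T) -mulrBr.
have -> : \int[mu]_(x in hull T) f x - \int[mu]_(x in cone t) f x =
    \int[mu]_(x in hull T `\` cone t) f x.
  have E : hull T = (hull T `\` cone t) `|` cone t.
    by rewrite setUC setDUK// => x [].
  rewrite [in X in X - _]E Rintegral_setU; first by rewrite addrK.
  - exact: bo.1.
  - exact: measurable_cone.
  - rewrite -E; apply: tame_integrable => //; exact: bounded_measurable_hull.
  - by apply/disj_setPS => x [[_ ?]].
have V0 := volume_gt0 nT.
rewrite normrM normfV (gtr0_norm V0) ler_pdivrMl// mulrCA [X in _ <= _ * X]mulrC.
rewrite -measure_off_cone//; apply: norm_Int_le => // x [hx cx].
apply: fm => //; rewrite ltNge; apply/negP => h; exact: cx.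
Qed.

Section gauss.
Variables (psi : 'rV[R]_d -> R) (G : 'rV[R]_d -> 'rV[R]_d) (L C M : R).
Hypotheses (tpsi : tame psi) (tG : forall i, tame (fun x => G x ord0 i)).
Hypothesis psiM : forall x, `|psi x| <= M.
Hypothesis psiL : forall x y, `|psi x - psi y| <= L * `|x - y|.
Hypothesis psiC : forall x h,
  `|psi (x + h) - psi x - dot h (G x)| <= C * `|h| ^+ 2.

(** Gauss' theorem for the field (x - z) psi, which is tangential to all sides
    of T through z. With h the homothety of centre z and ratio t = 1 - e, a
    Taylor expansion gives the average of psi - psi \o h up to O(e^2); on the
    other hand psi is close to its h-invariant side trace on the layer
    T \ h(T) of thickness e next to the opposite side. Comparing the terms of
    order e yields the identity. *)
Theorem gauss_cone :
  average T (fun x => dot (x - z) (G x)) + d%:R * average T psi =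
  d%:R * average T (side_trace T z psi).
Proof.
have [D D0 hD] := diameter_hull nT z.
have tst : tame (side_trace T z psi) := tame_side_trace tpsi.1 psiM.
have tdot : tame (fun x => dot (x - z) (G x)).
  apply: tame_dot => // i; under eq_fun do rewrite !mxE.
  by apply: tameD; [exact: tame_coord|exact: tame_cst].
set I2 := average T (fun x => dot _ _); set I1 := average T psi.
set Is := average T _.
apply/eqP; rewrite -subr_eq0; apply/eqP.
pose u := I1 - Is.
(* The sum of the constants of the O(e^2) terms estimated below. *)
pose K := 2 * `|L| * D * d%:R + `|C| * D ^+ 2 + d%:R ^+ 2 * `|u| + d%:R * `|I2|.
apply: (@eq0_of_norm_le _ K) => e /andP[e0 e2].
pose t := 1 - e; pose h := homothety z t.
have t01 : 0 < t <= 1 by rewrite /t; lra.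
have t01' : 0 <= t <= 1 by rewrite /t; lra.
have tpsih : tame (psi \o h).
  have t0 : t != 0 by apply: lt0r_neq0; case/andP: t01.
  have [mh _] := scales_homothety z t0.
  apply: (@tame_bounded _ _ _ M); first exact: (measurableT_comp tpsi.1 mh).
  by move=> x; exact: psiM.
pose E := average T (psi \o h).
have r1 : `|I1 - E - e * I2| <= `|C| * D ^+ 2 * e ^+ 2.
  rewrite -(averageZ nT e tdot) -(averageB nT tpsi tpsih).
  rewrite -(averageB nT (tameB tpsi tpsih) (tameZ e tdot)).
  apply: (norm_average_le nT (tameB (tameB tpsi tpsih) (tameZ e tdot))).
  move=> x hx; have := psiC x (- e *: (x - z)).
  have -> : x + - e *: (x - z) = h x.
    by rewrite /h /homothety /t scaleNr [(1 - e) *: _]scalerBl scale1r addrA addrCA subrr addr0.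
  rewrite dotZl mulNr opprK => hC.
  have -> : psi x - (psi \o h) x - e * dot (x - z) (G x) =
      - (psi (h x) - psi x + e * dot (x - z) (G x)) by rewrite /=; ring.
  rewrite normrN; apply: le_trans hC _.
  rewrite normrZ normrN (gtr0_norm e0) exprMn.
  have xD : `|x - z| ^+ 2 <= D ^+ 2 by rewrite lerXn2r ?nnegrE// hD.
  have e20 : 0 <= e ^+ 2 by exact: sqr_ge0.
  rewrite mulrCA [leRHS]mulrC ler_wpM2l//.
  apply: (@le_trans _ _ (`|C| * `|x - z| ^+ 2)).
    by rewrite ler_wpM2r ?sqr_ge0// ler_norm.
  by rewrite ler_wpM2l.
have r4 := expr_onem_bounds d t01'.
have e1 : 1 - t = e by rewrite /t subKr.
have r2 : `|u - t ^+ d * (E - Is)| <= 2 * `|L| * D * d%:R * e ^+ 2.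
  pose w x := psi x - side_trace T z psi x.
  have tw : tame w by exact: tameB.
  have wE : u - t ^+ d * (E - Is) =
      average T w - t ^+ d * average T (w \o h).
    rewrite /w averageB// -/I1 -/Is -/u; congr (_ - _ * _).
    rewrite /Is -averageB//; apply: eq_average => // x _ /=.
    by rewrite side_trace_homothety// lt0r_neq0//; case/andP: t01.
  rewrite wE; apply: (@le_trans _ _ (2 * `|L| * D * e * (1 - t ^+ d))).
    apply: average_sub_homothety => // x hx; rewrite /t => xt.
    have xz1 : bary T x z != 1 by apply/eqP => x1; move: xt; rewrite x1; lra.
    rewrite /w /side_trace xz1 mul1r.
    have u0 : 2^-1 < 1 - bary T x z by lra.
    have /(hullE nT)/(_ z) xz0 := hx.
    apply: le_trans (psiL _ _) _.
    have -> : x - cone_proj T z x =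
        - (bary T x z / (1 - bary T x z)) *: (x - z).
      rewrite cone_projE// opprD addrA -[X in X - _]scale1r -scalerBl.
      by congr (_ *: _); field; lra.
    rewrite normrZ normrN ger0_norm; last by rewrite divr_ge0//; lra.
    have q2 : bary T x z / (1 - bary T x z) <= 2 * e.
      by rewrite ler_pdivrMr; [nra|lra].
    have q0 : 0 <= bary T x z / (1 - bary T x z) by rewrite divr_ge0//; lra.
    apply: (@le_trans _ _ (`|L| * (2 * e * D))).
      apply: (@le_trans _ _ (`|L| * (bary T x z / (1 - bary T x z) * `|x - z|))).
        by rewrite ler_wpM2r ?ler_norm// mulr_ge0.
      by rewrite ler_wpM2l// ler_pM// hD.
    by rewrite le_eqVlt; apply/orP; left; apply/eqP; ring.
  have k0 : 0 <= 2 * `|L| * D * e by rewrite !mulr_ge0// ltW.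
  move: r4 => /andP[_]; rewrite e1 => r4.
  apply: le_trans (ler_wpM2l k0 r4) _.
  by rewrite le_eqVlt; apply/orP; left; apply/eqP; ring.
have r3 := expr_onem_linear d t01'; rewrite e1 in r3 r4.
set X := I2 + _ - _.
suff : `|e * X| <= K * e ^+ 2.
  by rewrite normrM (gtr0_norm e0) expr2 mulrA mulrC ler_pM2r.
have -> : e * X = (u - t ^+ d * (E - Is)) - t ^+ d * (I1 - E - e * I2)
    - (1 - t ^+ d - d%:R * e) * u + (1 - t ^+ d) * (e * I2).
  by rewrite /X /u; ring.
have td0 : 0 <= t ^+ d by rewrite exprn_ge0//; case/andP: t01'.
have td1 : t ^+ d <= 1 by rewrite -subr_ge0; case/andP: r4.
have -> : K * e ^+ 2 = 2 * `|L| * D * d%:R * e ^+ 2 + `|C| * D ^+ 2 * e ^+ 2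
   + d%:R ^+ 2 * e ^+ 2 * `|u| + d%:R * e * (e * `|I2|) by rewrite /K; ring.
apply: le_trans (ler_normD _ _) _; apply: lerD; last first.
  rewrite !normrM (gtr0_norm e0) ger0_norm; last by case/andP: r4.
  by apply: ler_wpM2r; [rewrite mulr_ge0// ltW|case/andP: r4].
apply: le_trans (ler_normB _ _) _; apply: lerD; last first.
  by rewrite normrM ler_wpM2r.
apply: le_trans (ler_normB _ _) _; apply: lerD => //.
rewrite normrM ger0_norm//; apply: le_trans r1.
by rewrite ler_piMl.
Qed.

End gauss.
End one_simplex.

(** The side averages seen from the two elements sharing a side agree: the
    affine map exchanging the opposite vertices intertwines the projections. *)
Theorem average_side_trace_eq T T' z z' (psi : 'rV[R]_d -> R) M :
  nondegenerate T -> nondegenerate T' -> z \in T -> z' \in T' ->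
  (T `\ z = T' `\ z')%fset -> measurable_fun setT psi ->
  (forall x, `|psi x| <= M) ->
  average T (side_trace T z psi) = average T' (side_trace T' z' psi).
Proof.
move=> nT nT' zT zT' TT' mpsi psiM.
pose s p := if p == z then z' else p.
have sS p : p \in (T `\ z)%fset -> s p = p.
  by rewrite in_fsetD1 /s => /andP[/negPf ->].
have pe : perm_eq (map s T) T'.
  have sz : s z = z' by rewrite /s eqxx.
  apply: uniq_perm; [|exact: fset_uniq|].
    rewrite map_inj_in_uniq ?fset_uniq// => p q pT qT.
    have notin r : r \in T -> r != z -> r != z'.
      move=> rT rz; have : r \in (T' `\ z')%fset by rewrite -TT' in_fsetD1 rz.
      by rewrite in_fsetD1 => /andP[].
    rewrite /s; case: (eqVneq p z) => [->|pz]; case: (eqVneq q z) => [->|qz] //.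
      by move=> E; have := notin q qT qz; rewrite -E eqxx.
    by move=> E; have := notin p pT pz; rewrite E eqxx.
  move=> q; apply/mapP/idP => [[p pT ->]|qT'].
    have [->|pz] := eqVneq p z; first by rewrite sz.
    have pS : p \in (T `\ z)%fset by rewrite in_fsetD1 pz.
    by rewrite sS//; move: pS; rewrite TT' in_fsetD1 => /andP[].
  have [->|qz'] := eqVneq q z'; first by exists z; rewrite ?sz.
  have qS : q \in (T `\ z)%fset by rewrite TT' in_fsetD1 qz'.
  by exists q; rewrite ?sS//; move: qS; rewrite in_fsetD1 => /andP[].
have tst : tame (side_trace T' z' psi) by exact: tame_side_trace mpsi psiM.
rewrite [RHS](average_amap nT nT' pe)//; apply: eq_average => // x _ /=.
have bz : bary T' (amap T s x) z' = bary T x z.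
  by rewrite -(bary_amap nT nT' pe x zT) /s eqxx.
rewrite /side_trace /cone_proj bz -TT'; congr (_ * psi _).
rewrite big_seq [RHS]big_seq; apply: eq_bigr => p pS.
have pT : p \in T by move: pS; rewrite in_fsetD1 => /andP[].
by rewrite -[in LHS](bary_amap nT nT' pe x pT) sS.
Qed.

End cone.

(** * Test functions *)

Section differential_estimates.
Variables (R : realType) (d : nat).
Implicit Types (f : 'rV[R]_d -> R) (x y h : 'rV[R]_d).
Local Notation e_ i := (delta_mx ord0 i : 'rV[R]_d).

Lemma is_derive_line f x v (t : R) : derivable f (x + t *: v) v ->
  is_derive t 1 (fun s => f (x + s *: v)) ('D_v f (x + t *: v)).
Proof.
move=> df.
have E : (fun h : R => h^-1 *: (((fun s => f (x + s *: v)) \o shift t) (h *: 1) -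
      f (x + t *: v))) =
    (fun h : R => h^-1 *: ((f \o shift (x + t *: v)) (h *: v) - f (x + t *: v))).
  apply/funext => h /=; congr (_ *: (f _ - _)).
  by rewrite -[h *: 1]/(h * 1) mulr1 scalerDl addrCA addrC.
by apply: DeriveDef; rewrite /derivable /derive E.
Qed.

Lemma mvt_line f x v (t : R) : (forall y, derivable f y v) ->
  exists2 s, `|s| <= `|t| & f (x + t *: v) - f x = t * 'D_v f (x + s *: v).
Proof.
move=> df; pose g s := f (x + s *: v).
have dg (s : R) : is_derive s (1 : R) g ('D_v f (x + s *: v)) by exact: is_derive_line.
have cg : continuous g.
  move=> s; apply/differentiable_continuous/derivable1_diffP.
  exact: (@ex_derive _ _ _ _ _ _ _ (dg s)).
have [t0|t0] := leP 0 t.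
  have [//|s] := @MVT_segment R g _ _ _ t0 (fun s _ => dg s).
    exact: continuous_subspaceT.
  rewrite in_itv/= subr0 => /andP[s0 st] E; exists s.
    by rewrite !ger0_norm.
  by rewrite mulrC -E /g scale0r addr0.
have [//|s] := @MVT_segment R g _ _ _ (ltW t0) (fun s _ => dg s).
  exact: continuous_subspaceT.
rewrite in_itv/= sub0r => /andP[s0 st] E; exists s.
  by rewrite !ler0_norm ?lerN2// ltW.
have -> : t * 'D_v f (x + s *: v) = - ('D_v f (x + s *: v) * - t) by ring.
by rewrite -E /g scale0r addr0 opprB.
Qed.

(** Mean value theorem along a path changing one coordinate at a time: only
    partial derivatives are involved. *)
Lemma mvt_coordinates f x h : (forall i y, derivable f y (e_ i)) ->
  exists2 xi : 'I_d -> 'rV[R]_d, forall i, `|xi i - x| <= `|h| &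
    f (x + h) - f x = \sum_i h ord0 i * 'D_(e_ i) f (xi i).
Proof.
move=> df.
pose X (k : nat) : 'rV[R]_d := x + \row_i (if (i < k)%N then h ord0 i else 0).
have XS (i : 'I_d) : X i.+1 = X i + h ord0 i *: e_ i.
  rewrite /X -addrA; congr (_ + _); apply/rowP => j; rewrite !mxE eqxx/=.
  rewrite ltnS leq_eqVlt; case: (eqVneq j i) => [->|ji].
    by rewrite eqxx ltnn add0r mulr1.
  by rewrite (_ : (j == i :> nat) = false) ?mulr0 ?addr0//; exact/negbTE.
have /choice[s sP] (i : 'I_d) : exists s, `|s| <= `|h ord0 i| /\
    f (X i.+1) - f (X i) = h ord0 i * 'D_(e_ i) f (X i + s *: e_ i).
  by rewrite XS; have [s] := mvt_line (X i) (h ord0 i) (df i); exists s.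
exists (fun i : 'I_d => X i + s i *: e_ i).
  move=> i; apply: ler_norm_rV => // j; rewrite !mxE eqxx/=.
  rewrite (_ : _ - _ = (if (j < i)%N then h ord0 j else 0) + s i * (j == i)%:R).
    case: (eqVneq j i) => [->|ji].
      rewrite ltnn add0r mulr1; apply: le_trans (normr_coord h i); exact: (sP i).1.
    rewrite mulr0 addr0; case: ifP => _; [exact: normr_coord|by rewrite normr0].
  by set a := if _ then _ else _; set b := _%:R; ring.
have -> : f (x + h) - f x = f (X d) - f (X 0%N).
  congr (f _ - f _); rewrite /X.
    by congr (_ + _); apply/rowP => i; rewrite mxE ltn_ord.
  by rewrite -[LHS]addr0; congr (_ + _); apply/rowP => i; rewrite !mxE.
rewrite -(telescope_sumr (fun k => f (X k)) (leq0n d)) big_mkord.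
by apply: eq_bigr => i _; exact: (sP i).2.
Qed.

Section compactly_supported.
Variable K : set 'rV[R]_d.
Hypothesis cK : compact K.

Let closedK : closed K.
Proof. by apply: compact_closed => //; exact: norm_hausdorff. Qed.

Lemma bounded_of_support f : continuous f -> (forall x, ~ K x -> f x = 0) ->
  exists2 M, 0 <= M & forall x, `|f x| <= M.
Proof.
move=> cf f0.
have /compact_bounded[M [_ hM]] : compact (f @` K).
  by apply: continuous_compact => //; exact: continuous_subspaceT.
exists (`|M| + 1); first by rewrite addr_ge0.
move=> x; have [Kx|/f0 ->] := pselect (K x); last first.
  by rewrite normr0 addr_ge0.
by apply: (hM (`|M| + 1)); [rewrite ltr_pwDr// ler_norm|exists x].
Qed.

Lemma derive_off_support f v x : (forall x, ~ K x -> f x = 0) -> ~ K x ->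
  'D_v f x = 0.
Proof.
move=> f0 Kx; rewrite (@near_eq_derive _ _ _ f (cst 0)) ?derive_cst//.
have : nbhs x (~` K) by apply: open_nbhs_nbhs; split => //; exact: closed_openC closedK.
by apply: filterS => y /f0.
Qed.

Lemma Ck1_lipschitz f : Ck 1 f -> (forall x, ~ K x -> f x = 0) ->
  exists2 L, 0 <= L & forall x y, `|f x - f y| <= L * `|x - y|.
Proof.
move=> [cf df] f0.
have /choice[M hM] (i : 'I_d) : exists M, 0 <= M /\ forall x, `|'D_(e_ i) f x| <= M.
  have [_ cdf] := df i.
  have [M] := bounded_of_support cdf (fun x => @derive_off_support f (e_ i) x f0).
  by exists M.
exists (\sum_i M i); first by apply: sumr_ge0 => i _; exact: (hM i).1.
move=> x y; have -> : f x - f y = f (y + (x - y)) - f y.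
  by rewrite [y + _]addrC subrK.
have [xi _ ->] := @mvt_coordinates f y (x - y) (fun i => (df i).1).
apply: le_trans (ler_norm_sum _ _ _) _; rewrite mulr_suml.
apply: ler_sum => i _; rewrite normrM mulrC.
by apply: ler_pM => //; [exact: (hM i).2|exact: normr_coord].
Qed.

Lemma Ck2_taylor f : Ck 2 f -> (forall x, ~ K x -> f x = 0) ->
  exists C, forall x h, `|f (x + h) - f x - dot h (grad f x)| <= C * `|h| ^+ 2.
Proof.
move=> [cf df] f0.
have /choice[L hL] (i : 'I_d) : exists L, 0 <= L /\
    forall x y, `|'D_(e_ i) f x - 'D_(e_ i) f y| <= L * `|x - y|.
  have [_ cdf] := df i.
  have [L] := Ck1_lipschitz cdf (fun x => @derive_off_support f (e_ i) x f0).
  by exists L.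
exists (\sum_i L i) => x h.
have [xi hxi ->] := @mvt_coordinates f x h (fun i => (df i).1).
rewrite /dot -sumrB; apply: le_trans (ler_norm_sum _ _ _) _; rewrite mulr_suml.
apply: ler_sum => i _; rewrite mxE -mulrBr normrM expr2 mulrCA.
apply: ler_pM => //; first exact: normr_coord.
by apply: le_trans ((hL i).2 _ _) _; apply: ler_wpM2l; [exact: (hL i).1|].
Qed.

End compactly_supported.

Lemma CkW k f : Ck k.+1 f -> Ck k f.
Proof.
elim: k f => [|k IH] f; first by case.
by move=> [cf df]; split=> // i; have [di Ci] := df i; split=> //; exact: IH.
Qed.

Lemma test_function_off (U : set 'rV[R]_d) f x : test_function U f ->
  ~ U x -> f x = 0.
Proof.
move=> [_ _ KU] Ux; apply/eqP/negPn/negP => fx; apply: Ux; apply: KU.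
exact: subset_closure.
Qed.

(** All that Gauss' theorem requires of a test function. *)
Lemma test_function_estimates (U : set 'rV[R]_d) f : test_function U f ->
  [/\ tame f, forall i, tame (fun x => grad f x ord0 i),
     exists M, forall x, `|f x| <= M,
     exists L, forall x y, `|f x - f y| <= L * `|x - y|
   & exists C, forall x h, `|f (x + h) - f x - dot h (grad f x)| <= C * `|h| ^+ 2].
Proof.
move=> [Cf cK _].
have f0 x : ~ closure [set y | f y != 0] x -> f x = 0.
  by move=> h; apply/eqP/negPn/negP => fx; apply: h; exact: subset_closure.
split.
- exact/tame_continuous/(Cf 0%N).
- move=> i; under eq_fun do rewrite mxE.
  by apply: tame_continuous; have [_ /(_ i)[_]] := Cf 1%N.
- by have [M _ hM] := bounded_of_support cK (Cf 0%N) f0; exists M.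
- by have [L _ hL] := Ck1_lipschitz cK (Cf 1%N) f0; exists L.
- by have [C hC] := Ck2_taylor cK (Cf 2%N) f0; exists C.
Qed.

Lemma CkD k f g : Ck k f -> Ck k g -> Ck k (f + g).
Proof.
elim: k f g => [|k IH] f g.
  by move=> /= cf cg x; apply: continuousD; [exact: cf|exact: cg].
move=> [cf df] [cg dg]; split=> [x|i].
  by apply: continuousD; [exact: cf|exact: cg].
have [dfi Cfi] := df i; have [dgi Cgi] := dg i; split.
  by move=> x; exact: derivableD.
rewrite (_ : (fun x => _) = (fun x => 'D_(e_ i) f x) + (fun x => 'D_(e_ i) g x)).
  exact: IH.
by apply/funext => x; rewrite deriveD.
Qed.

Lemma CkM k f g : Ck k f -> Ck k g -> Ck k (f * g).
Proof.
elim: k f g => [|k IH] f g.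
  by move=> /= cf cg x; apply: continuousM; [exact: cf|exact: cg].
move=> Cf Cg; have [[cf df] [cg dg]] := (Cf, Cg); split=> [x|i].
  by apply: continuousM; [exact: cf|exact: cg].
have [dfi Cfi] := df i; have [dgi Cgi] := dg i; split.
  by move=> x; exact: derivableM.
rewrite (_ : (fun x => _) =
  f * (fun x => 'D_(e_ i) g x) + g * (fun x => 'D_(e_ i) f x)).
  by apply: CkD; apply: IH => //; exact: CkW.
by apply/funext => x; rewrite deriveM.
Qed.

Lemma Ck_cst k (c : R) : Ck k (fun=> c : R) (d := d).
Proof.
elim: k c => [|k IH] c; first exact: cst_continuous.
split=> [|i]; first exact: cst_continuous.
split=> [x|]; first exact: derivable_cst.
rewrite (_ : (fun x => _) = (fun=> 0 : R)); first exact: (IH 0).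
by apply/funext => x; exact: derive_cst.
Qed.

Lemma Ck_prod k (I : Type) (s : seq I) (F : I -> 'rV[R]_d -> R) :
  (forall i, Ck k (F i)) -> Ck k (fun x => \prod_(i <- s) F i x).
Proof.
move=> CF; elim: s => [|i s IH].
  by under eq_fun do rewrite big_nil; exact: Ck_cst.
by under eq_fun do rewrite big_cons; exact: CkM.
Qed.

End differential_estimates.

(** The smooth function exp(-1/x) extended by 0 to x <= 0, and its multiples by
    polynomials in 1/x: a class of functions stable under derivation. *)
Section flat_exponential.
Variable R : realType.
Implicit Types (P : {poly R}) (x : R).

Definition flat P x : R := if 0 < x then P.[x^-1] * expR (- x^-1) else 0.

Lemma flat_le0 P x : x <= 0 -> flat P x = 0.
Proof. by rewrite /flat ltNge => ->. Qed.

Lemma horner_le P (u : R) : 1 <= u ->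
  `|P.[u]| <= (\sum_(i < size P) `|P`_i|) * u ^+ size P.
Proof.
move=> u1; rewrite horner_coef mulr_suml; apply: le_trans (ler_norm_sum _ _ _) _.
apply: ler_sum => i _; rewrite normrM ler_wpM2l// normrX ger0_norm ?(le_trans _ u1)//.
by apply: ler_weXn2l => //; exact: ltnW.
Qed.

(** Near 0 the exponential beats every power of 1/x. *)
Lemma flat_near0 P : exists2 C, 0 <= C & forall x, x <= 1 -> `|flat P x| <= C * `|x|.
Proof.
pose S := \sum_(i < size P) `|P`_i|; pose n := size P.
have S0 : 0 <= S by apply: sumr_ge0.
exists (S * n.+1`!%:R) => [|x x1]; first exact: mulr_ge0.
have [x0|x0] := ltP 0 x; last by rewrite flat_le0// normr0 !mulr_ge0.
rewrite /flat x0 normrM [X in _ * X <= _]ger0_norm ?expR_ge0// expRN.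
have u1 : 1 <= x^-1 by rewrite invf_ge1.
have u0 : 0 < x^-1 by rewrite invr_gt0.
have eu : x^-1 ^+ n.+1 / n.+1`!%:R <= expR x^-1.
  by apply: le_trans (expR_ge1Dxn n (ltW u0)); rewrite lerDr.
rewrite ler_pdivrMr ?expR_gt0//; apply: le_trans (horner_le P u1) _.
rewrite -/S -/n (gtr0_norm x0) -!mulrA; apply: ler_wpM2l => //.
have f0 : 0 < n.+1`!%:R :> R by rewrite ltr0n fact_gt0.
rewrite mulrCA; rewrite ler_pdivrMr// mulrC in eu.
apply: (@le_trans _ _ (x * (x^-1 ^+ n.+1))).
  by rewrite exprS mulrA divff ?mul1r// lt0r_neq0.
by apply: ler_wpM2l => //; exact: ltW.
Qed.

(** d/dx (P(1/x) exp(-1/x)) = (1/x)^2 (P - P')(1/x) exp(-1/x). *)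
Definition flat_deriv P : {poly R} := 'X^2 * (P - P^`()).

(** At 0 the difference quotient of flat P is flat ('X * P), which tends to 0. *)
Lemma is_derive_flat P x : is_derive x 1 (flat P) (flat (flat_deriv P) x).
Proof.
have [x0|x0|->] := ltgtP x 0.
- rewrite flat_le0; last exact: ltW.
  apply: (@near_eq_is_derive R R R (cst 0)).
  have : nbhs x [set y | y < 0] by apply: open_nbhs_nbhs; split=> //; exact: open_lt.
  by apply: filterS => y /= /ltW /flat_le0 ->.
- have xn0 : x != 0 by rewrite lt0r_neq0.
  apply: (@near_eq_is_derive R R R (fun y => P.[y^-1] * expR (- y^-1))).
    have : nbhs x [set y | 0 < y] by apply: open_nbhs_nbhs; split=> //; exact: open_gt.
    by apply: filterS => y /= y0; rewrite /flat y0.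
  have di : is_derive x 1 (fun y : R => y^-1) (- x ^- 2).
    rewrite -[X in is_derive _ _ _ X]mulr1.
    exact: (@is_deriveV _ (id : R -> R) x 1 1 xn0 (is_derive_id x 1)).
  have dP := @is_derive1_comp _ (horner P) (fun y : R => y^-1) x _ _
    (is_derive_poly P x^-1) di.
  have dN : is_derive x 1 (fun y : R => - y^-1) (x ^- 2).
    by rewrite -[x ^- 2]opprK; exact: is_deriveN.
  have dE := @is_derive1_comp _ expR (fun y : R => - y^-1) x _ _
    (is_derive_expR (- x^-1)) dN.
  refine (is_derive_eq (is_deriveM dP dE) _).
  rewrite /flat x0 /= hornerM hornerXn hornerD hornerN -exprVn.
  rewrite -[P.[_] *: _]/(_ * _) -[expR _ *: _]/(_ * _); ring.
- rewrite (flat_le0 _ (lexx 0)).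
  have [C C0 hC] := flat_near0 ('X * P).
  have E (h : R) : `|h^-1 * flat P h| <= `|flat ('X * P) h|.
    have [h0|h0] := ltP 0 h; last by rewrite (flat_le0 _ h0) mulr0 normr0.
    by rewrite /flat h0 hornerM hornerX mulrA.
  have : (fun h : R => h^-1 *: ((flat P \o shift 0) (h *: 1) - flat P 0)) @ 0^' --> (0 : R).
    have C1 : 0 < C + 1 by rewrite ltr_wpDl.
    apply/cvgr0Pnorm_lt => e e0.
    have eC : 0 < e / (C + 1) by exact: divr_gt0.
    near=> h.
    rewrite /= (flat_le0 _ (lexx 0)) subr0 addr0 -[h *: 1]/(h * 1) mulr1.
    rewrite -[_ *: _]/(_ * _); apply: le_lt_trans (E h) _.
    have h1 : h <= 1.
      apply: le_trans (ler_norm _) _; near: h; apply: dnbhs0_le; exact: ltr01.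
    apply: le_lt_trans (hC h h1) _.
    apply: (@le_lt_trans _ _ ((C + 1) * `|h|)).
      by rewrite ler_wpM2r// lerDl.
    rewrite -ltr_pdivlMl// mulrC; near: h; exact: dnbhs0_lt.
  move=> cv; apply: DeriveDef; first by apply/cvg_ex; exists 0.
  exact: cvg_lim cv.
Unshelve. all: by end_near. Qed.

Lemma flat_continuous P : continuous (flat P).
Proof.
move=> x; apply/differentiable_continuous/derivable1_diffP.
exact: (@ex_derive _ _ _ _ _ _ _ (is_derive_flat P x)).
Qed.

Lemma flatZ a P x : flat (a *: P) x = a * flat P x.
Proof. by rewrite /flat hornerZ; case: ifP; rewrite ?mulr0// mulrA. Qed.

Lemma flat1_bounds x : 0 <= flat 1 x <= 1.
Proof.
rewrite /flat; case: ifP => x0; last by rewrite lexx ler01.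
rewrite hornerC mul1r expR_ge0 -[leRHS]expR0 ler_expR oppr_le0 invr_ge0.
exact: ltW.
Qed.

Lemma flat1_gt0 x : (0 < flat 1 x) = (0 < x).
Proof.
by rewrite /flat; case: ifP; rewrite ?ltxx// hornerC mul1r expR_gt0.
Qed.

(** Compressing the argument turns the smooth step into the Heaviside function. *)
Lemma flat1_cvg x :
  (fun n : nat => flat 1 (n.+1%:R * x)) @ \oo --> ((0 < x)%R%:R : R).
Proof.
have [x0|x0] := ltP 0 x; last first.
  rewrite (_ : (fun _ => _) = fun=> 0); first exact: cvg_cst.
  by apply/funext => n; rewrite flat_le0// mulr_ge0_le0.
rewrite (_ : (fun _ => _) = fun n => expR (- (x^-1 * n.+1%:R^-1))).
  rewrite -[X in _ --> X]expR0; apply: continuous_cvg.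
    exact: continuous_expR.
  rewrite -oppr0; apply: cvgN; rewrite -(mulr0 x^-1).
  by apply: cvgM; [exact: cvg_cst|exact: cvg_harmonic].
apply/funext => n.
by rewrite /flat mulr_gt0// hornerC mul1r invfM mulrC.
Qed.

End flat_exponential.

Section bump.
Variables (R : realType) (d : nat).
Implicit Types (a b x : 'rV[R]_d).

(** The partial derivatives are again of this form, with another polynomial. *)
Lemma Ck_flat k (P : {poly R}) (i : 'I_d) (s r : R) :
  Ck k (fun x : 'rV[R]_d => flat P (s * x ord0 i + r)).
Proof.
have cts Q : continuous (fun x : 'rV[R]_d => flat Q (s * x ord0 i + r)).
  move=> x; apply: (@continuous_comp _ _ _ (fun x : 'rV[R]_d => s * x ord0 i + r)).
    apply: continuousD; last exact: cst_continuous.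
    by apply: continuousM; [exact: cst_continuous|exact: coord_continuous].
  exact: flat_continuous.
have der Q (j : 'I_d) (x : 'rV[R]_d) :
    is_derive x (delta_mx ord0 j : 'rV[R]_d)
    (fun x : 'rV[R]_d => flat Q (s * x ord0 i + r))
    (flat ((i == j)%:R *: (s *: flat_deriv Q)) (s * x ord0 i + r)).
  set c := (i == j)%:R * s; pose t := s * x ord0 i + r.
  pose g (h : R) := flat Q (c * h + t).
  have dl : is_derive (0 : R) 1 (fun h : R => c * h + t) c.
    have := is_deriveD (is_deriveZ c (is_derive_id (0 : R) 1)) (is_derive_cst t (0 : R) 1).
    by rewrite addr0 -[c *: 1]/(c * 1) mulr1.
  have dg : is_derive (0 : R) 1 g (flat (flat_deriv Q) (c * 0 + t) * c).
    exact: (@is_derive1_comp _ (flat Q) _ 0 _ _ (is_derive_flat Q _) dl).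
  rewrite mulr0 add0r in dg.
  have E : (fun h : R => h^-1 *: (((fun x : 'rV[R]_d => flat Q (s * x ord0 i + r))
        \o shift x) (h *: (delta_mx ord0 j : 'rV[R]_d)) - flat Q t)) =
      (fun h : R => h^-1 *: ((g \o shift 0) (h *: 1) - g 0)).
    apply/funext => h /=; congr (_ *: (flat Q _ - flat Q _)); last first.
      by rewrite mulr0 add0r.
    by rewrite !mxE eqxx/= /t /c addr0 -[h *: 1]/(h * 1); ring.
  have [dg1 dg2] := dg; apply: DeriveDef; rewrite /derivable /derive E //.
  by rewrite [LHS]dg2 scalerA -/c flatZ mulrC.
elim: k P => [|k IH] P; first exact: cts.
split=> [|j]; first exact: cts.
split=> [x|]; first exact: (@ex_derive _ _ _ _ _ _ _ (der P j x)).
rewrite (_ : (fun x => _) = fun x : 'rV[R]_d =>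
  flat ((i == j)%:R *: (s *: flat_deriv P)) (s * x ord0 i + r)); first exact: IH.
by apply/funext => x; exact: (@derive_val _ _ _ _ _ _ _ (der P j x)).
Qed.

(** A smooth function positive exactly in the open box, increasing to its
    indicator as the slope s grows. *)
Definition bump a b (s : R) x : R :=
  \prod_i (flat 1 (s * (x ord0 i - a ord0 i)) * flat 1 (s * (b ord0 i - x ord0 i))).

Lemma Ck_bump k a b s : Ck k (bump a b s).
Proof.
apply: Ck_prod => i; apply: CkM.
  under eq_fun do rewrite mulrBr; exact: Ck_flat.
under eq_fun do rewrite mulrBr addrC -mulNr; exact: Ck_flat.
Qed.

Lemma bump_bounds a b s x : 0 <= bump a b s x <= 1.
Proof.
have fb (u v : R) : 0 <= flat 1 u * flat 1 v <= 1.
  have /andP[u0 u1] := flat1_bounds u; have /andP[v0 v1] := flat1_bounds v.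
  by rewrite mulr_ge0//= mulr_ile1.
rewrite /bump prodr_ge0/=; last first.
  by move=> i _; case/andP: (fb (s * (x ord0 i - a ord0 i)) (s * (b ord0 i - x ord0 i))).
by apply: prodr_ile1 => i _; exact: fb.
Qed.

Lemma bump_gt0 a b s x : 0 < s -> 0 < bump a b s x <-> box a b x.
Proof.
move=> s0; split=> [bx i|bx]; last first.
  apply: prodr_gt0 => i _; have /andP[h1 h2] := bx i.
  by rewrite mulr_gt0// flat1_gt0 mulr_gt0// subr_gt0.
have : bump a b s x != 0 by rewrite lt0r_neq0.
move=> /prodf_neq0/(_ i isT); rewrite mulf_eq0 negb_or => /andP[h1 h2].
have pos (u : R) : flat 1 u != 0 -> 0 < u.
  by move=> fu; rewrite -flat1_gt0 lt_neqAle eq_sym fu; have /andP[] := flat1_bounds u.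
have := pos _ h1; have := pos _ h2.
by rewrite !(pmulr_rgt0 _ s0) !subr_gt0 => -> ->.
Qed.

Lemma closed_closed_box a b : closed (closed_box a b).
Proof.
rewrite (_ : closed_box a b = \bigcap_(i in [set: 'I_d])
    (fun x : 'rV[R]_d => x ord0 i) @^-1` `[a ord0 i, b ord0 i]%classic).
  apply: closed_bigI => i _; apply: closed_comp => [x _|].
    exact: coord_continuous.
  exact: interval_closed.
apply/seteqP; split=> [x h i _|x h i] /=; first by rewrite in_itv/=; exact: h.
by have := h i I; rewrite /= in_itv.
Qed.

Lemma compact_closed_box a b : compact (closed_box a b).
Proof.
apply: bounded_closed_compact; last exact: closed_closed_box.
exists (`|a| + `|b|); split=> [|M hM x hx]; first exact: num_real.
apply: ler_norm_rV => [|i]; first by apply: le_trans (ltW hM); rewrite addr_ge0.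
apply: le_trans (ltW hM); have /andP[h1 h2] := hx i.
have := normr_coord a i; have := normr_coord b i.
have := normr_ge0 a; have := normr_ge0 b.
rewrite !ler_norml => ? ? /andP[? ?] /andP[? ?]; apply/andP; split; lra.
Qed.

Lemma test_function_bump (U : set 'rV[R]_d) a b s : 0 < s ->
  closed_box a b `<=` U -> test_function U (bump a b s).
Proof.
move=> s0 KU.
have sub : closure [set x | bump a b s x != 0] `<=` closed_box a b.
  have := @closed_closed_box a b; rewrite closure_id => E.
  rewrite [X in _ `<=` X]E.
  apply: closure_subset => x /= bx i.
  have : 0 < bump a b s x.
    by rewrite lt_neqAle eq_sym bx; have /andP[] := bump_bounds a b s x.
  by move=> /(bump_gt0 _ _ _ s0)/(_ i)/andP[h1 h2]; rewrite !ltW.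
split; [by move=> k; exact: Ck_bump| |exact: subset_trans sub KU].
apply: subclosed_compact (@compact_closed_box a b) sub.
exact: closed_closure.
Qed.

Lemma bump_cvg a b x :
  (fun n : nat => bump a b n.+1%:R x) @ \oo --> (\1_(box a b) x : R).
Proof.
have -> : \1_(box a b) x = \prod_i ((0 < x ord0 i - a ord0 i)%R%:R *
    (0 < b ord0 i - x ord0 i)%R%:R) :> R.
  rewrite indicE; case: (boolP (x \in box a b)); rewrite ?inE ?notin_setE => bx.
    rewrite big1// => i _; have /andP[h1 h2] := bx i.
    by rewrite !subr_gt0 h1 h2 mulr1.
  have [i bi] : exists i, ~~ (a ord0 i < x ord0 i < b ord0 i).
    by apply/existsP; rewrite -negb_forall; apply/negP => /forallP.
  apply/esym/eqP; rewrite prodf_seq_eq0; apply/hasP; exists i => //=.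
    exact: mem_index_enum.
  rewrite !subr_gt0 -natrM mulnb pnatr_eq0 eqb0.
  exact: bi.
rewrite /bump; elim: (index_enum _) => [|i s IH].
  rewrite big_nil; under eq_fun do rewrite big_nil; exact: cvg_cst.
rewrite big_cons; under eq_fun do rewrite big_cons.
by apply: cvgM => //; apply: cvgM; exact: flat1_cvg.
Qed.

End bump.

(** * The fundamental lemma of the calculus of variations *)

Section du_bois_reymond.
Variables (R : realType) (d : nat).
Local Notation mu := (lebesgue_measure_rV R d).
Implicit Types (a b x : 'rV[R]_d) (U : set 'rV[R]_d) (f : 'rV[R]_d -> R).

Let coord_max a b : 'rV[R]_d := \row_i Num.max (a ord0 i) (b ord0 i).
Let coord_min a b : 'rV[R]_d := \row_i Num.min (a ord0 i) (b ord0 i).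

Let box_setI a b a' b' :
  box a b `&` box a' b' = box (coord_max a a') (coord_min b b').
Proof.
apply/seteqP; split=> [x [h h'] i|x h].
  rewrite !mxE gt_max lt_min.
  by have /andP[-> ->] := h i; have /andP[-> ->] := h' i.
split=> i; have := h i; rewrite !mxE gt_max lt_min => /andP[/andP[? ?] /andP[? ?]];
  by apply/andP.
Qed.

(** Dominated convergence along the bumps increasing to the box. *)
Lemma integral_box_eq0 U f a b : open U -> mu.-integrable U (EFin \o f) ->
  (forall phi, test_function U phi -> \int[mu]_(x in U) (f x * phi x) = 0) ->
  closed_box a b `<=` U -> (\int[mu]_(x in box a b) (f x)%:E = 0)%E.
Proof.
move=> oU fi h KU; have mU := open_measurable_rV oU.
have mf : measurable_fun U f.
  by apply/measurable_EFinP; exact: measurable_int fi.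
have bU : box a b `<=` U by move=> x /box_closed_box; exact: KU.
pose F n x := (f x * bump a b n.+1%:R x)%:E.
have tb n := test_function_bump (ltr0Sn R n) KU.
have mb n : measurable_fun U (bump a b n.+1%:R).
  apply: measurable_funTS.
  by have [tbn _ _ _ _] := test_function_estimates (tb n); exact: tbn.1.
have mF n : measurable_fun U (F n).
  by apply/measurable_EFinP; apply: measurable_funM => //; exact: mb.
have mb1 : measurable_fun U (\1_(box a b) : _ -> R).
  by apply: measurable_funTS; apply: measurable_indic; exact: measurable_box.
have bound n x : `|bump a b n.+1%:R x| <= 1.
  by have /andP[h0 h1] := bump_bounds a b n.+1%:R x; rewrite ger0_norm.
have iF n : mu.-integrable U (F n).
  apply: le_integrable fi => // x _ /=.
  by rewrite lee_fin normrM ler_piMr.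
have F0 n : (\int[mu]_(x in U) F n x = 0)%E.
  have := congr1 EFin (h _ (tb n)); rewrite /Rintegral fineK//.
  exact: (integrable_fin_num mU (iF n)).
have mF' : measurable_fun U (fun x => (f x * \1_(box a b) x)%:E).
  by apply/measurable_EFinP; apply: measurable_funM.
have cF : {ae mu, forall x, U x -> F ^~ x @ \oo --> (f x * \1_(box a b) x)%:E}.
  apply: aeW => x _; apply: cvg_EFin; first exact: nearW.
  by apply: cvgM; [exact: cvg_cst|exact: bump_cvg].
have ig : mu.-integrable U (fun x => `|f x|%:E) by exact: integrable_norm.
have dF : {ae mu, forall x n, U x -> (`|F n x| <= `|f x|%:E)%E}.
  by apply: aeW => x n _; rewrite /= lee_fin normrM ler_piMr.
have [_ _] := @dominated_convergence _ _ _ mu U mU F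
  (fun x => (f x * \1_(box a b) x)%:E) (fun x => `|f x|%:E) mF mF' cF ig dF.
rewrite (_ : (fun n => _) = fun=> 0%E); last by apply/funext => n; exact: F0.
have -> : (\int[mu]_(x in U) (f x * \1_(box a b) x)%:E =
    \int[mu]_(x in box a b) (f x)%:E)%E.
  rewrite -[in RHS](setIidr bU) [RHS]integral_mkcondr; apply: eq_integral => x _.
  rewrite /patch indicE; case: ifP => xb; first by rewrite mulr1.
  by rewrite mulr0.
by move=> cv; rewrite -(cvg_lim _ cv)//; exact: lim_cst.
Qed.

(** An integrable function orthogonal to all test functions vanishes: its
    integrals over boxes vanish, boxes are stable under intersection and
    generate the Borel sets. *)
Lemma du_bois_reymond U f : open U -> measurable_fun setT f ->
  mu.-integrable U (EFin \o f) ->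
  (forall phi, test_function U phi -> \int[mu]_(x in U) (f x * phi x) = 0) ->
  f = cst 0 %[ae mu in U].
Proof.
move=> oU mf fi h; have mU := open_measurable_rV oU.
have mEf : measurable_fun setT (EFin \o f) by exact/measurable_EFinP.
have local a b : closed_box a b `<=` U -> f = cst 0 %[ae mu in box a b].
  move=> KU.
  have mB := @measurable_box R d a b.
  have bU : box a b `<=` U by move=> x /box_closed_box; exact: KU.
  have iB : mu.-integrable (box a b) (EFin \o f) by exact: integrableS fi.
  pose G := [set B | exists a b : 'rV[R]_d, B = box a b].
  pose H := [set A : set 'rV[R]_d | measurable A /\
    (\int[mu]_(x in A `&` box a b) (f x)%:E = 0)%E].
  have GI : setI_closed G.
    by move=> _ _ [a1 [b1 ->]] [a2 [b2 ->]]; rewrite box_setI; eexists; eexists.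
  have dH : dynkin H.
    split.
    - by split=> //; rewrite setTI; exact: (integral_box_eq0 oU fi h KU).
    - move=> A [mA A0]; split; first exact: measurableC.
      have E : box a b = (A `&` box a b) `|` (~` A `&` box a b).
        by rewrite -setIUl setUv setTI.
      have := integral_box_eq0 oU fi h KU; rewrite {1}E integral_setU.
      + by rewrite A0 add0e.
      + exact: measurableI.
      + by apply: measurableI => //; exact: measurableC.
      + exact: measurable_funTS.
      + by apply/disj_setPS => x [[Ax _] []].
    - move=> F tF HF; split; first by apply: bigcupT_measurable => k; case: (HF k).
      rewrite setI_bigcupl integral_bigcup.
      + by apply: eseries0 => k _ _; case: (HF k).
      + exact: trivIset_setIr.
      + by move=> k; apply: measurableI => //; case: (HF k).
      + apply: integrableS iB => //; last by move=> x [k _ []].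
        by apply: bigcupT_measurable => k; apply: measurableI => //; case: (HF k).
  have GH : G `<=` H.
    move=> _ [a1 [b1 ->]]; split; first exact: measurable_box.
    rewrite box_setI; apply: (integral_box_eq0 oU fi h) => x xb; apply: KU => i.
    have := xb i; rewrite !mxE ge_max le_min => /andP[/andP[_ ->] /andP[_ ->]].
    by [].
  have mH A : measurable A -> H A.
    rewrite measurable_generated_by_boxes -(setI_closed_g_dynkin_g_sigma_algebra GI).
    exact: smallest_sub.
  have : ae_eq mu (box a b) (EFin \o f) (cst 0%E).
    apply: integral_ae_eq => // E Eb mE; rewrite integral0.
    by have [_] := mH E mE; rewrite (setIidl Eb).
  by apply: filterS => x hx /hx [].
pose P (n : nat) (x : 'rV[R]_d) : Prop :=
  if (choice.unpickle n : option ('rV[rat]_d * 'rV[rat]_d)) is Some q then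
    closed_box (map_mx ratr q.1) (map_mx ratr q.2) `<=` U ->
    box (map_mx ratr q.1) (map_mx ratr q.2) x -> f x = 0
  else True.
have : \forall x \ae mu, forall n, P n x.
  apply: ae_foralln => n; rewrite /P; case: choice.unpickle => [q|]; last exact: aeW.
  have [KU|KU] := pselect (closed_box (map_mx ratr q.1) (map_mx ratr q.2) `<=` U); last first.
    by apply: aeW => x.
  by apply: filterS (local _ _ KU) => x hx _.
apply: filterS => x hx Ux.
have [r r0 rU] := open_rVP oU Ux.
have [q [qx qU]] := rational_box x r0.
have := hx (choice.pickle q); rewrite /P choice.pickleK; apply=> //.
by move=> y /qU; exact: rU.
Qed.

End du_bois_reymond.

(** * Sides of the triangulation *)

Section triangulation_geometry.
Variables (R : realType) (d : nat).
Variables (Omega : set 'rV[R]_d) (Th : {fset {fset 'rV[R]_d}}).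
Hypothesis d0 : (0 < d)%N.
Hypothesis hOmega : bounded_lipschitz_domain Omega.
Hypothesis hTh : regular_triangulation Omega Th.
Local Notation mu := (lebesgue_measure_rV R d).
Implicit Types (x y z p : 'rV[R]_d) (S T F : {fset 'rV[R]_d}).

Lemma open_Omega : open Omega. Proof. by case: hOmega. Qed.

Lemma nondegenerate_element T : T \in Th -> nondegenerate T.
Proof. by move=> TT; case: hTh => + _ _; exact. Qed.

Lemma hull_meet T T' x : T \in Th -> T' \in Th -> hull T x -> hull T' x ->
  hull (T `&` T')%fset x.
Proof. by move=> TT TT' hx hx'; case: hTh => _ _ <-. Qed.

Lemma hull_closure T x : T \in Th -> hull T x -> closure Omega x.
Proof. by move=> TT hx; case: hTh => _ -> _; exists T. Qed.

Lemma closure_hull x : closure Omega x -> exists2 T, T \in Th & hull T x.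
Proof. by case: hTh => _ -> _ [T TT hx]; exists T. Qed.

(** A Lipschitz domain lies on one side of its boundary: next to a boundary
    point, points moved against the direction e are exterior. This rules out
    slits, which a general open set may have. *)
Lemma interior_closure x r : 0 < r ->
  (forall y, `|x - y| < r -> closure Omega y) -> Omega x.
Proof.
move=> r0 hr; apply: contrapT => nOx.
have [_ oO _ _ lip] := hOmega.
have cx : closure Omega x by apply: hr; rewrite subrr normr0.
have bx : boundary Omega x.
  by split=> //; have /interior_id -> := oO.
have [e [gamma [rho [e1 gT [L gL] rho0 hrho]]]] := lip x bx.
have gx : dot e x <= gamma x.
  rewrite leNgt; apply/negP => h; apply: nOx; apply/hrho => //.
  by apply/ball_rVE; rewrite subrr normr0.
pose m := Num.min r rho.
have m0 : 0 < m by rewrite lt_min r0.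
have ne : 0 < `|e| + 1 by rewrite ltr_wpDl.
(* The displacement keeps xt in both balls; around xt the strict epigraph is
   missed in the radius t / K, K bounding the slopes of gamma and of dot e. *)
pose t := m / 2 / (`|e| + 1).
have t0 : 0 < t by rewrite !divr_gt0.
have te : `|t *: e| <= m / 2.
  rewrite normrZ (gtr0_norm t0) /t mulrAC ler_pdivrMr//.
  by rewrite ler_wpM2l ?lerDl// divr_ge0// ltW.
pose xt := x - t *: e.
have gxt : gamma xt = gamma x by rewrite /xt -scaleNr gT.
have ext : dot e xt = dot e x - t by rewrite /xt dotBr dotZr e1 mulr1.
have : closure Omega xt.
  apply: hr; rewrite /xt opprB addrCA subrr addr0.
  have : m <= r by rewrite ge_min lexx.
  by move=> ?; apply: le_lt_trans te _; lra.
pose K := `|L| + d%:R * `|e| + 1.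
have K0 : 0 < K by rewrite ltr_wpDl// addr_ge0// mulr_ge0.
pose s := Num.min (m / 2) (t / K).
have s0 : 0 < s by rewrite lt_min !divr_gt0.
move=> /(_ [set y | `|xt - y| < s]) [].
  exact: (@nbhs_rVP _ _ _ _ s).
move=> y [Oy /= ys].
have ys1 : `|xt - y| < m / 2 by apply: lt_le_trans ys _; rewrite ge_min lexx.
have ys2 : `|xt - y| < t / K by apply: lt_le_trans ys _; rewrite ge_min lexx orbT.
have : gamma y < dot e y.
  apply/hrho => //; apply/ball_rVE.
  have -> : x - y = t *: e + (xt - y) by rewrite /xt addrA [t *: e + _]addrC subrK.
  apply: le_lt_trans (ler_normD _ _) _.
  have : m <= rho by rewrite ge_min lexx orbT.
  by lra.
have h1 : `|gamma xt - gamma y| <= `|L| * `|xt - y|.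
  by apply: le_trans (gL _ _) _; rewrite ler_wpM2r// ler_norm.
have h2 : `|dot e xt - dot e y| <= d%:R * `|e| * `|xt - y|.
  by rewrite -dotBr -mulrA norm_dot_le.
rewrite ltr_pdivlMr// in ys2.
have : (`|L| + d%:R * `|e|) * `|xt - y| <= K * `|xt - y|.
  by rewrite ler_wpM2r// /K lerDl.
rewrite mulrDl; move: h1 h2; rewrite !ler_norml gxt ext => /andP[? ?] /andP[? ?].
by lra.
Qed.

(** The topological interior of the simplex T. *)
Definition open_simplex T : set 'rV[R]_d :=
  [set x | forall p, p \in T -> 0 < bary T x p].

Lemma open_simplex_hull T : nondegenerate T -> open_simplex T `<=` hull T.
Proof.
move=> nT x hx; apply/(hullE nT) => p.
by have [/hx/ltW//|/(bary_off nT) ->] := boolP (p \in T).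
Qed.

Lemma open_open_simplex T : nondegenerate T -> open (open_simplex T).
Proof.
move=> nT; rewrite openE => x hx.
have [e e0 eT] := seq_lower_bound hx.
have [r r0 hr] := bary_near nT x e0; apply: (@nbhs_rVP _ _ _ _ r) => // y xy p pT.
by have := hr y xy p; have := eT p pT; rewrite ltr_norml => ? /andP[? ?]; lra.
Qed.

(** The interior of the closure of Omega is Omega. *)
Lemma open_simplex_sub T : T \in Th -> open_simplex T `<=` Omega.
Proof.
move=> TT x hx; have nT := nondegenerate_element TT.
have [r r0 hr] := hull_nbhs nT hx.
by apply: (interior_closure r0) => y /hr; exact: hull_closure.
Qed.

(** A common point with all coordinates in T positive lies on no proper face of
    T, so that the two elements share all vertices. *)
Lemma open_simplex_meet T T' x : T \in Th -> T' \in Th ->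
  open_simplex T x -> hull T' x -> T' = T.
Proof.
move=> TT TT' hx hx'; have nT := nondegenerate_element TT.
have hT := open_simplex_hull nT hx.
have := hull_meet TT TT' hT hx'.
move=> /(hull_faceE nT _ (fsubsetIl _ _))[_ h].
apply/esym/eqP; rewrite eqEfcard (nondegenerate_element TT').1 nT.1 leqnn andbT.
apply/fsubsetP => p pT; apply: contraT => pT'.
have := hx p pT; rewrite h ?ltxx//.
by rewrite in_fsetI pT.
Qed.

Lemma closed_hull T : nondegenerate T -> closed (hull T).
Proof.
move=> nT; rewrite (_ : hull T = \bigcap_(p in [set: 'rV[R]_d])
    (fun x => bary T x p) @^-1` [set t | 0 <= t]).
  apply: closed_bigI => p _; apply: closed_comp => [x _|]; last exact: closed_ge.
  apply/(@cvgrPdist_lt _ _ _ (nbhs x)) => e e0.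
  have [r r0 hr] := bary_near nT x e0.
  have : nbhs x [set y | `|bary T x p - bary T y p| < e].
    by apply: (@nbhs_rVP _ _ _ _ r) => // y xy; exact: hr.
  by [].
apply/seteqP; split=> [x /(hullE nT) h p _|x h]; first exact: h.
by apply/(hullE nT) => p; exact: h.
Qed.

Lemma bary_barycenter_face T F p : nondegenerate T -> (F `<=` T)%fset ->
  F != fset0 -> bary T (barycenter F) p = (p \in F)%:R / #|` F|%:R.
Proof.
move=> nT FT F0.
have f0 : #|` F|%:R != 0 :> R by rewrite pnatr_eq0 cardfs_eq0.
have [pT|pT] := boolP (p \in T); last first.
  have /negPf -> : p \notin F by apply: contra pT; exact: (fsubsetP FT).
  by rewrite (bary_off nT)// mul0r.
apply/esym; move: p pT; apply: (bary_unique nT).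
  rewrite -(sum_sub_fset FT); last by move=> q /negPf ->; rewrite mul0r.
  rewrite big_seq (eq_bigr (fun=> #|` F|%:R^-1)); last by move=> q ->; rewrite mul1r.
  rewrite -big_seq big_const_seq count_predT iter_addr addr0.
  by rewrite -[LHS]mulr_natr mulVf.
rewrite -(sum_sub_fset FT); last by move=> q /negPf ->; rewrite mul0r scale0r.
rewrite /barycenter scaler_sumr !big_seq; apply: eq_bigr => q ->.
by rewrite mul1r.
Qed.

Lemma hull_sub F T : nondegenerate T -> (F `<=` T)%fset -> hull F `<=` hull T.
Proof. by move=> nT FT x /(hull_faceE nT _ FT)[]. Qed.

(** The midpoint of a side lies on no smaller face, so a side of any element
    containing it has all its vertices. *)
Lemma side_of_barycenter T z T' S : T \in Th -> z \in T -> T' \in Th ->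
  is_side_of S T' -> hull S (barycenter (T `\ z)%fset) -> S = (T `\ z)%fset.
Proof.
move=> TT zT TT' [ST' cS] hS.
have nT := nondegenerate_element TT; have nT' := nondegenerate_element TT'.
set x := barycenter _ in hS.
have cz := card_side nT zT.
have z0 : (T `\ z)%fset != fset0 by rewrite -cardfs_gt0 cz.
have := hull_meet TT TT' (hull_sub nT (fsubD1set _ _) (hull_barycenter_side nT zT d0))
  (hull_sub nT' ST' hS).
move=> /(hull_faceE nT _ (fsubsetIl _ _))[_ h].
have zT' : (T `\ z `<=` T')%fset.
  apply/fsubsetP => p pz; apply: contraT => pT'.
  have := bary_barycenter_face p nT (fsubD1set _ _) z0; rewrite pz h; last first.
    by rewrite in_fsetI negb_and pT' orbT.
  by rewrite cz mul1r => /esym/eqP; rewrite invr_eq0 pnatr_eq0 eqn0Ngt d0.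
apply/esym/eqP; rewrite eqEfcard cS cz leqnn andbT.
apply/fsubsetP => p pz; apply: contraT => pS.
have [_ /(_ p pS)] := (hull_faceE nT' x ST').1 hS.
rewrite (bary_barycenter_face p nT' zT' z0) pz cz mul1r => /eqP.
by rewrite invr_eq0 pnatr_eq0 eqn0Ngt d0.
Qed.

Lemma is_side_ofP S T : nondegenerate T ->
  is_side_of S T <-> exists2 z, z \in T & S = (T `\ z)%fset.
Proof.
move=> nT; split=> [[ST cS]|[z zT ->]]; last first.
  by split; [exact: fsubD1set|exact: card_side].
have [z zTS] : exists z, z \in (T `\` S)%fset.
  apply/fset0Pn; rewrite -cardfs_gt0 cardfsD (fsetIidPr ST) nT.1 cS.
  by rewrite subSnn.
move: zTS; rewrite in_fsetD => /andP[zS zT]; exists z => //.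
apply/eqP; rewrite eqEfcard cS (card_side nT zT) leqnn andbT.
by apply/fsubsetP => p pS; rewrite in_fsetD1 (fsubsetP ST)// andbT;
  apply: contraNneq zS => <-.
Qed.

(** A flag (T, z) stands for the side of T opposite to its vertex z, seen from
    T; neighbours are the same side seen from two elements. *)
Definition neighbour T z T' z' :=
  [/\ T' \in Th, z' \in T', T' != T & (T `\ z = T' `\ z')%fset].

Section flag.
Variables (T : {fset 'rV[R]_d}) (z : 'rV[R]_d).
Hypotheses (TT : T \in Th) (zT : z \in T).
Let nT := nondegenerate_element TT.
Local Notation S := (T `\ z)%fset.

Lemma neighbour_notin T' z' : neighbour T z T' z' -> z' \notin T.
Proof.
move=> [TT' zT' TT'n SS']; apply: contra TT'n => z'T.
rewrite eqEfcard (nondegenerate_element TT').1 nT.1 leqnn andbT.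
apply/fsubsetP => p pT'; have [->//|pz] := eqVneq p z'.
have : p \in (T' `\ z')%fset by rewrite in_fsetD1 pz.
by rewrite -SS' in_fsetD1 => /andP[].
Qed.

(** Two elements lie on opposite sides of a common side: otherwise points next
    to the midpoint in the direction of z' would belong to both elements, but
    not to their common face. *)
Lemma neighbour_opposite T' z' : neighbour T z T' z' -> bary T z' z < 0.
Proof.
move=> nb; have z'T := neighbour_notin nb; have [TT' zT' _ SS'] := nb.
have nT' := nondegenerate_element TT'.
rewrite ltNge; apply/negP => bz.
pose x := barycenter S.
have dR : 0 < d%:R^-1 :> R by rewrite invr_gt0 ltr0n.
have [r r0 hr] := bary_near nT x dR.
pose e := Num.min 1 (r / 2 / (`|z' - x| + 1)).
have w0 : 0 < `|z' - x| + 1 by rewrite ltr_wpDl.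
have e0 : 0 < e by rewrite lt_min ltr01 !divr_gt0.
have e1 : e <= 1 by rewrite ge_min lexx.
pose xe := x + e *: (z' - x).
have xr : `|x - xe| < r.
  rewrite /xe opprD addrA subrr add0r normrN normrZ (gtr0_norm e0).
  have : e <= r / 2 / (`|z' - x| + 1) by rewrite ge_min lexx orbT.
  rewrite ler_pdivlMr// mulrDr mulr1 => ?.
  by have := normr_ge0 (z' - x); lra.
have hT : hull T xe.
  apply/(hullE nT) => p; have [pT|/(bary_off nT) ->//] := boolP (p \in T).
  have [->|pz] := eqVneq p z.
    rewrite /xe (bary_line nT) (bary_barycenter_side nT zT d0 zT) eqxx mulr0 add0r.
    by rewrite mulr_ge0// ltW.
  have := hr xe xr p; rewrite (bary_barycenter_side nT zT d0 pT) (negPf pz).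
  by rewrite ltr_norml => /andP[_]; lra.
have hx' : hull T' x.
  by apply: (hull_sub nT' (fsubD1set T' z')); rewrite -SS'; exact: hull_barycenter_side.
have bx' : bary T' x z' = 0.
  by rewrite /x SS' (bary_barycenter_side nT' zT' d0 zT') eqxx.
have hT' : hull T' xe.
  apply/(hullE nT') => p; rewrite /xe (bary_line nT') (bary_vertex nT' p zT').
  have := (hullE nT' x).1 hx' p => hp.
  by rewrite addr_ge0 ?mulr_ge0 ?ler0n ?subr_ge0// ltW.
have /(hull_faceE nT' _ (fsubsetIr _ _))[_ /(_ z')] := hull_meet TT TT' hT hT'.
rewrite in_fsetI (negPf z'T) /= => /(_ isT).
rewrite /xe (bary_line nT') bx' (bary_vertex nT' _ zT') eqxx mulr0 add0r mulr1.
by move=> E; rewrite E ltxx in e0.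
Qed.

(** Both sides are affine functions of x vanishing on the common side, and they
    agree at z'. *)
Lemma neighbour_bary T' z' x : neighbour T z T' z' ->
  bary T x z = bary T' x z' * bary T z' z.
Proof.
move=> [TT' zT' _ SS']; have nT' := nondegenerate_element TT'.
rewrite [LHS](affine_bary nT' x (fun y => bary_affine nT y z)).
rewrite (big_fsetD1 z')//= big_seq big1 ?addr0// => q.
rewrite -SS' in_fsetD1 => /andP[qz qT]; rewrite (bary_vertex nT)//.
by rewrite (negPf qz) mulr0.
Qed.

End flag.

Section flag.
Variables (T : {fset 'rV[R]_d}) (z : 'rV[R]_d).
Hypotheses (TT : T \in Th) (zT : z \in T).
Let nT := nondegenerate_element TT.
Local Notation S := (T `\ z)%fset.

(** Of three elements with a common side, two would be on the same side of it. *)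
Lemma neighbour_unique T' z' T'' z'' :
  neighbour T z T' z' -> neighbour T z T'' z'' -> T' = T'' /\ z' = z''.
Proof.
move=> n1 n2; have [TT1 zT1 d1 E1] := n1; have [TT2 zT2 d2 E2] := n2.
have TE : T' = T''.
  apply/eqP/negPn/negP => ne.
  have n12 : neighbour T' z' T'' z'' by split=> //; rewrite -?E1// eq_sym.
  have h1 := neighbour_opposite TT zT n1; have h2 := neighbour_opposite TT zT n2.
  have h12 := neighbour_opposite TT1 zT1 n12.
  have E := neighbour_bary TT z'' n1.
  have : 0 < bary T' z'' z' * bary T z' z by rewrite nmulr_rgt0.
  by rewrite -E => /lt_trans/(_ h2); rewrite ltxx.
split=> //; have : z'' \notin S by rewrite E2 in_fsetD1 eqxx.
by rewrite E1 in_fsetD1 TE zT2 andbT negbK => /eqP ->.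
Qed.

(** Two elements on opposite sides cover a neighbourhood of the midpoint. *)
Lemma neighbour_barycenter T' z' : neighbour T z T' z' -> Omega (barycenter S).
Proof.
move=> nb; have [TT' zT' _ SS'] := nb; have nT' := nondegenerate_element TT'.
have dR : 0 < d%:R^-1 :> R by rewrite invr_gt0 ltr0n.
set x := barycenter S.
have [r r0 hr] := bary_near nT x dR; have [r' r'0 hr'] := bary_near nT' x dR.
apply: (@interior_closure _ (Num.min r r')); first by rewrite lt_min r0.
move=> y; rewrite lt_min => /andP[xr xr'].
have [yz|yz] := leP 0 (bary T y z).
  apply: (hull_closure TT); apply/(hullE nT) => p.
  have [pT|/(bary_off nT) ->//] := boolP (p \in T).
  have [->//|pz] := eqVneq p z.
  have := hr y xr p; rewrite (bary_barycenter_side nT zT d0 pT) (negPf pz).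
  by rewrite ltr_norml => /andP[_]; lra.
apply: (hull_closure TT'); apply/(hullE nT') => p.
have [pT|/(bary_off nT') ->//] := boolP (p \in T').
have [->|pz] := eqVneq p z'.
  move: yz; rewrite (neighbour_bary TT y nb) (nmulr_llt0 _ (neighbour_opposite TT zT nb)).
  exact: ltW.
have := hr' y xr' p; rewrite /x SS' (bary_barycenter_side nT' zT' d0 pT) (negPf pz).
by rewrite ltr_norml => /andP[_]; lra.
Qed.

Lemma closed_finite_near (x : 'rV[R]_d) :
  exists2 r, 0 < r & forall y, `|x - y| < r ->
    forall T', T' \in Th -> hull T' y -> hull T' x.
Proof.
have /choice[f hf] (T' : {fset 'rV[R]_d}) : exists r, 0 < r /\
    (T' \in Th -> forall y, `|x - y| < r -> hull T' y -> hull T' x).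
  have [TT'|TT'] := boolP (T' \in Th); last by exists 1.
  have [hx|hx] := pselect (hull T' x); first by exists 1.
  have oC : open (~` hull T').
    by apply: closed_openC; exact: closed_hull (nondegenerate_element TT').
  by have [r r0 hr] := open_rVP oC hx; exists r; split=> // _ y /hr.
have [e e0 he] := @seq_lower_bound _ _ Th f (fun T' _ => (hf T').1).
exists e => // y xy T' TT'; apply: (hf T').2 => //.
exact: lt_le_trans xy (he T' TT').
Qed.

(** Moving from the relative interior of the side out of T, one remains in
    Omega and thus enters another element, which contains the side. *)
Lemma neighbour_ex : ~ hull S `<=` boundary Omega ->
  exists T' z', neighbour T z T' z'.
Proof.
move=> /nonsubset[x [hx /not_andP[]]].
  by move=> []; apply: (hull_closure TT); exact: (hull_sub nT (fsubD1set _ _) hx).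
rewrite -/(interior Omega) => /contrapT; have /interior_id -> := open_Omega => Ox.
have dR : 0 < d%:R^-1 :> R by rewrite invr_gt0 ltr0n.
have [r r0 hr] := open_rVP open_Omega Ox.
have [/(hullE nT) hx0 xz] := (hull_sideE nT z x).1 hx.
(* First move along the side to a point x1 of its relative interior. *)
pose v := barycenter S - x.
have nv : 0 < `|v| + 1 by rewrite ltr_wpDl.
pose e := Num.min 2^-1 (r / 2 / (`|v| + 1)).
have e0 : 0 < e by rewrite lt_min invr_gt0 ltr0n !divr_gt0.
have e1 : e <= 2^-1 by rewrite ge_min lexx.
pose x1 := x + e *: v.
have x1r : `|x - x1| <= r / 2.
  rewrite /x1 opprD addrA subrr add0r normrN normrZ (gtr0_norm e0).
  have : e <= r / 2 / (`|v| + 1) by rewrite ge_min lexx orbT.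
  by rewrite ler_pdivlMr// mulrDr mulr1 => ?; lra.
have x1z : bary T x1 z = 0.
  by rewrite (bary_line nT) xz (bary_barycenter_side nT zT d0 zT) eqxx !mulr0 addr0.
have x1p p : p \in S -> 0 < bary T x1 p.
  rewrite in_fsetD1 => /andP[pz pT].
  rewrite (bary_line nT) (bary_barycenter_side nT zT d0 pT) (negPf pz).
  by rewrite ltr_wpDl ?mulr_gt0// mulr_ge0//; lra.
have hx1 : hull T x1.
  apply/(hullE nT) => p; have [pT|/(bary_off nT) ->//] := boolP (p \in T).
  have [->|pz] := eqVneq p z; first by rewrite x1z.
  by apply/ltW/x1p; rewrite in_fsetD1 pz.
have [s s0 hs] := closed_finite_near x1.
(* Then move away from z to a point w outside T. *)
pose u := x1 - z.
have nu : 0 < `|u| + 1 by rewrite ltr_wpDl.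
pose m := Num.min s (r / 2).
have m0 : 0 < m by rewrite lt_min s0 divr_gt0.
pose t := m / 2 / (`|u| + 1).
have t0 : 0 < t by rewrite !divr_gt0.
pose w := x1 + (- t) *: (z - x1).
have x1w : `|x1 - w| < m.
  rewrite /w opprD addrA subrr add0r scaleNr opprK normrZ (gtr0_norm t0) distrC -/u.
  have : t * (`|u| + 1) = m / 2 by rewrite /t divfK// lt0r_neq0.
  by rewrite mulrDr mulr1 => ?; lra.
have Ow : Omega w.
  apply: hr; rewrite -(subrK x1 x) -addrA; apply: le_lt_trans (ler_normD _ _) _.
  have : m <= r / 2 by rewrite ge_min lexx orbT.
  by lra.
have [T' TT' hw] := closure_hull (subset_closure Ow).
have hx1' : hull T' x1.
  by apply: (hs w _ T' TT' hw); apply: lt_le_trans x1w _; rewrite ge_min lexx.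
have ST' : (S `<=` T')%fset.
  apply/fsubsetP => p pS; apply: contraT => pT'.
  have /(hull_faceE nT _ (fsubsetIl _ _))[_ /(_ p)] := hull_meet TT TT' hx1 hx1'.
  rewrite in_fsetI negb_and pT' orbT => /(_ isT) h.
  by have := x1p p pS; rewrite h ltxx.
have TneT' : T' != T.
  apply/eqP => E; move: hw; rewrite E => /(hullE nT)/(_ z).
  rewrite (bary_line nT) x1z (bary_vertex nT _ zT) eqxx mulr0 add0r mulr1.
  by rewrite oppr_ge0 leNgt t0.
have [z' z'T' SE] := (is_side_ofP S (nondegenerate_element TT')).1
  (conj ST' (card_side nT zT)).
by exists T', z'.
Qed.

(** The dichotomy between boundary sides, belonging to one element, and interior
    sides, belonging to two. *)
Lemma flag_dichotomy :
  (is_boundary_side Omega Th S /\ forall T' z', ~ neighbour T z T' z') \/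
  (~ hull S `<=` boundary Omega /\ exists T' z', neighbour T z T' z').
Proof.
have [bS|bS] := pselect (hull S `<=` boundary Omega); [left|right]; split=> //.
- by split=> //; exists T => //; apply/is_side_ofP => //; exists z.
- move=> T' z' /neighbour_barycenter Ox.
  have [_] := bS _ (hull_barycenter_side nT zT d0).
  by apply; have /interior_id -> := open_Omega.
- exact: neighbour_ex.
Qed.

End flag.

Lemma boundary_off x : boundary Omega x -> ~ Omega x.
Proof. by move=> [_]; have /interior_id -> := open_Omega. Qed.

End triangulation_geometry.

(** * Elementwise integration *)

Section piecewise_integration.
Variables (R : realType) (d : nat).
Variables (Omega : set 'rV[R]_d) (Th : {fset {fset 'rV[R]_d}}).
Hypothesis d0 : (0 < d)%N.
Hypothesis hOmega : bounded_lipschitz_domain Omega.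
Hypothesis hTh : regular_triangulation Omega Th.
Local Notation mu := (lebesgue_measure_rV R d).
Implicit Types (x y z p : 'rV[R]_d) (S T : {fset 'rV[R]_d}).
Implicit Types (f w : 'rV[R]_d -> R) (F : {fset 'rV[R]_d} -> 'rV[R]_d -> R).

Lemma ae_forall_seq (A : eqType) (s : seq A) (P : A -> 'rV[R]_d -> Prop) :
  (forall a, a \in s -> {ae mu, forall x, P a x}) ->
  {ae mu, forall x, forall a, a \in s -> P a x}.
Proof.
elim: s => [_|a s IH h]; first exact: aeW.
have ha := h a (mem_head _ _).
have hs : {ae mu, forall x, forall b, b \in s -> P b x}.
  by apply: IH => b bs; apply: h; rewrite inE bs orbT.
apply: filterS2 ha hs => x Pa Ps b; rewrite inE => /predU1P[->//|]; exact: Ps.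
Qed.

Lemma tame_sum_seq (A : eqType) (s : seq A) (F : A -> 'rV[R]_d -> R) :
  (forall a, a \in s -> tame (F a)) -> tame (fun x => \sum_(a <- s) F a x).
Proof.
elim: s => [_|a s IH h].
  by under eq_fun do rewrite big_nil; exact: tame_cst.
under eq_fun do rewrite big_cons; apply: tameD; first by apply: h; rewrite mem_head.
by apply: IH => b bs; apply: h; rewrite inE bs orbT.
Qed.

Lemma Int_sum_seq D (A : eqType) (s : seq A) (F : A -> 'rV[R]_d -> R) :
  bounded_measurable D -> (forall a, a \in s -> tame (F a)) ->
  \int[mu]_(x in D) (\sum_(a <- s) F a x) = \sum_(a <- s) \int[mu]_(x in D) F a x.
Proof.
move=> bD; elim: s => [_|a s IH h].
  by rewrite big_nil; under eq_Rintegral do rewrite big_nil; rewrite Int_cst// mul0r.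
have hs b : b \in s -> tame (F b) by move=> bs; apply: h; rewrite inE bs orbT.
rewrite big_cons; under eq_Rintegral do rewrite big_cons.
by rewrite IntD ?IH//; [apply: h; rewrite mem_head|exact: tame_sum_seq].
Qed.

(** The faces are null sets. *)
Lemma ae_hull_open_simplex T : nondegenerate T ->
  {ae mu, forall x, hull T x -> open_simplex T x}.
Proof.
move=> nT.
have : {ae mu, forall x, forall p, p \in (T : seq _) -> hull T x -> bary T x p != 0}.
  apply: ae_forall_seq => p pT.
  exists (hull T `&` [set x | bary T x p = 0]); split.
  - apply: measurableI; first exact: measurable_hull.
    have tb := tame_bary nT p.
    rewrite (_ : [set x | _] = [set x | bary T x p <= 0] `&` [set x | 0 <= bary T x p]).
      by apply: measurableI; apply: measurable_le_tame => //; exact: tame_cst.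
    apply/seteqP; split=> x /=; first by move=> ->.
    by move=> [? ?]; apply/eqP; rewrite eq_le; apply/andP.
  - exact: measure_face0.
  - by move=> x /= /not_implyP[hx /negP]; rewrite negbK => /eqP.
apply: filterS => x h hx p pT; rewrite lt_neqAle eq_sym h//.
by have /(hullE nT) := hx; exact.
Qed.

Lemma ae_Omega_open_simplex :
  {ae mu, forall x, Omega x -> exists2 T, T \in Th & open_simplex T x}.
Proof.
have : {ae mu, forall x, forall T, T \in (Th : seq _) -> hull T x -> open_simplex T x}.
  by apply: ae_forall_seq => T TT; apply: ae_hull_open_simplex;
    apply: (nondegenerate_element hTh); exact: TT.
apply: filterS => x h Ox.
have [T TT hx] := closure_hull hTh (subset_closure Ox).
by exists T => //; exact: h.
Qed.

Lemma ae_eq_Int D f g : measurable D -> measurable_fun D f ->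
  measurable_fun D g -> f = g %[ae mu in D] ->
  \int[mu]_(x in D) f x = \int[mu]_(x in D) g x.
Proof.
move=> mD mf mg fg; congr fine; apply: ae_eq_integral => //.
- exact/measurable_EFinP.
- exact/measurable_EFinP.
- by apply: filterS fg => x h Dx; rewrite h.
Qed.

Lemma Int_indic D U f :
  \int[mu]_(x in D) (\1_U x * f x) = \int[mu]_(x in D `&` U) f x.
Proof.
rewrite Rintegral_mkcondr; apply: eq_Int => x _.
by rewrite indicE /patch; case: ifP => _; rewrite ?mul1r ?mul0r.
Qed.

Lemma bounded_measurable_Omega : bounded_measurable Omega.
Proof.
split; first by apply: open_measurable_rV; exact: open_Omega hOmega.
have [_ _ _ [M [_ hM]] _] := hOmega.
by exists (M + 1) => x Ox; apply: (hM (M + 1)) => //; rewrite ltrDl.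
Qed.

Lemma measurable_open_simplex T : nondegenerate T -> measurable (open_simplex T).
Proof. by move=> nT; apply: open_measurable_rV; exact: open_open_simplex. Qed.

(** Elements overlap on their sides, so the gluing uses their disjoint interiors
    and vanishes on the null set which remains. *)
Definition pieces F x := \sum_(T <- Th) \1_(open_simplex T) x * F T x.

Lemma pieces_in F T x : T \in Th -> open_simplex T x -> pieces F x = F T x.
Proof.
move=> TT Tx; rewrite /pieces (big_fsetD1 T)//= indicE mem_set// mul1r.
rewrite big_seq big1 ?addr0// => T'; rewrite in_fsetD1 => /andP[T'T TT'].
rewrite indicE memNset ?mul0r// => T'x; move/eqP: T'T; apply.
apply: (open_simplex_meet hTh TT TT' Tx).
exact: open_simplex_hull (nondegenerate_element hTh TT') _ T'x.
Qed.

Lemma pieces_ae F T : T \in Th -> pieces F = F T %[ae mu in hull T].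
Proof.
move=> TT; apply: filterS (ae_hull_open_simplex (nondegenerate_element hTh TT)).
by move=> x h /h; exact: pieces_in.
Qed.

Lemma tame_pieces F : (forall T, tame (F T)) -> tame (pieces F).
Proof.
move=> tF; apply: tame_sum_seq => T TT; apply: tameM => //; apply: tame_indic.
exact: measurable_open_simplex (nondegenerate_element hTh TT).
Qed.

Lemma pieces_ae_Omega F f : (forall T, T \in Th -> f = F T %[ae mu in hull T]) ->
  f = pieces F %[ae mu in Omega].
Proof.
move=> fF.
have : {ae mu, forall x, forall T, T \in (Th : seq _) -> hull T x -> f x = F T x}.
  by apply: ae_forall_seq => T TT; exact: fF.
apply: filterS2 ae_Omega_open_simplex => x h1 h2 /h1[T TT Tx].
rewrite (pieces_in _ TT Tx); apply: h2 => //.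
exact: open_simplex_hull (nondegenerate_element hTh TT) _ Tx.
Qed.

Lemma Int_open_simplex T f : T \in Th -> measurable_fun setT f ->
  \int[mu]_(x in hull T) f x = \int[mu]_(x in open_simplex T) f x.
Proof.
move=> TT mf; have nT := nondegenerate_element hTh TT.
have mU := measurable_open_simplex nT.
rewrite -[in RHS](setIidr (open_simplex_hull nT)) -Int_indic.
apply: ae_eq_Int; first exact: measurable_hull.
- exact: measurable_funTS.
- by apply: measurable_funTS; apply: measurable_funM => //; exact: measurable_indic.
- apply: filterS (ae_hull_open_simplex nT) => x h /h Tx.
  by rewrite indicE mem_set// mul1r.
Qed.

Lemma Int_Omega_pieces F : (forall T, tame (F T)) ->
  \int[mu]_(x in Omega) pieces F x = \sum_(T <- Th) \int[mu]_(x in hull T) F T x.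
Proof.
move=> tF; rewrite /pieces (Int_sum_seq bounded_measurable_Omega); last first.
  move=> T TT; apply: tameM => //; apply: tame_indic.
  exact: measurable_open_simplex (nondegenerate_element hTh TT).
rewrite big_seq [RHS]big_seq; apply: eq_bigr => T TT.
rewrite Int_indic (setIidr (open_simplex_sub hOmega hTh TT)) Int_open_simplex//.
exact: (tF T).1.
Qed.

Lemma Int_Omega F f : (forall T, tame (F T)) -> measurable_fun setT f ->
  (forall T, T \in Th -> f = F T %[ae mu in hull T]) ->
  \int[mu]_(x in Omega) f x = \sum_(T <- Th) \int[mu]_(x in hull T) F T x.
Proof.
move=> tF mf fF; rewrite -Int_Omega_pieces//; apply: ae_eq_Int.
- exact: bounded_measurable_Omega.1.
- exact: measurable_funTS.
- by apply: measurable_funTS; exact: (tame_pieces tF).1.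
- exact: pieces_ae_Omega.
Qed.

(** Each side contributes a single flag or a pair of neighbours, since
    neighbours are unique. *)
Lemma flag_sum_eq0 (F : {fset 'rV[R]_d} -> 'rV[R]_d -> R) :
  (forall T z, T \in Th -> z \in T -> (forall T' z', ~ neighbour Th T z T' z') ->
     F T z = 0) ->
  (forall T z T' z', T \in Th -> z \in T -> neighbour Th T z T' z' ->
     F T z + F T' z' = 0) ->
  \sum_(T <- Th) \sum_(z <- T) F T z = 0.
Proof.
move=> Fb Fn.
(* The double sum is regrouped by sides, given by their vertex sets. *)
pose sides := undup (flatten [seq [seq (T `\ z)%fset | z <- (T : seq _)] | T <- (Th : seq _)]).
have mem_sides T z : T \in Th -> z \in T -> (T `\ z)%fset \in sides.
  move=> TT zT; rewrite mem_undup; apply/flatten_mapP; exists T => //.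
  by apply/mapP; exists z.
pose G S T := \sum_(z <- T) (if (T `\ z)%fset == S then F T z else 0).
have -> : \sum_(T <- Th) \sum_(z <- T) F T z =
    \sum_(S <- sides) \sum_(T <- Th) G S T.
  rewrite exchange_big/= big_seq [RHS]big_seq; apply: eq_bigr => T TT.
  rewrite exchange_big/= big_seq [RHS]big_seq; apply: eq_bigr => z zT.
  rewrite (bigD1_seq (T `\ z)%fset)/= ?undup_uniq ?mem_sides// eqxx.
  by rewrite big1 ?addr0// => S; rewrite eq_sym => /negPf ->.
rewrite big_seq big1// => S; rewrite mem_undup => /flatten_mapP[T TT /mapP[z zT SE]].
have nT := nondegenerate_element hTh TT.
have GE T' z' : T' \in Th -> z' \in T' -> (T' `\ z')%fset = S -> G S T' = F T' z'.
  move=> TT' zT' SE'; rewrite /G (big_fsetD1 z')//= (introT eqP SE') big_seq big1 ?addr0//.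
  move=> q; rewrite in_fsetD1 => /andP[qz qT']; case: eqP => // E.
  have : q \in (T' `\ q)%fset by rewrite E -SE' in_fsetD1 qz.
  by rewrite in_fsetD1 eqxx.
have G0 T' : T' \in Th -> (forall z', z' \in T' -> (T' `\ z')%fset != S) -> G S T' = 0.
  by move=> TT' h; rewrite /G big_seq big1// => q /h /negPf ->.
rewrite (big_fsetD1 T)//= (GE T z)//.
have [[T' [z' nb]]|nn] := pselect (exists T' z', neighbour Th T z T' z'); last first.
  rewrite Fb//; last by move=> T' z' nb; apply: nn; exists T', z'.
  rewrite add0r big_seq big1// => T'; rewrite in_fsetD1 => /andP[T'T TT'].
  apply: G0 => // z' zT'; apply/eqP => E; apply: nn; exists T', z'.
  by split=> //; rewrite E.
have [TT' zT' T'T SE'] := nb.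
rewrite (big_fsetD1 T')/=; last by rewrite in_fsetD1 T'T.
rewrite (GE T' z')//; last by rewrite -SE'.
rewrite addrA (Fn _ _ _ _ TT zT nb) add0r big_seq big1// => T''.
rewrite !in_fsetD1 => /and3P[T''T' T''T TT'']; apply: G0 => // q qT''.
apply/eqP => E; move/eqP: T''T'; apply.
have nb'' : neighbour Th T z T'' q by split=> //; rewrite E.
by have [->] := neighbour_unique d0 hTh TT zT nb'' nb.
Qed.

End piecewise_integration.

(** * The weak divergence of elementwise Raviart--Thomas fields *)

Section weak_divergence.
Variables (R : realType) (d : nat).
Variables (Omega : set 'rV[R]_d) (Th : {fset {fset 'rV[R]_d}}).
Hypothesis d0 : (0 < d)%N.
Hypothesis hOmega : bounded_lipschitz_domain Omega.
Hypothesis hTh : regular_triangulation Omega Th.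
Local Notation mu := (lebesgue_measure_rV R d).
Implicit Types (x y z p : 'rV[R]_d) (S T : {fset 'rV[R]_d}).
Implicit Types (phi g : 'rV[R]_d -> R) (U : set 'rV[R]_d).

(** The average of phi over the side opposite to z, as the average over T of
    the projected function: no surface measure is needed. *)
Definition side_average T z phi := average T (side_trace T z phi).

Lemma tame_test_trace T z U phi : nondegenerate T -> z \in T ->
  test_function U phi -> tame (side_trace T z phi).
Proof.
move=> nT zT /test_function_estimates[tphi _ [M hM] _ _].
exact: tame_side_trace tphi.1 hM.
Qed.

(** Integration by parts on one element, by Gauss' theorem for each of the
    fields x - z. *)
Lemma Int_RT_grad T (a : 'rV[R]_d) (b : R) U phi :
  nondegenerate T -> test_function U phi ->
  \int[mu]_(x in hull T) dot (RT_shape T a b x) (grad phi x) =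
  d%:R * (\sum_(z <- T) volume T * RT_flux T a b z * side_average T z phi) -
  d%:R * b * \int[mu]_(x in hull T) phi x.
Proof.
move=> nT tphi.
have [tp tg [M hM] [L hL] [C hC]] := test_function_estimates tphi.
have tdot z : tame (fun x => dot (x - z) (grad phi x)).
  apply: tame_dot => // i; under eq_fun do rewrite !mxE.
  by apply: tameD; [exact: tame_coord|exact: tame_cst].
have -> : \int[mu]_(x in hull T) dot (RT_shape T a b x) (grad phi x) =
    \int[mu]_(x in hull T) \sum_(z <- T) RT_flux T a b z * dot (x - z) (grad phi x).
  apply: eq_Int => x _; rewrite (RT_shapeE nT) dot_suml.
  by apply: eq_bigr => z _; rewrite dotZl.
rewrite (Int_sum (bounded_measurable_hull nT)); last by move=> z; exact: tameZ.
rewrite [in RHS](Int_average nT) -[X in _ * X * _](sum_RT_flux nT a b).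
rewrite mulr_sumr [d%:R * \sum_(_ <- _) _]mulr_sumr mulr_suml -sumrB.
rewrite big_seq [RHS]big_seq; apply: eq_bigr => z zT.
rewrite (IntZ (bounded_measurable_hull nT) _ (tdot z)) (Int_average nT).
have := gauss_cone nT zT tp tg hM hL hC.
rewrite -/(side_average T z phi) => E.
have -> : average T (fun x => dot (x - z) (grad phi x)) =
    d%:R * side_average T z phi - d%:R * average T phi by rewrite -E addrK.
ring.
Qed.

Lemma side_average_off T z U phi : nondegenerate T -> z \in T ->
  test_function U phi -> (forall x, hull (T `\ z)%fset x -> ~ U x) ->
  side_average T z phi = 0.
Proof.
move=> nT zT tphi h; rewrite /side_average -[RHS](average_cst nT 0).
apply: eq_average => // x hx; rewrite /side_trace.
have [|x1] := eqVneq (bary T x z) 1; first by rewrite mul0r.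
rewrite mul1r; apply: (test_function_off tphi); apply: h.
exact: cone_proj_hull.
Qed.

Lemma side_average_boundary T z phi : T \in Th -> z \in T ->
  test_function Omega phi -> (forall T' z', ~ neighbour Th T z T' z') ->
  side_average T z phi = 0.
Proof.
move=> TT zT tphi nn; have nT := nondegenerate_element hTh TT.
apply: (side_average_off nT zT tphi) => x hx.
have [[[_ bS] _]|[_ [T' [z' /nn//]]]] := flag_dichotomy d0 hOmega hTh TT zT.
exact: (boundary_off hOmega (bS x hx)).
Qed.

Lemma side_average_neighbour T z T' z' U phi : T \in Th -> z \in T ->
  neighbour Th T z T' z' -> test_function U phi ->
  side_average T z phi = side_average T' z' phi.
Proof.
move=> TT zT [TT' zT' _ SE] /test_function_estimates[tp _ [M hM] _ _].
apply: (average_side_trace_eq _ _ zT zT' SE tp.1 hM);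
  exact: (nondegenerate_element hTh).
Qed.

Lemma bary_continuous T z : nondegenerate T -> continuous (fun x => bary T x z).
Proof.
move=> nT x; apply/(@cvgrPdist_lt _ _ _ (nbhs x)) => e e0.
have [r r0 hr] := bary_near nT x e0.
have : nbhs x [set y | `|bary T x z - bary T y z| < e].
  by apply: (@nbhs_rVP _ _ _ _ r) => // y xy; exact: hr.
by [].
Qed.

(** The barycenter of T projects onto the midpoint of the side, so the projected
    function is bounded below in a small box. *)
Lemma side_average_gt0 T z U phi : nondegenerate T -> z \in T ->
  test_function U phi -> (forall x, 0 <= phi x) ->
  0 < phi (barycenter (T `\ z)%fset) -> 0 < side_average T z phi.
Proof.
move=> nT zT tphi phi0; set xS := barycenter _ => phiS.
have ttr := tame_test_trace nT zT tphi.
pose P x := z + (1 - bary T x z)^-1 *: (x - z).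
pose xT := barycenter T.
have dn0 : d%:R != 0 :> R by rewrite pnatr_eq0 -lt0n.
have dn1 : d.+1%:R != 0 :> R by rewrite pnatr_eq0.
have bT : bary T xT z = d.+1%:R^-1 by rewrite (bary_barycenter nT).
have bT1 : 1 - bary T xT z = d%:R / d.+1%:R.
  by rewrite bT -natr1; field; rewrite natr1.
have bTn0 : 1 - bary T xT z != 0 by rewrite bT1 mulf_neq0// invr_neq0.
have PT : P xT = xS.
  rewrite /P bT1 invf_div /xS (barycenter_sideE nT zT d0) -/xT.
  rewrite -[X in z + _ *: X]scale1r.
  have -> : d.+1%:R / d%:R = 1 + d%:R^-1 :> R by rewrite -natr1; field.
  by rewrite scale1r scalerDl scale1r addrA addrCA subrr addr0.
have cphi : continuous phi by case: tphi => /(_ 0%N).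
have FF : Filter (nbhs xT) := nbhs_filter xT.
have cP : phi (P x) @[x --> xT] --> phi xS.
  have h0 : bary T x z @[x --> xT] --> bary T xT z by exact: bary_continuous.
  have h1 := cvgV bTn0 (cvgB (cvg_cst (1 : R)) h0).
  have h2 : (x - z) @[x --> xT] --> xT - z by exact: (cvgB cvg_id (cvg_cst z)).
  have h3 := @cvgZ _ _ _ _ FF _ _ _ _ (h1 FF FF FF) h2.
  have h4 := @cvgD _ _ _ _ FF _ _ _ _ (@cvg_cst _ z _ _ FF) h3.
  have h5 : P @ xT --> P xT by exact: h4.
  by rewrite -PT; exact: (@cvg_comp _ _ _ P phi _ _ _ h5 (cphi (P xT))).
have near1 : \forall x \near xT, phi xS / 2 < phi (P x).
  by apply: (cvgr_gt _ cP); rewrite ltr_pdivrMr// ltr_pMr// ltr1n.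
have near2 : \forall x \near xT, open_simplex T x.
  apply: open_nbhs_nbhs; split; first exact: open_open_simplex.
  by move=> p pT; rewrite (bary_barycenter nT pT) invr_gt0.
have near3 : \forall x \near xT, bary T x z != 1.
  have bT_lt1 : bary T xT z < 1 by rewrite -subr_gt0 bT1 divr_gt0 ?ltr0n.
  have := @cvgr_lt _ _ _ FF _ _ (@bary_continuous T z nT xT) _ bT_lt1.
  by apply: (@filterS _ _ FF) => x /lt_eqF ->.
have /nbhs_ballP[r /= r0 hr] : nbhs xT [set x | [/\ phi xS / 2 < phi (P x), open_simplex T x & bary T x z != 1]].
  by apply: (@filterS3 _ _ FF _ _ _ _ _ near1 near2 near3) => x ? ? ?; split.
have {}hr y : `|xT - y| < r -> [/\ phi xS / 2 < phi (P y), open_simplex T y & bary T y z != 1].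
  by move=> /ball_rVE /hr.
pose B := box (xT - const_mx r) (xT + const_mx r).
have mB : measurable B by exact: measurable_box.
rewrite /side_average /average mulr_gt0//.
  by rewrite invr_gt0; exact: volume_gt0.
have Bh : B `<=` hull T.
  by move=> y /(box_ball _ _ r0).1/hr[_ + _]; exact: open_simplex_hull.
apply: (@lt_le_trans _ _ (\int[mu]_(x in hull T) (phi xS / 2 * \1_B x))).
  rewrite (IntZ (bounded_measurable_hull nT)); last exact: tame_indic.
  rewrite mulr_gt0 ?divr_gt0//.
  have -> : \int[mu]_(x in hull T) \1_B x = \int[mu]_(x in hull T) (\1_B x * 1).
    by apply: eq_Int => x _; rewrite mulr1.
  have bB : bounded_measurable B.
    exact: bounded_measurableS mB Bh (bounded_measurable_hull nT).
  rewrite Int_indic (setIidr Bh) (Int_cst bB) mul1r fine_gt0//.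
  rewrite bounded_measurable_lty// andbT.
  have BB y : `|xT - y| < r -> B y by move=> xy; exact: (box_ball _ _ r0).2.
  exact: (measure_ball_gt0 r0 mB BB).
apply: (le_Int (bounded_measurable_hull nT)) => //.
  by apply: tameZ; exact: tame_indic.
move=> x hx; rewrite indicE; case: (boolP (x \in B)) => [|_]; last first.
  by rewrite mulr0 /side_trace mulr_ge0.
rewrite inE => /(box_ball _ _ r0).1/hr[h1 _ h3].
rewrite mulr1 /side_trace h3 mul1r (cone_projE nT zT h3); exact: ltW.
Qed.

Section pieces.
Variables (y : 'rV[R]_d -> 'rV[R]_d) (a : {fset 'rV[R]_d} -> 'rV[R]_d).
Variable b : {fset 'rV[R]_d} -> R.
Hypothesis my : forall j, measurable_fun setT (component y j).
Hypothesis yE : forall T, T \in Th -> y = RT_shape T (a T) (b T) %[ae mu in hull T].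

Local Notation flux T z := (volume T * RT_flux T (a T) (b T) z).

(** Continuity of the normal component across interior sides: the two outward
    fluxes are opposite. *)
Definition compatible_fluxes := forall T z T' z', T \in Th -> z \in T ->
  neighbour Th T z T' z' -> flux T z + flux T' z' = 0.

Lemma tame_RT_shape T (u : 'rV[R]_d) (c : R) j :
  tame (fun x => RT_shape T u c x ord0 j).
Proof.
rewrite /RT_shape; under eq_fun do rewrite !mxE.
apply: tameD; first exact: tame_cst; apply: tameZ.
by apply: tameD; [exact: tame_coord|exact: tame_cst].
Qed.

(** Summation over the elements leaves the fluxes through the sides and the
    elementwise divergence d b. *)
Lemma Int_grad_pieces phi : test_function Omega phi ->
  \int[mu]_(x in Omega) dot (y x) (grad phi x) =
  d%:R * (\sum_(T <- Th) \sum_(z <- T) flux T z * side_average T z phi) -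
  \int[mu]_(x in Omega) (pieces Th (fun T _ => d%:R * b T) x * phi x).
Proof.
move=> tphi; have [tp tg _ _ _] := test_function_estimates tphi.
rewrite (Int_Omega hOmega hTh (F := fun T x => dot (RT_shape T (a T) (b T) x) (grad phi x))).
- rewrite (Int_Omega hOmega hTh (F := fun T x => d%:R * b T * phi x)); first last.
  + by move=> T TT; apply: filterS (pieces_ae hTh (fun T _ => d%:R * b T) TT) => x h /h ->.
  + apply: measurable_funM tp.1.
    by have [] := @tame_pieces _ _ _ _ hTh (fun T _ => d%:R * b T) (fun T => tame_cst _ (d%:R * b T)).
  + by move=> T; exact: tameZ.
  rewrite mulr_sumr -sumrB big_seq [RHS]big_seq; apply: eq_bigr => T TT.
  have nT := nondegenerate_element hTh TT.
  by rewrite (Int_RT_grad _ _ nT tphi) (IntZ (bounded_measurable_hull nT)).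
- by move=> T; apply: tame_dot => // j; exact: tame_RT_shape.
- rewrite /dot; apply: measurable_sum => j; apply: measurable_funM; first exact: my.
  exact: (tg j).1.
- by move=> T TT; apply: filterS (yE TT) => x h /h ->.
Qed.

Lemma L2_tame g : tame g -> L2 Omega g.
Proof.
move=> tg; split; first exact: tg.1.
apply: (tame_integrable (f := fun x => g x ^+ 2)).
  exact: bounded_measurable_Omega.
by rewrite (_ : (fun x => _) = fun x => g x * g x)//; exact: tameM.
Qed.

(** The side contributions cancel in pairs in the interior, and vanish on the
    boundary, where test functions are zero. *)
Lemma is_div_of_compatible_fluxes : compatible_fluxes ->
  is_div Omega y (pieces Th (fun T _ => d%:R * b T)).
Proof.
move=> comp; split.
  exact: L2_tame (@tame_pieces _ _ _ _ hTh (fun T _ => d%:R * b T) (fun T => tame_cst _ (d%:R * b T))).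
move=> phi tphi; rewrite Int_grad_pieces// (flag_sum_eq0 d0 hTh) ?mulr0 ?sub0r//.
  move=> T z TT zT nn.
  by rewrite (side_average_boundary TT zT tphi nn) mulr0.
move=> T z T' z' TT zT nb.
rewrite (side_average_neighbour TT zT nb tphi) -mulrDl comp// mul0r.
by [].
Qed.

Section converse.
Variable g : 'rV[R]_d -> R.
Hypothesis yg : is_div Omega y g.

Lemma integrable_div : mu.-integrable Omega (EFin \o g).
Proof.
have [[mg g2] _] := yg.
have bO := bounded_measurable_Omega hOmega.
have mO := bO.1.
have i0 : mu.-integrable Omega (EFin \o cst (1 : R)).
  by apply: (tame_integrable (f := cst 1) bO); exact: tame_cst.
have i1 := integrableD mO i0 g2.
apply: le_integrable i1 => //.
  by apply/measurable_EFinP; exact: measurable_funTS.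
move=> x _; rewrite /= lee_fin [leRHS]ger0_norm ?addr_ge0 ?sqr_ge0//.
have := sqr_ge0 (`|g x| - 1); rewrite -(real_normK (num_real (g x))).
by have := normr_ge0 (g x); nra.
Qed.

(** Test functions supported inside one element see no side. *)
Lemma div_on_element T : T \in Th -> g = cst (d%:R * b T) %[ae mu in hull T].
Proof.
move=> TT; have nT := nondegenerate_element hTh TT.
have [[mg g2] gy] := yg.
pose U := open_simplex T.
have oU : open U := open_open_simplex nT.
have UO : U `<=` Omega := open_simplex_sub hOmega hTh TT.
have mU : measurable U := measurable_open_simplex nT.
have bU : bounded_measurable U.
  exact: bounded_measurableS mU (open_simplex_hull nT) (bounded_measurable_hull nT).
pose f x := g x - d%:R * b T.
have iU : mu.-integrable U (EFin \o g).
  by apply: integrableS integrable_div => //; exact: (bounded_measurable_Omega hOmega).1.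
have ic : mu.-integrable U (EFin \o cst (d%:R * b T)).
  by apply: (tame_integrable (f := cst _) bU); exact: tame_cst.
have fi : mu.-integrable U (EFin \o f).
  have iB := integrableB mU iU ic.
  by apply: (eq_integrable mU _ _ _ iB) => x _; rewrite /f /= EFinB.
have mf : measurable_fun setT f by apply: measurable_funB.
suff : f = cst 0 %[ae mu in U].
  move=> fU; apply: filterS2 fU (ae_hull_open_simplex nT) => x h1 h2 /h2/h1 /eqP.
  by rewrite subr_eq0 => /eqP.
apply: (du_bois_reymond oU mf fi) => phi tphi.
have tphiO : test_function Omega phi.
  by case: tphi => C K s; split=> //; exact: subset_trans s UO.
have [tp _ [M hM] _ _] := test_function_estimates tphi.
have restrict (h : 'rV[R]_d -> R) :
    \int[mu]_(x in Omega) (h x * phi x) = \int[mu]_(x in U) (h x * phi x).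
  rewrite -[in RHS](setIidr UO) -Int_indic; apply: eq_Int => x _.
  rewrite indicE; case: (boolP (x \in U)); rewrite ?mul1r// notin_setE => Ux.
  by rewrite (test_function_off tphi Ux) !mulr0.
have := gy _ tphiO; rewrite Int_grad_pieces// big_seq big1; last first.
  move=> T' TT'; rewrite big_seq big1// => z zT'.
  have nT' := nondegenerate_element hTh TT'.
  rewrite (side_average_off nT' zT' tphi) ?mulr0// => x.
  move=> /(hull_sideE nT')[hx xz] Ux.
  have E := open_simplex_meet hTh TT TT' Ux hx.
  by have := Ux z; rewrite -E xz ltxx => /(_ zT').
rewrite mulr0 sub0r => /oppr_inj; rewrite !restrict => E.
have -> : \int[mu]_(x in U) (f x * phi x) =
    \int[mu]_(x in U) (g x * phi x - d%:R * b T * phi x).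
  by apply: eq_Int => x _; rewrite /f mulrBl.
rewrite RintegralB//; last 2 first.
- apply: (le_integrable mU _ _ (integrableZl mU `|M| (integrable_norm iU))).
    by apply/measurable_EFinP; apply: measurable_funTS; apply: measurable_funM => //; exact: tp.1.
  move=> x _; rewrite /= lee_fin !normrM !normr_id mulrC.
  by apply: ler_wpM2r => //; exact: le_trans (hM x) (ler_norm _).
- by apply: (tame_integrable (f := fun x => d%:R * b T * phi x) bU); exact: tameZ.
apply/eqP; rewrite subr_eq0 -E; apply/eqP; apply: eq_Int => x Ux.
by rewrite (pieces_in hTh _ TT Ux).
Qed.

(** A bump at the midpoint of an interior side, with support so small that it
    meets no other side, isolates the sum of the two fluxes. *)
Lemma compatible_fluxes_of_div : compatible_fluxes.
Proof.
move=> T z T' z' TT zT nb; have [TT' zT' T'T SE] := nb.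
have nT := nondegenerate_element hTh TT.
have nT' := nondegenerate_element hTh TT'.
have [[mg g2] gy] := yg.
set xS := barycenter (T `\ z)%fset.
have OxS : Omega xS by exact: neighbour_barycenter nb.
have dR : 0 < d%:R^-1 :> R by rewrite invr_gt0 ltr0n.
have [r1 r10 hr1] := open_rVP (open_Omega hOmega) OxS.
have [r2 r20 hr2] := closed_finite_near hTh xS.
have [r3 r30 hr3] := bary_near nT xS dR.
have [r4 r40 hr4] := bary_near nT' xS dR.
pose r := Num.min (Num.min r1 r2) (Num.min r3 r4).
have r0 : 0 < r by rewrite !lt_min r10 r20 r30.
pose U := [set x | `|xS - x| < r].
have hU x : U x -> [/\ `|xS - x| < r1, `|xS - x| < r2, `|xS - x| < r3 & `|xS - x| < r4].
  by rewrite /U /= !lt_min => /andP[/andP[-> ->] /andP[-> ->]].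
have r2' : 0 < r / 2 by rewrite divr_gt0.
pose phi := bump (xS - const_mx (r / 2)) (xS + const_mx (r / 2)) 1.
have KU : closed_box (xS - const_mx (r / 2)) (xS + const_mx (r / 2)) `<=` U.
  move=> x hx; apply: ltr_norm_rV => // i; have := hx i; rewrite !mxE => /andP[? ?].
  by rewrite ltr_norml; apply/andP; split; lra.
have tU : test_function U phi by exact: test_function_bump.
have tO : test_function Omega phi.
  by apply: test_function_bump => // x /KU/hU[/hr1].
(* Sides other than the given one stay away from the support of the bump. *)
have Joff T'' p : T'' \in Th -> p \in T'' -> ~ (T'' = T /\ p = z) ->
    ~ (T'' = T' /\ p = z') -> side_average T'' p phi = 0.
  move=> TT'' pT'' n1 n2; have nT'' := nondegenerate_element hTh TT''.
  apply: (side_average_off nT'' pT'' tU) => x /(hull_sideE nT'')[hx xp] /hU[_ xr2 xr3 xr4].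
  have hS := hr2 x xr2 T'' TT'' hx.
  have [E|T''T] := eqVneq T'' T.
    have pz : p <> z by move=> E'; apply: n1.
    have := hr3 x xr3 p; rewrite -E xp subr0 E.
    rewrite (bary_barycenter_side nT zT d0) -?E//; case: eqP => // _.
    by rewrite ger0_norm ?ltxx// ltW.
  have hST : hull T xS.
    by have /(hull_sideE nT)[] := hull_barycenter_side nT zT d0.
  have sS : (T `\ z `<=` T'')%fset.
    apply/fsubsetP => q qS; apply: contraT => qT''.
    have /(hull_faceE nT _ (fsubsetIl _ _))[_ /(_ q)] := hull_meet hTh TT TT'' hST hS.
    rewrite in_fsetI negb_and qT'' orbT => /(_ isT).
    move: qS; rewrite in_fsetD1 => /andP[qz qT].
    rewrite (bary_barycenter_side nT zT d0 qT) (negPf qz) => h.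
    by rewrite h ltxx in dR.
  have [z'' z''T'' SE''] := (is_side_ofP _ nT'').1 (conj sS (card_side nT zT)).
  have nb'' : neighbour Th T z T'' z'' by [].
  have [E1 E2] := neighbour_unique d0 hTh TT zT nb'' nb.
  have pz : p <> z'' by move=> E'; apply: n2; rewrite E' E2.
  have := hr4 x xr4 p; rewrite -E1 xp subr0 /xS SE''.
  rewrite (bary_barycenter_side nT'' z''T'' d0 pT''); case: eqP => // _.
  by rewrite ger0_norm ?ltxx// ltW.
have := gy _ tO; rewrite Int_grad_pieces//.
have -> : \int[mu]_(x in Omega) (pieces Th (fun T0 _ => d%:R * b T0) x * phi x) =
    \int[mu]_(x in Omega) (g x * phi x).
  have tpp := test_function_estimates tO; have [tp _ _ _ _] := tpp.
  apply: ae_eq_Int; first exact: (bounded_measurable_Omega hOmega).1.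
  - apply: measurable_funTS; apply: measurable_funM; last exact: tp.1.
    by have [] := @tame_pieces _ _ _ _ hTh (fun T _ => d%:R * b T) (fun T => tame_cst _ (d%:R * b T)).
  - by apply: measurable_funTS; apply: measurable_funM => //; exact: tp.1.
  - have gp : g = pieces Th (fun T0 _ => d%:R * b T0) %[ae mu in Omega].
      by apply: pieces_ae_Omega => // T0; exact: div_on_element.
    by apply: filterS gp => x h /h ->.
move=> /eqP; rewrite -subr_eq0 opprK subrK mulf_eq0 pnatr_eq0 eqn0Ngt d0 /= => /eqP.
have sumT : \sum_(p <- T) flux T p * side_average T p phi =
    flux T z * side_average T z phi.
  rewrite (big_fsetD1 z zT) big_seq big1 => [|p]; first exact: addr0.
  rewrite in_fsetD1 => /andP[/eqP pz pT]; rewrite Joff ?mulr0// => -[//].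
  by move=> E; move: T'T; rewrite E eqxx.
have sumT' : \sum_(p <- T') flux T' p * side_average T' p phi =
    flux T' z' * side_average T' z' phi.
  rewrite (big_fsetD1 z' zT') big_seq big1 => [|p]; first exact: addr0.
  rewrite in_fsetD1 => /andP[/eqP pz pT]; rewrite Joff ?mulr0// => -[//].
  by move=> E; move: T'T; rewrite E eqxx.
have sumTh : \sum_(T0 <- ((Th `\ T) `\ T')%fset)
    \sum_(p <- T0) flux T0 p * side_average T0 p phi = 0.
  rewrite big_seq big1// => T''; rewrite !in_fsetD1 => /and3P[T''T' T''T TT''].
  rewrite big_seq; apply: big1 => p pT''.
  rewrite (Joff _ _ TT'' pT'') ?mulr0 => [//|[/eqP]|[/eqP]].
    by rewrite (negPf T''T).
  by rewrite (negPf T''T').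
have T'D : T' \in (Th `\ T)%fset by rewrite in_fsetD1 T'T.
have -> : \sum_(T0 <- Th) \sum_(p <- T0) flux T0 p * side_average T0 p phi =
    flux T z * side_average T z phi + flux T' z' * side_average T' z' phi.
  rewrite (big_fsetD1 T TT); congr (_ + _); first exact: sumT.
  rewrite (big_fsetD1 T' T'D) -[RHS]addr0.
  by congr (_ + _); [exact: sumT'|exact: sumTh].
rewrite (side_average_neighbour TT zT nb tO) -mulrDl => /eqP.
rewrite mulf_eq0 => /orP[/eqP//|]; rewrite gt_eqF//.
apply: (side_average_gt0 nT' zT' tO).
  by move=> x; case/andP: (bump_bounds (xS - const_mx (r / 2)) (xS + const_mx (r / 2)) 1 x).
rewrite -SE; apply: ((bump_gt0 _ _ _ ltr01).2).
by apply: ((box_ball _ _ r2').2); rewrite subrr normr0.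
Qed.

End converse.
End pieces.
End weak_divergence.

(** * Affine functions on an element *)

Section affine_functions.
Variables (R : realType) (d : nat).
Local Notation mu := (lebesgue_measure_rV R d).
Implicit Types (x y z p g : 'rV[R]_d) (S T : {fset 'rV[R]_d}).

Definition affine c g x : R := c + dot g x.

Lemma affineB c g x y : affine c g x - affine c g y = dot g (x - y).
Proof. by rewrite /affine dotBr; ring. Qed.

Lemma polynomial_leD k (p q : 'rV[R]_d -> R) : polynomial_le k p -> polynomial_le k q ->
  polynomial_le k (fun x => p x + q x).
Proof.
move=> [c pE] [e qE]; exists (fun alpha => c alpha + e alpha) => x.
by rewrite pE qE -big_split; apply: eq_bigr => alpha _; rewrite mulrDl.
Qed.

Lemma polynomial_leZ k (s : R) (p : 'rV[R]_d -> R) : polynomial_le k p ->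
  polynomial_le k (fun x => s * p x).
Proof.
move=> [c pE]; exists (fun alpha => s * c alpha) => x.
by rewrite pE mulr_sumr; apply: eq_bigr => alpha _; rewrite mulrA.
Qed.

Lemma polynomial_le_cst k (s : R) : polynomial_le k (fun _ : 'rV[R]_d => s).
Proof.
exists (fun alpha => if alpha == [ffun=> ord0] then s else 0) => x.
rewrite (bigD1 [ffun=> ord0])/=; last first.
  by rewrite big1// => i _; rewrite ffunE.
rewrite eqxx !big1 ?mulr1 ?addr0//.
  by move=> alpha /andP[_ /negPf ->]; rewrite mul0r.
by move=> i _; rewrite ffunE.
Qed.

Lemma polynomial_le_coord (i : 'I_d) : polynomial_le 1 (fun x => x ord0 i).
Proof.
pose delta : {ffun 'I_d -> 'I_2} := [ffun j => inord (j == i)].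
have deltaE j : delta j = (j == i) :> nat by rewrite ffunE inordK//; case: (j == i).
exists (fun alpha => (alpha == delta)%:R) => x.
rewrite (bigD1 delta)/=; last first.
  by rewrite (bigD1 i)//= deltaE eqxx big1// => j /negPf ji; rewrite deltaE ji.
rewrite eqxx mul1r (bigD1 i)//= deltaE eqxx expr1.
rewrite !big1 ?mulr1 ?addr0//.
  by move=> alpha /andP[_ /negPf ->]; rewrite mul0r.
by move=> j /negPf ji; rewrite deltaE ji expr0.
Qed.

Lemma polynomial_le_affine c g : polynomial_le 1 (affine c g).
Proof.
rewrite /affine; apply: polynomial_leD; first exact: polynomial_le_cst.
rewrite /dot; elim: (index_enum _) => [|i s IH].
  by under eq_fun do rewrite big_nil; exact: polynomial_le_cst.
under eq_fun do rewrite big_cons; apply: polynomial_leD => //.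
exact/polynomial_leZ/polynomial_le_coord.
Qed.

(** Every monomial of degree at most 1 is affine. *)
Lemma affine_polynomial_le (p : 'rV[R]_d -> R) : polynomial_le 1 p ->
  exists c g, p = affine c g.
Proof.
move=> [C pE].
pose m (alpha : {ffun 'I_d -> 'I_2}) x := C alpha * \prod_i x ord0 i ^+ alpha i.
have mE (alpha : {ffun 'I_d -> 'I_2}) : (\sum_i alpha i <= 1)%N -> exists c g, m alpha = affine c g.
  move=> a1; have [/forallP a0|] := boolP [forall i, alpha i == ord0].
    exists (C alpha), 0; apply/funext => x; rewrite /affine dot0l addr0 /m.
    by rewrite big1 ?mulr1// => i _; rewrite (eqP (a0 i)) expr0.
  rewrite negb_forall => /existsP[i ai].
  have a_i : alpha i = 1%N :> nat.
    by case: (alpha i) ai => -[|[|//]] ? //=; rewrite -val_eqE.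
  move: a1; rewrite (bigD1 i)//= a_i -[leqRHS]addn0 leq_add2l leqn0.
  rewrite sum_nat_eq0 => /forallP aj.
  exists 0, (C alpha *: delta_mx ord0 i); apply/funext => x.
  rewrite /affine dotZl dotC dot_delta add0r /m (bigD1 i)//= a_i expr1 big1 ?mulr1//.
  by move=> j ji; have := aj j; rewrite ji => /eqP ->; rewrite expr0.
have -> : p = fun x => \sum_(alpha : {ffun 'I_d -> 'I_2} | (\sum_i alpha i <= 1)%N) m alpha x.
  by apply/funext => x; rewrite pE.
elim: (index_enum _) => [|alpha s [c [g IH]]].
  by exists 0, 0; apply/funext => x; rewrite big_nil /affine dot0l addr0.
have [a1|a1] := boolP (\sum_i alpha i <= 1)%N; last first.
  exists c, g; rewrite -IH; apply/funext => x.
  by rewrite big_cons (negPf a1).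
have [e [h mh]] := mE _ a1; exists (e + c), (h + g); apply/funext => x.
rewrite big_cons a1 mh (congr1 (@^~ x) IH) /affine dotDl; ring.
Qed.

Lemma cst_polynomial_le (p : 'rV[R]_d -> R) : polynomial_le 0 p -> exists c, p = cst c.
Proof.
move=> [C pE]; exists (\sum_(alpha : {ffun 'I_d -> 'I_1} | (\sum_i alpha i <= 0)%N) C alpha).
apply/funext => x; rewrite pE; apply: eq_bigr => alpha _.
by rewrite big1 ?mulr1// => i _; rewrite (ord1 (alpha i)).
Qed.

Lemma grad_affine c g x : grad (affine c g) x = g.
Proof.
apply/rowP => i; rewrite mxE /derive.
apply: cvg_lim => //; apply: cvg_near_cst.
have : \forall h \near (0 : R)^', h != 0 by exact: nbhs_dnbhs_neq.
apply: filterS => h h0.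
rewrite -[LHS]/(h^-1 * (affine c g (h *: delta_mx ord0 i + x) - affine c g x)).
by rewrite affineB addrK dotZr dot_delta mulKf.
Qed.

(** A property true almost everywhere on an element holds at points arbitrarily
    close to any interior point, since balls have positive measure. *)
Lemma ae_hull_near T x r (P : set 'rV[R]_d) : nondegenerate T ->
  (\forall x \ae mu, hull T x -> P x) -> open_simplex T x -> 0 < r ->
  exists y, [/\ open_simplex T y, `|x - y| < r & P y].
Proof.
move=> nT hP Tx r0; apply: contrapT => no.
have [e e0 he] := open_rVP (open_open_simplex nT) Tx.
pose s := Num.min r e; have s0 : 0 < s by rewrite lt_min r0.
have mB : measurable (box (x - const_mx s) (x + const_mx s)) by exact: measurable_box.
have := @measure_ball_gt0 _ _ x s _ s0 mB (fun y => (box_ball x y s0).2).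
case: hP => N [mN N0 sN]; rewrite -N0 => /lt_geF/negP; apply.
apply: le_measure; rewrite ?inE// => y /(box_ball _ _ s0).1; rewrite lt_min => /andP[yr ye].
apply: sN => hPy; apply: no; exists y; split=> //; first exact: he.
by apply: hPy; apply: open_simplex_hull (he _ ye).
Qed.

Lemma open_simplex_barycenter T : nondegenerate T -> open_simplex T (barycenter T).
Proof. by move=> nT p pT; rewrite (bary_barycenter nT pT) invr_gt0. Qed.

Lemma ae_hull_ex T (P : set 'rV[R]_d) : nondegenerate T ->
  (\forall x \ae mu, hull T x -> P x) -> exists2 y, open_simplex T y & P y.
Proof.
move=> nT hP.
by have [y [? _ ?]] := ae_hull_near nT hP (open_simplex_barycenter nT) ltr01; exists y.
Qed.

(** By density and continuity the function vanishes in the interior, where its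
    increment in the direction g is a multiple of dot g g. *)
Lemma affine_ae_eq0 T c g : nondegenerate T ->
  affine c g = cst 0 %[ae mu in hull T] -> c = 0 /\ g = 0.
Proof.
move=> nT q0.
have q0E x : open_simplex T x -> affine c g x = 0.
  move=> Tx; apply: contrapT => /eqP qx.
  pose r := `|affine c g x| / (1 + d%:R * `|g|).
  have D0 : 0 < 1 + d%:R * `|g| by rewrite ltr_pwDl// mulr_ge0.
  have r0 : 0 < r by rewrite divr_gt0// normr_gt0.
  have [y [_ xy qy]] := ae_hull_near nT q0 Tx r0.
  have : `|affine c g x| < `|affine c g x|; last by rewrite ltxx.
  rewrite -[X in `|X| < _]subr0 -[X in `|_ - X| < _]qy affineB.
  apply: (le_lt_trans (norm_dot_le _ _)).
  move: xy; rewrite /r ltr_pdivlMr// => /(le_lt_trans _); apply.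
  have := normr_ge0 (x - y); have := normr_ge0 g; nra.
pose b := barycenter T; have Tb := open_simplex_barycenter nT.
have [r r0 hr] := open_rVP (open_open_simplex nT) Tb.
have g0 : g = 0.
  pose s := r / (1 + `|g|).
  have D0 : 0 < 1 + `|g| by rewrite ltr_pwDl.
  have s0 : 0 < s by rewrite divr_gt0.
  have : open_simplex T (b + s *: g).
    apply: hr; rewrite opprD addNKr normrN normrZ gtr0_norm// /s mulrAC.
    by rewrite ltr_pdivrMr// ltr_pM2l// ltrDr.
  move=> /q0E qs; have : affine c g (b + s *: g) - affine c g b = 0.
    by rewrite qs q0E// subrr.
  move=> /eqP; rewrite affineB addrC addKr dotZr mulf_eq0 gt_eqF//=.
  by move=> /eqP; exact: dot_eq0.
by split=> //; have := q0E _ Tb; rewrite g0 /affine dot0l addr0.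
Qed.

Lemma affine_ae_inj T c g c' g' : nondegenerate T ->
  affine c g = affine c' g' %[ae mu in hull T] -> c = c' /\ g = g'.
Proof.
move=> nT h; have [] := @affine_ae_eq0 T (c - c') (g - g') nT.
  apply: filterS h => x h /h E; rewrite /affine dotBl addrACA -opprD.
  by apply/eqP; rewrite subr_eq0; apply/eqP.
by move=> /eqP; rewrite subr_eq0 => /eqP -> /eqP; rewrite subr_eq0 => /eqP ->.
Qed.

Lemma RT_shape_affine T (a : 'rV[R]_d) (b : R) x j :
  RT_shape T a b x ord0 j =
  affine (a ord0 j - b * barycenter T ord0 j) (b *: delta_mx ord0 j) x.
Proof.
by rewrite /affine dotZl dotC dot_delta /RT_shape; move: (barycenter T) => m; rewrite !mxE; ring.
Qed.

(** The components are affine. *)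
Lemma RT_shape_ae_inj T a b a' b' : (0 < d)%N -> nondegenerate T ->
  RT_shape T a b = RT_shape T a' b' %[ae mu in hull T] -> a = a' /\ b = b'.
Proof.
move=> d0 nT h.
have E j : a ord0 j - b * barycenter T ord0 j = a' ord0 j - b' * barycenter T ord0 j /\
    b *: delta_mx ord0 j = b' *: delta_mx ord0 j :> 'rV[R]_d.
  apply: (affine_ae_inj nT); apply: filterS h => x h /h E.
  by rewrite -!RT_shape_affine E.
have bb : b = b'.
  have [_ /(congr1 (fun u : 'rV_d => u ord0 (Ordinal d0)))] := E (Ordinal d0).
  by rewrite !mxE !eqxx !mulr1.
split=> //; apply/rowP => j; have [+ _] := E j.
by rewrite bb => /addIr.
Qed.

End affine_functions.

(** * Elementwise averages and representatives *)

Section finite_element_fields.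
Variables (R : realType) (d : nat).
Variables (Omega : set 'rV[R]_d) (Th : {fset {fset 'rV[R]_d}}).
Hypothesis d0 : (0 < d)%N.
Hypothesis hOmega : bounded_lipschitz_domain Omega.
Hypothesis hTh : regular_triangulation Omega Th.
Local Notation mu := (lebesgue_measure_rV R d).
Local Notation simplex := {fset 'rV[R]_d}.
Implicit Types (x y z p : 'rV[R]_d) (S T : simplex).

Let nondeg T : T \in Th -> nondegenerate T.
Proof. by move=> TT; exact: (nondegenerate_element hTh TT). Qed.

Lemma ae_Omega_of_elements (P : set 'rV[R]_d) :
  (forall T, T \in Th -> \forall x \ae mu, hull T x -> P x) ->
  \forall x \ae mu, Omega x -> P x.
Proof.
move=> h; have := @ae_forall_seq R d _ (enum_fset Th) (fun T x => hull T x -> P x) h.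
by apply: filterS => x hx /subset_closure /(closure_hull hTh)[T TT Tx]; exact: (hx T).
Qed.

Lemma ae_element_of_Omega (P : set 'rV[R]_d) T : T \in Th ->
  (\forall x \ae mu, Omega x -> P x) -> \forall x \ae mu, hull T x -> P x.
Proof.
move=> TT h; apply: filterS2 h (ae_hull_open_simplex (nondeg TT)) => x h1 h2 /h2.
by move=> /(open_simplex_sub hOmega hTh TT).
Qed.

Lemma ae_eq_average T (f g : 'rV[R]_d -> R) : T \in Th ->
  measurable_fun setT f -> measurable_fun setT g -> f = g %[ae mu in hull T] ->
  average T f = average T g.
Proof.
move=> TT mf mg fg; congr (_ * _); apply: ae_eq_Int => //.
- exact: measurable_hull (nondeg TT).
- exact: measurable_funTS.
- exact: measurable_funTS.
Qed.

Lemma average_of_affine T c g f : T \in Th -> measurable_fun setT f ->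
  f = affine c g %[ae mu in hull T] -> average T f = affine c g (barycenter T).
Proof.
move=> TT mf fE; rewrite (ae_eq_average TT mf (tame_affine c g).1 fE).
exact: (@average_affine _ _ _ _ c g (nondeg TT)).
Qed.

Lemma Pi_h_open_simplex T f x : T \in Th -> open_simplex T x -> Pi_h Th f x = average T f.
Proof.
move=> TT Tx; rewrite /Pi_h (big_fsetD1 T)//= indicE mem_set ?mul1r; last first.
  exact: open_simplex_hull (nondeg TT) _ Tx.
rewrite big_seq big1 ?addr0// => T'; rewrite in_fsetD1 => /andP[T'T TT'].
rewrite indicE memNset ?mul0r// => hx.
by rewrite (open_simplex_meet hTh TT TT' Tx hx) eqxx in T'T.
Qed.

Lemma Pi_h_ae T f : T \in Th -> Pi_h Th f = cst (average T f) %[ae mu in hull T].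
Proof.
move=> TT; apply: filterS (ae_hull_open_simplex (nondeg TT)) => x h /h.
exact: Pi_h_open_simplex.
Qed.

Lemma measurable_Pi_h f : measurable_fun setT (Pi_h Th f).
Proof.
suff [] : tame (Pi_h Th f) by [].
apply: tame_sum_seq => T TT; apply: tameM; last exact: tame_cst.
by apply: tame_indic; exact: measurable_hull (nondeg TT).
Qed.

(** The projection is elementwise constant with the averages as values. *)
Lemma Pi_h_eq0 f : Pi_h Th f = cst 0 %[ae mu in Omega] <->
  forall T, T \in Th -> average T f = 0.
Proof.
split=> [h T TT|h].
  have [y Ty Py] := ae_hull_ex (nondeg TT) (ae_element_of_Omega TT h).
  by rewrite -(Pi_h_open_simplex f TT Ty).
apply: ae_Omega_of_elements => T TT; apply: filterS (Pi_h_ae f TT) => x hx /hx ->.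
by rewrite /cst h.
Qed.

Lemma Pi_hv_eq0 l (y : 'rV[R]_d -> 'rV[R]_l) : Pi_hv Th y = cst 0 %[ae mu in Omega] <->
  forall T j, T \in Th -> average T (component y j) = 0.
Proof.
split=> [h T j TT|h].
  move: T TT; apply/Pi_h_eq0; apply: filterS h => x h /h /rowP/(_ j).
  by rewrite !mxE.
have hj j : Pi_h Th (component y j) = cst 0 %[ae mu in Omega].
  by apply/Pi_h_eq0 => T TT; exact: h.
have := @ae_forall_seq R d _ (enum 'I_l)
  (fun j x => Omega x -> Pi_h Th (component y j) x = 0) (fun j _ => hj j).
apply: filterS => x hx Ox; apply/rowP => j; rewrite !mxE.
by apply: hx => //; rewrite mem_enum.
Qed.

Lemma ae_rowP l (y y' : 'rV[R]_d -> 'rV[R]_l) (D : set 'rV[R]_d) :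
  (forall j, component y j = component y' j %[ae mu in D]) ->
  y = y' %[ae mu in D].
Proof.
move=> h; have := @ae_forall_seq R d _ (enum 'I_l)
  (fun j x => D x -> component y j x = component y' j x) (fun j _ => h j).
apply: filterS => x hx Dx; apply/rowP => j.
by apply: hx => //; rewrite mem_enum.
Qed.

Lemma Int_piecewise_cst (s : simplex -> R) (f : 'rV[R]_d -> R) :
  measurable_fun setT f ->
  (forall T, T \in Th -> f = cst (s T) %[ae mu in hull T]) ->
  \int[mu]_(x in Omega) f x = \sum_(T <- Th) volume T * s T.
Proof.
move=> mf fs; rewrite (Int_Omega hOmega hTh (F := fun T _ => s T))//; last first.
  by move=> T; exact: tame_cst.
rewrite big_seq [RHS]big_seq; apply: eq_bigr => T TT; rewrite Int_cst.
  by rewrite (volumeE (nondeg TT)) mulrC.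
exact: bounded_measurable_hull (nondeg TT).
Qed.

Lemma Linfty_tame_ae f h : measurable_fun setT f -> tame h ->
  f = h %[ae mu in Omega] -> Linfty Omega f.
Proof.
move=> mf [_ bh] fh; split=> //.
have [_ [r hr]] := bounded_measurable_Omega hOmega.
have [M hM] := bh r; exists M; apply: filterS fh => x h1 Ox.
by rewrite (h1 Ox); apply: hM; exact: hr.
Qed.

Lemma L2_tame_ae f h : measurable_fun setT f -> tame h ->
  f = h %[ae mu in Omega] -> L2 Omega f.
Proof.
move=> mf th fh; split=> //.
have [mO _] := bounded_measurable_Omega hOmega.
have [mh /integrableP[mh2 hoo]] := L2_tame hOmega th.
apply/integrableP; split.
  by apply/measurable_EFinP; apply: measurable_funTS; exact: measurable_funX.
rewrite (ae_eq_integral (fun x => `|(h x ^+ 2)%:E|)%E)//.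
- apply: measurableT_comp => //; apply/measurable_EFinP.
  by apply: measurable_funTS; exact: measurable_funX.
- exact: measurableT_comp.
- by apply: filterS fh => x h1 Ox; rewrite (h1 Ox).
Qed.

Lemma Lk1_data v : Lk Omega Th 1 v -> exists c (g : simplex -> 'rV[R]_d),
  forall T, T \in Th -> v = affine (c T) (g T) %[ae mu in hull T].
Proof.
move=> [_ h].
have /choice[F hF] : forall T, exists cg : R * 'rV[R]_d,
    T \in Th -> v = affine cg.1 cg.2 %[ae mu in hull T].
  move=> T; have [TT|nTT] := boolP (T \in Th); last by exists (0, 0).
  by have [p [/affine_polynomial_le[c [g ->]] vE]] := h T TT; exists (c, g).
by exists (fun T => (F T).1), (fun T => (F T).2).
Qed.

Lemma Lk0_data v : Lk Omega Th 0 v -> exists c : simplex -> R,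
  forall T, T \in Th -> v = cst (c T) %[ae mu in hull T].
Proof.
move=> [_ h].
have /choice[F hF] : forall T, exists c : R,
    T \in Th -> v = cst c %[ae mu in hull T].
  move=> T; have [TT|nTT] := boolP (T \in Th); last by exists 0.
  by have [p [/cst_polynomial_le[c ->] vE]] := h T TT; exists c.
by exists F.
Qed.

Lemma Lkv0_data (z : 'rV[R]_d -> 'rV[R]_d) : Lkv Omega Th 0 d z -> exists g : simplex -> 'rV[R]_d,
  forall T, T \in Th -> z = cst (g T) %[ae mu in hull T].
Proof.
move=> hz; have /choice[F hF] : forall j, exists c : simplex -> R,
    forall T, T \in Th -> component z j = cst (c T) %[ae mu in hull T].
  by move=> j; exact: Lk0_data (hz j).
exists (fun T => \row_j F j T) => T TT; apply: ae_rowP => j.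
by apply: filterS (hF j T TT) => x h /h ->; rewrite /component /cst mxE.
Qed.

Lemma RT_data (y : 'rV[R]_d -> 'rV[R]_d) : RT Omega Th y -> exists a b,
  forall T, T \in Th -> y = RT_shape T (a T) (b T) %[ae mu in hull T].
Proof.
move=> [_ h].
have /choice[F hF] : forall T, exists ab : 'rV[R]_d * R,
    T \in Th -> y = RT_shape T ab.1 ab.2 %[ae mu in hull T].
  move=> T; have [TT|nTT] := boolP (T \in Th); last by exists (0, 0).
  by have [a [b yE]] := h T TT; exists (a, b).
by exists (fun T => (F T).1), (fun T => (F T).2).
Qed.

Lemma RT_measurable (y : 'rV[R]_d -> 'rV[R]_d) j : RT Omega Th y -> measurable_fun setT (component y j).
Proof. by move=> [[h _] _]; case: (h j). Qed.

Lemma average_RT (y : 'rV[R]_d -> 'rV[R]_d) T a b j : T \in Th -> measurable_fun setT (component y j) ->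
  y = RT_shape T a b %[ae mu in hull T] -> average T (component y j) = a ord0 j.
Proof.
move=> TT my yE.
rewrite (@average_of_affine T (a ord0 j - b * barycenter T ord0 j) (b *: delta_mx ord0 j))//.
  by rewrite -RT_shape_affine RT_shape_barycenter.
by apply: filterS yE => x h /h yx; rewrite /component yx RT_shape_affine.
Qed.

(** The representative of v on T is unique, so conditions on all representatives
    are conditions on the given one. *)
Lemma restricts_affineP v T c g (p : 'rV[R]_d -> R) : T \in Th ->
  v = affine c g %[ae mu in hull T] -> restricts 1 v T p <-> p = affine c g.
Proof.
move=> TT vE; split=> [[/affine_polynomial_le[c' [g' ->]] vE']|->].
  have [-> ->]// : c' = c /\ g' = g.
  apply: (affine_ae_inj (nondeg TT)).
  by apply: filterS2 vE vE' => x h1 h2 hx; rewrite -h1// h2.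
by split=> //; exact: polynomial_le_affine.
Qed.

End finite_element_fields.

(** * The pairing of the two finite element spaces *)

Section mixed_pairing.
Variables (R : realType) (d : nat).
Variables (Omega : set 'rV[R]_d) (Th : {fset {fset 'rV[R]_d}}).
Variables (GammaD GammaN : set 'rV[R]_d) (D : {fset {fset 'rV[R]_d}}).
Hypothesis d0 : (0 < d)%N.
Hypothesis hOmega : bounded_lipschitz_domain Omega.
Hypothesis hTh : regular_triangulation Omega Th.
Hypothesis hD : forall S, S \in D -> is_boundary_side Omega Th S.
Hypothesis hGammaD : GammaD = \bigcup_(S in [set` D]) hull S.
Hypothesis hGammaN : GammaN =
  \bigcup_(S in [set S | is_boundary_side Omega Th S /\ S \notin D]) hull S.
Local Notation mu := (lebesgue_measure_rV R d).
Local Notation simplex := {fset 'rV[R]_d}.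
Local Notation midpoint T z := (barycenter (T `\ z)%fset).
Implicit Types (x z p : 'rV[R]_d) (S T : simplex).
Implicit Types (a g : simplex -> 'rV[R]_d) (b c : simplex -> R).

Let nondeg T : T \in Th -> nondegenerate T.
Proof. by move=> TT; exact: (nondegenerate_element hTh TT). Qed.

Lemma neighbour_sym T z T' z' : T \in Th -> z \in T ->
  neighbour Th T z T' z' -> neighbour Th T' z' T z.
Proof. by move=> TT zT [? ? T'T SE]; split; rewrite ?SE// eq_sym. Qed.

Lemma boundary_no_neighbour T z T' z' : T \in Th -> z \in T ->
  is_boundary_side Omega Th (T `\ z)%fset -> ~ neighbour Th T z T' z'.
Proof.
move=> TT zT [_ bS] nb.
by have [[_ /(_ _ _ nb)//]|[/(_ bS)]] := flag_dichotomy d0 hOmega hTh TT zT.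
Qed.

(** Every point of a side has to be covered; looking at its midpoint is enough,
    as this lies in no other side. *)
Lemma side_in_GammaD T z : T \in Th -> z \in T ->
  hull (T `\ z)%fset `<=` GammaD <-> (T `\ z)%fset \in D.
Proof.
move=> TT zT; split=> [h|SD]; last by rewrite hGammaD => x hx; exists (T `\ z)%fset.
have := h _ (hull_barycenter_side (nondeg TT) zT d0).
rewrite hGammaD => -[S /= SD hS]; have [[T' TT' ST'] _] := hD SD.
by rewrite -(side_of_barycenter d0 hTh TT zT TT' ST' hS).
Qed.

Lemma side_in_GammaN T z : T \in Th -> z \in T ->
  hull (T `\ z)%fset `<=` GammaN <->
  is_boundary_side Omega Th (T `\ z)%fset /\ (T `\ z)%fset \notin D.
Proof.
move=> TT zT; split=> [h|SD]; last by rewrite hGammaN => x hx; exists (T `\ z)%fset.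
have := h _ (hull_barycenter_side (nondeg TT) zT d0).
rewrite hGammaN => -[S /= [bS SD] hS]; have [[T' TT' ST'] _] := bS.
by rewrite -(side_of_barycenter d0 hTh TT zT TT' ST' hS).
Qed.

(** The Crouzeix--Raviart conditions on the elementwise affine functions with
    coefficients c and g. *)
Definition CR_compatible c g :=
  (forall T z T' z', T \in Th -> z \in T -> neighbour Th T z T' z' ->
     affine (c T) (g T) (midpoint T z) = affine (c T') (g T') (midpoint T z)) /\
  (forall T z, T \in Th -> z \in T -> (T `\ z)%fset \in D ->
     affine (c T) (g T) (midpoint T z) = 0).

(** The Raviart--Thomas conditions on the elementwise shapes with coefficients a
    and b, in terms of fluxes. *)
Definition RT_compatible a b :=
  compatible_fluxes Th a b /\
  (forall T z, T \in Th -> z \in T -> is_boundary_side Omega Th (T `\ z)%fset ->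
     (T `\ z)%fset \notin D -> RT_flux T (a T) (b T) z = 0).

Lemma CR_DP v c g : Lk Omega Th 1 v ->
  (forall T, T \in Th -> v = affine (c T) (g T) %[ae mu in hull T]) ->
  CR_D Omega Th GammaD v <-> CR_compatible c g.
Proof.
move=> Lv vE.
have vP T (p : 'rV[R]_d -> R) : T \in Th -> restricts 1 v T p <-> p = affine (c T) (g T).
  by move=> TT; exact: (restricts_affineP hTh _ TT (vE T TT)).
split=> [[[_ h1] h2]|[h1 h2]]; split.
- move=> T z T' z' TT zT [TT' zT' T'T SE].
  apply: (h1 (T `\ z)%fset T T') => //; try exact/vP.
    by apply/(is_side_ofP _ (nondeg TT)); exists z.
  by apply/(is_side_ofP _ (nondeg TT')); exists z'.
- move=> T z TT zT SD; apply: (h2 (T `\ z)%fset T) => //; last exact/vP.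
    by apply/(is_side_ofP _ (nondeg TT)); exists z.
  exact/(side_in_GammaD TT zT).
- split=> // S T T' p p' TT TT' + + /(vP _ _ TT) -> /(vP _ _ TT') ->.
  move=> /(is_side_ofP _ (nondeg TT))[z zT SE] /(is_side_ofP _ (nondeg TT'))[z' zT' SE'].
  have [-> //|T'T] := eqVneq T' T.
  by rewrite SE; apply: (h1 _ _ _ z') => //; split=> //; rewrite -SE.
- move=> S T p TT /(is_side_ofP _ (nondeg TT))[z zT ->] SG /(vP _ _ TT) ->.
  by apply: h2 => //; exact/(side_in_GammaD TT zT).
Qed.

(** The weak divergence forces compatible fluxes; on a side the normal
    component is constant and proportional to the flux. *)
Lemma RT_NP (y : 'rV[R]_d -> 'rV[R]_d) a b : RT Omega Th y ->
  (forall T, T \in Th -> y = RT_shape T (a T) (b T) %[ae mu in hull T]) ->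
  RT_N Omega Th GammaN y <-> RT_compatible a b.
Proof.
move=> RTy yE; have my j := RT_measurable j RTy.
split=> [[_ hN]|[hc hN]]; split=> //.
- have [[_ [f yf]] _] := RTy.
  exact: (compatible_fluxes_of_div d0 hOmega hTh my yE yf).
- move=> T z TT zT bS SD; have nT := nondeg TT.
  have [n on] := outer_normal_ex nT zT d0.
  have hS := hull_barycenter_side nT zT d0.
  have sS : is_side_of (T `\ z)%fset T by apply/(is_side_ofP _ nT); exists z.
  have SG : hull (T `\ z)%fset `<=` GammaN by apply/(side_in_GammaN TT zT).
  have /eqP := hN _ _ _ _ _ TT sS bS SG (yE T TT) on _ hS.
  rewrite (dot_RT_shape_normal nT _ _ zT d0 on hS) mulf_eq0 => /orP[/eqP//|].
  by rewrite (negPf (dot_outer_normal_neq0 nT on hS)).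
- move=> S T a' b' n TT sS bS SG yE' on x hx; have nT := nondeg TT.
  have [Ea Eb] : a' = a T /\ b' = b T.
    apply: (RT_shape_ae_inj d0 nT).
    by apply: filterS2 (yE T TT) yE' => u h1 h2 hu; rewrite -h1// h2.
  have [z zT SE] := (is_side_ofP _ nT).1 sS; move: bS SG on hx; rewrite SE => bS SG on hx.
  rewrite (dot_RT_shape_normal nT _ _ zT d0 on hx) Ea Eb hN ?mul0r//.
  by case: ((side_in_GammaN TT zT).1 SG).
Qed.

(** The global integration by parts: the sum over the elements of the local
    identity is a sum over the sides of flux times midpoint value. On interior
    sides the fluxes are opposite and the values agree, on the boundary one of
    the two factors vanishes. *)
Lemma pairing_eq0 a b c g : RT_compatible a b -> CR_compatible c g ->
  \sum_(T <- Th) volume T * (dot (g T) (a T) +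
     d%:R * b T * affine (c T) (g T) (barycenter T)) = 0.
Proof.
move=> [ab abN] [cg cgD].
transitivity (d%:R * \sum_(T <- Th) \sum_(z <- T)
    volume T * RT_flux T (a T) (b T) z * affine (c T) (g T) (midpoint T z)).
  rewrite mulr_sumr big_seq [RHS]big_seq; apply: eq_bigr => T TT.
  rewrite (@local_integration_by_parts _ _ _ (nondeg TT) _ (c T) (g T))//.
  rewrite mulrCA; congr (_ * _); rewrite mulr_sumr.
  by apply: eq_bigr => z _; rewrite mulrA.
rewrite (flag_sum_eq0 d0 hTh) ?mulr0// => T z.
  move=> TT zT nn.
  have [[bS _]|[_ [T' [z' /nn//]]]] := flag_dichotomy d0 hOmega hTh TT zT.
  have [SD|SD] := boolP ((T `\ z)%fset \in D); first by rewrite cgD ?mulr0.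
  by rewrite abN// mulr0 mul0r.
move=> T' z' TT zT nb; have [TT' zT' _ SE] := nb.
by rewrite (cg _ _ _ _ TT zT nb) -SE -mulrDl ab// mul0r.
Qed.

Definition CR_field c g := pieces Th (fun T => affine (c T) (g T)).

Definition RT_field a b : 'rV[R]_d -> 'rV[R]_d :=
  fun x => \row_j pieces Th (fun T x => RT_shape T (a T) (b T) x ord0 j) x.

Lemma CR_field_ae c g T : T \in Th ->
  CR_field c g = affine (c T) (g T) %[ae mu in hull T].
Proof. exact: (pieces_ae hTh (fun T => affine (c T) (g T))). Qed.

Lemma RT_field_ae a b T : T \in Th ->
  RT_field a b = RT_shape T (a T) (b T) %[ae mu in hull T].
Proof.
move=> TT; apply: filterS (ae_hull_open_simplex (nondeg TT)) => x h /h Tx.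
by apply/rowP => j; rewrite mxE (pieces_in hTh _ TT Tx).
Qed.

Lemma tame_CR_field c g : tame (CR_field c g).
Proof. by apply: (tame_pieces hTh) => T; exact: tame_affine. Qed.

Lemma tame_RT_field a b j : tame (component (RT_field a b) j).
Proof.
rewrite /component /RT_field; under eq_fun do rewrite mxE.
by apply: (tame_pieces hTh) => T; exact: tame_RT_shape.
Qed.

Lemma CR_field_in c g : CR_compatible c g -> CR_D Omega Th GammaD (CR_field c g).
Proof.
move=> cg; have vE := CR_field_ae c g; have tv := tame_CR_field c g.
apply/(CR_DP (c := c) (g := g)) => //; split.
  by apply: (Linfty_tame_ae hOmega tv.1 tv); exact: aeW.
move=> T TT; exists (affine (c T) (g T)).
exact/(restricts_affineP hTh _ TT (vE T TT)).
Qed.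

Lemma RT_field_in a b : RT_compatible a b -> RT_N Omega Th GammaN (RT_field a b).
Proof.
move=> ab; have yE := RT_field_ae a b; have ty := tame_RT_field a b.
apply/(RT_NP (a := a) (b := b)) => //; split; last by move=> T TT; exists (a T), (b T); exact: yE.
split=> [j|]; first exact: (L2_tame hOmega (ty j)).
exists (pieces Th (fun T _ => d%:R * b T)).
by apply: (is_div_of_compatible_fluxes d0 hOmega hTh _ yE ab.1) => j; case: (ty j).
Qed.

(** The data of a basis function: unit weight on one flag. *)
Definition flag_delta T0 z0 T z : R := ((T == T0) && (z == z0))%:R.

Lemma sum_flag_delta (G : simplex -> 'rV[R]_d -> R) T0 z0 : T0 \in Th -> z0 \in T0 ->
  \sum_(T <- Th) \sum_(z <- T) flag_delta T0 z0 T z * G T z = G T0 z0.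
Proof.
move=> TT0 zT0; rewrite (big_fsetD1 T0 TT0) -[RHS]addr0; congr (_ + _).
  rewrite (big_fsetD1 z0 zT0) -[RHS]addr0; congr (_ + _).
    by rewrite /flag_delta !eqxx mul1r.
  rewrite big_seq; apply: big1 => z; rewrite in_fsetD1 => /andP[/negPf z0z _].
  by rewrite /flag_delta z0z andbF mul0r.
rewrite big_seq; apply: big1 => T; rewrite in_fsetD1 => /andP[/negPf T0T _].
by apply: big1 => z _; rewrite /flag_delta T0T mul0r.
Qed.

(** Passing to the neighbour is an involution on flags of interior sides. *)
Lemma flag_delta_neighbour T z T' z' T1 z1 T2 z2 :
  T \in Th -> z \in T -> T1 \in Th -> z1 \in T1 ->
  neighbour Th T z T' z' -> neighbour Th T1 z1 T2 z2 ->
  flag_delta T z T1 z1 = flag_delta T' z' T2 z2.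
Proof.
move=> TT zT TT1 zT1 nb nb1; congr (nat_of_bool _)%:R.
apply/andP/andP => -[/eqP E1 /eqP E2].
  move: nb1; rewrite E1 E2 => nb1.
  by have [-> ->] := neighbour_unique d0 hTh TT zT nb1 nb.
have [TT' zT' _ _] := nb.
move: (neighbour_sym TT1 zT1 nb1); rewrite E1 E2 => nb2.
by have [-> ->] := neighbour_unique d0 hTh TT' zT' nb2 (neighbour_sym TT zT nb).
Qed.

Lemma flag_delta_boundary T z T1 z1 T2 z2 : T \in Th -> z \in T ->
  is_boundary_side Omega Th (T `\ z)%fset -> neighbour Th T1 z1 T2 z2 ->
  flag_delta T z T1 z1 = 0.
Proof.
move=> TT zT bS nb; rewrite /flag_delta; case: eqP => //= E1; case: eqP => //= E2.
by have := @boundary_no_neighbour T z T2 z2 TT zT bS; rewrite -E1 -E2.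
Qed.

Lemma flag_delta_interior T z T1 z1 T1' z1' : T \in Th -> z \in T ->
  is_boundary_side Omega Th (T `\ z)%fset -> neighbour Th T1 z1 T1' z1' ->
  flag_delta T1 z1 T z = 0.
Proof.
by move=> TT zT bS nb; rewrite -(flag_delta_boundary TT zT bS nb) /flag_delta
  (eq_sym T) (eq_sym z).
Qed.

Section prescribed_fluxes.
Variable w : simplex -> 'rV[R]_d -> R.

(** The shape sum_p (w T p / |T|) (x - p): dividing by |T| makes w T p, up to
    the factor d, the total flux through the side opposite to p. *)
Definition RT_of_fluxes_b T := \sum_(p <- T) w T p / volume T.
Definition RT_of_fluxes_a T :=
  \sum_(p <- T) (w T p / volume T) *: (barycenter T - p).

Lemma RT_flux_of_fluxes T z : T \in Th -> z \in T ->
  volume T * RT_flux T (RT_of_fluxes_a T) (RT_of_fluxes_b T) z = w T z.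
Proof.
move=> TT zT; have nT := nondeg TT.
have -> : RT_flux T (RT_of_fluxes_a T) (RT_of_fluxes_b T) z = w T z / volume T.
  rewrite /RT_flux /RT_of_fluxes_a /RT_of_fluxes_b dot_sumr mulr_suml -sumrB.
  rewrite (big_fsetD1 z zT) big_seq big1 => [|p].
    rewrite dotZr -(bary_sub nT) (bary_barycenter nT zT) (bary_vertex nT _ zT) eqxx.
    rewrite [LHS]addr0 mulr1n mulrBr mulr1 opprB.
    by rewrite addrC subrK.
  rewrite in_fsetD1 => /andP[/negPf pz pT].
  rewrite dotZr -(bary_sub nT) (bary_barycenter nT zT) (bary_vertex nT _ pT) pz.
  by rewrite subr0 subrr.
by rewrite mulrC divfK// gt_eqF// volume_gt0.
Qed.

Lemma RT_of_fluxes_compatible :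
  (forall T z T' z', T \in Th -> z \in T -> neighbour Th T z T' z' ->
     w T z + w T' z' = 0) ->
  (forall T z, T \in Th -> z \in T -> is_boundary_side Omega Th (T `\ z)%fset ->
     (T `\ z)%fset \notin D -> w T z = 0) ->
  RT_compatible RT_of_fluxes_a RT_of_fluxes_b.
Proof.
move=> wn wN; split=> [T z T' z' TT zT nb|T z TT zT bS SD].
  by have [TT' zT' _ _] := nb; rewrite !RT_flux_of_fluxes//; exact: wn.
have := RT_flux_of_fluxes TT zT; rewrite wN// => /eqP; rewrite mulf_eq0.
by rewrite gt_eqF ?(volume_gt0 (nondeg TT))// => /eqP.
Qed.

Lemma dot_RT_of_fluxes (e : 'rV[R]_d) T : T \in Th ->
  volume T * dot e (RT_of_fluxes_a T) = \sum_(p <- T) w T p * dot e (barycenter T - p).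
Proof.
move=> TT; rewrite /RT_of_fluxes_a dot_sumr mulr_sumr; apply: eq_bigr => p _.
have v0 : volume T != 0 by rewrite gt_eqF// (volume_gt0 (nondeg TT)).
by rewrite dotZr; field.
Qed.

End prescribed_fluxes.

Section prescribed_midpoint_values.
Variable w : simplex -> 'rV[R]_d -> R.

(** The affine function on T with value w T p at the midpoint of the side
    opposite to p: the nodal basis functions are 1 - d lambda_p. *)
Definition CR_of_values_c T := \sum_(p <- T) w T p * (1 - d%:R * bary T 0 p).
Definition CR_of_values_g T := \sum_(p <- T) (- (w T p * d%:R)) *: bary_grad T p.

Lemma CR_of_valuesE T x : T \in Th ->
  affine (CR_of_values_c T) (CR_of_values_g T) x =
  \sum_(p <- T) w T p * (1 - d%:R * bary T x p).
Proof.
move=> TT; rewrite /affine /CR_of_values_c /CR_of_values_g dot_suml -big_split.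
apply: eq_bigr => p _ /=; rewrite dotZl (bary_affine (nondeg TT) x); ring.
Qed.

Lemma CR_of_values_midpoint T z : T \in Th -> z \in T ->
  affine (CR_of_values_c T) (CR_of_values_g T) (midpoint T z) = w T z.
Proof.
move=> TT zT; have nT := nondeg TT; rewrite CR_of_valuesE//.
have dn0 : d%:R != 0 :> R by rewrite pnatr_eq0 -lt0n.
rewrite (big_fsetD1 z zT) big_seq big1 => [|p].
  by rewrite [LHS]addr0 (bary_barycenter_side nT zT d0 zT) eqxx mulr0 subr0 mulr1.
rewrite in_fsetD1 => /andP[/negPf pz pT].
by rewrite (bary_barycenter_side nT zT d0 pT) pz divff// subrr mulr0.
Qed.

Lemma CR_of_values_barycenter T : T \in Th ->
  affine (CR_of_values_c T) (CR_of_values_g T) (barycenter T) =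
  \sum_(p <- T) w T p / d.+1%:R.
Proof.
move=> TT; rewrite CR_of_valuesE// big_seq [RHS]big_seq; apply: eq_bigr => p pT.
by rewrite (bary_barycenter (nondeg TT) pT) -natr1; field; rewrite natr1 pnatr_eq0.
Qed.

Lemma CR_of_values_compatible :
  (forall T z T' z', T \in Th -> z \in T -> neighbour Th T z T' z' ->
     w T z = w T' z') ->
  (forall T z, T \in Th -> z \in T -> (T `\ z)%fset \in D -> w T z = 0) ->
  CR_compatible CR_of_values_c CR_of_values_g.
Proof.
move=> wn wD; split=> [T z T' z' TT zT nb|T z TT zT SD].
  have [TT' zT' _ SE] := nb.
  by rewrite CR_of_values_midpoint// SE CR_of_values_midpoint//; exact: wn.
by rewrite CR_of_values_midpoint//; exact: wD.
Qed.

End prescribed_midpoint_values.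
End mixed_pairing.

(** * The two orthogonality relations *)

Section orthogonality.
Variables (R : realType) (d : nat).
Variables (Omega : set 'rV[R]_d) (Th : {fset {fset 'rV[R]_d}}).
Variables (GammaD GammaN : set 'rV[R]_d) (D : {fset {fset 'rV[R]_d}}).
Hypothesis d0 : (0 < d)%N.
Hypothesis hOmega : bounded_lipschitz_domain Omega.
Hypothesis hTh : regular_triangulation Omega Th.
Hypothesis hD : forall S, S \in D -> is_boundary_side Omega Th S.
Hypothesis hGammaD : GammaD = \bigcup_(S in [set` D]) hull S.
Hypothesis hGammaN : GammaN =
  \bigcup_(S in [set S | is_boundary_side Omega Th S /\ S \notin D]) hull S.
Local Notation mu := (lebesgue_measure_rV R d).
Local Notation simplex := {fset 'rV[R]_d}.
Local Notation midpoint T z := (barycenter (T `\ z)%fset).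
Local Notation RTN := (RT_N Omega Th GammaN).
Local Notation CRD := (CR_D Omega Th GammaD).
Local Notation delta := flag_delta.
Implicit Types (T S : simplex).

Let nondeg T : T \in Th -> nondegenerate T.
Proof. by move=> TT; exact: (nondegenerate_element hTh TT). Qed.

Let dn0 : d%:R != 0 :> R. Proof. by rewrite pnatr_eq0 -lt0n. Qed.

Let volume_neq0 T : T \in Th -> volume T != 0.
Proof. by move=> TT; rewrite gt_eqF// (volume_gt0 (nondeg TT)). Qed.

Lemma RT_N_data y : RTN y -> exists a b,
  [/\ forall T, T \in Th -> y = RT_shape T (a T) (b T) %[ae mu in hull T],
      RT_compatible Omega Th D a b
    & forall T j, T \in Th -> average T (component y j) = a T ord0 j].
Proof.
move=> yN; have [RTy _] := yN; have [a [b yE]] := RT_data RTy.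
exists a, b; split=> //; first exact/(RT_NP d0 hOmega hTh hGammaN RTy yE).
by move=> T j TT; apply: (average_RT hTh TT (RT_measurable j RTy) (yE T TT)).
Qed.

Lemma CR_D_data v : CRD v -> exists c g,
  [/\ forall T, T \in Th -> v = affine (c T) (g T) %[ae mu in hull T],
      CR_compatible Th D c g
    & forall T, T \in Th -> average T v = affine (c T) (g T) (barycenter T)].
Proof.
move=> vD; have [[Lv _] _] := vD; have [c [g vE]] := Lk1_data Lv.
exists c, g; split=> //; first exact/(CR_DP d0 hTh hD hGammaD Lv vE).
move=> T TT; have [[mv _] _] := Lv.
exact: (average_of_affine hTh TT mv (vE T TT)).
Qed.

Lemma component_measurable (z : 'rV[R]_d -> 'rV[R]_d) j :
  Lkv Omega Th 0 d z -> measurable_fun setT (component z j).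
Proof. by move=> /(_ j)[[]]. Qed.

Lemma innerv_Pi_hv z zeta y (a : simplex -> 'rV[R]_d) :
  Lkv Omega Th 0 d z ->
  (forall T, T \in Th -> z = cst (zeta T) %[ae mu in hull T]) ->
  (forall T j, T \in Th -> average T (component y j) = a T ord0 j) ->
  innerv Omega z (Pi_hv Th y) = \sum_(T <- Th) volume T * dot (zeta T) (a T).
Proof.
move=> Lz zE ya.
have PE j : component (Pi_hv Th y) j = Pi_h Th (component y j).
  by apply/funext => x; rewrite /component mxE.
apply: (Int_piecewise_cst hOmega hTh) => [|T TT].
- apply: measurable_sum => j; apply: measurable_funM.
    exact: component_measurable.
  by have := measurable_Pi_h hTh (component y j); rewrite -PE.
- have yE : Pi_hv Th y = cst (a T) %[ae mu in hull T].
    apply: ae_rowP => j; rewrite PE; apply: filterS (Pi_h_ae hTh (component y j) TT).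
    by move=> x h /h ->; rewrite /component /cst ya.
  by apply: filterS2 (zE T TT) yE => x h1 h2 hx; rewrite h1// h2.
Qed.

Lemma inner_Pi_h (g v : 'rV[R]_d -> R) gamma : measurable_fun setT g ->
  (forall T, T \in Th -> g = cst (gamma T) %[ae mu in hull T]) ->
  inner Omega g (Pi_h Th v) = \sum_(T <- Th) volume T * (gamma T * average T v).
Proof.
move=> mg gE; apply: (Int_piecewise_cst hOmega hTh) => [|T TT].
  by apply: measurable_funM => //; exact: (measurable_Pi_h hTh).
by apply: filterS2 (gE T TT) (Pi_h_ae hTh v TT) => x h1 h2 hx; rewrite h1// h2.
Qed.

(** In the pairing identity the second term is the average of v over T. *)
Lemma grad_ker_orthogonal v z y : ker_Pi_h Omega Th CRD v -> is_grad_h Omega Th v z ->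
  RTN y -> innerv Omega z (Pi_hv Th y) = 0.
Proof.
move=> [vD /(Pi_h_eq0 hOmega hTh) v0] [Lz zv] yN.
have [c [g [vE cg vb]]] := CR_D_data vD; have [a [b [yE ab ya]]] := RT_N_data yN.
have zE T : T \in Th -> z = cst (g T) %[ae mu in hull T].
  move=> TT; have [p /(restricts_affineP hTh _ TT (vE T TT)) ->] := zv T TT.
  by apply: filterS => x h /h ->; rewrite grad_affine.
rewrite (innerv_Pi_hv Lz zE ya) -[RHS](pairing_eq0 d0 hOmega hTh ab cg).
rewrite big_seq [RHS]big_seq; apply: eq_bigr => T TT.
by rewrite -(vb T TT) v0// mulr0 addr0.
Qed.

(** In the pairing identity a T is the average of y over T, and d b T is the
    divergence. *)
Lemma div_ker_orthogonal y g : ker_Pi_hv Omega Th RTN y -> is_div Omega y g ->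
  Lk Omega Th 0 g /\ forall v, CRD v -> inner Omega g (Pi_h Th v) = 0.
Proof.
move=> [yN /(Pi_hv_eq0 hOmega hTh) y0] yg.
have [a [b [yE ab ya]]] := RT_N_data yN.
have my j := RT_measurable j yN.1; have [[mg _] _] := yg.
have gE T : T \in Th -> g = cst (d%:R * b T) %[ae mu in hull T].
  exact: (div_on_element hOmega hTh my yE yg).
split.
  split=> [|T TT]; last by exists (cst (d%:R * b T)); split; [exact: polynomial_le_cst|exact: gE].
  apply: (Linfty_tame_ae hOmega mg (h := pieces Th (fun T _ => d%:R * b T))).
    by apply: (tame_pieces hTh) => T; exact: tame_cst.
  exact: (pieces_ae_Omega hTh gE).
move=> v vD; have [c [e [vE ce vb]]] := CR_D_data vD.
rewrite (inner_Pi_h v mg gE) -[RHS](pairing_eq0 d0 hOmega hTh ab ce).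
rewrite big_seq [RHS]big_seq; apply: eq_bigr => T TT.
have -> : a T = 0 by apply/rowP => j; rewrite -ya// y0// mxE.
by rewrite dot0r add0r vb.
Qed.

(** The only elementwise affine function with gradient z and zero averages is
    zeta_T . (x - x_T) on T. Testing z with the basis field of a side shows
    that this function has the same midpoint value on both sides of an interior
    side, and the value zero at the midpoint of a Dirichlet side. *)
Lemma orthogonal_is_grad z : Lkv Omega Th 0 d z ->
  (forall y, RTN y -> innerv Omega z (Pi_hv Th y) = 0) ->
  exists2 v, ker_Pi_h Omega Th CRD v & is_grad_h Omega Th v z.
Proof.
move=> Lz zo; have [zeta zE] := Lkv0_data Lz.
pose c T := - dot (zeta T) (barycenter T).
have cE T x : affine (c T) (zeta T) x = dot (zeta T) (x - barycenter T).
  by rewrite /affine /c dotBr addrC.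
have cS T u : T \in Th -> u \in T -> affine (c T) (zeta T) (midpoint T u) =
    d%:R^-1 * dot (zeta T) (barycenter T - u).
  move=> TT uT; rewrite cE (barycenter_sideE (nondeg TT) uT d0).
  by rewrite addrC addKr dotZr.
have flux0 w :
    (forall T u T' u', T \in Th -> u \in T -> neighbour Th T u T' u' ->
       w T u + w T' u' = 0) ->
    (forall T u, T \in Th -> u \in T -> is_boundary_side Omega Th (T `\ u)%fset ->
       (T `\ u)%fset \notin D -> w T u = 0) ->
    \sum_(T <- Th) \sum_(p <- T) w T p * dot (zeta T) (barycenter T - p) = 0.
  move=> wn wN; have ab := RT_of_fluxes_compatible hTh wn wN.
  have yN := RT_field_in d0 hOmega hTh hGammaN ab.
  rewrite -[RHS](zo _ yN).
  rewrite (@innerv_Pi_hv _ zeta _ (RT_of_fluxes_a w) Lz zE); last first.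
    move=> T j TT; apply: (average_RT hTh TT); last exact: (RT_field_ae hTh _ _ TT).
    by case: (tame_RT_field hTh (RT_of_fluxes_a w) (RT_of_fluxes_b w) j).
  rewrite big_seq [RHS]big_seq; apply: eq_bigr => T TT.
  by rewrite (dot_RT_of_fluxes hTh).
have cg : CR_compatible Th D c zeta.
  split=> [T u T' u' TT uT nb|T u TT uT SD]; last first.
    rewrite cS//; apply/eqP; rewrite mulf_eq0 invr_eq0 (negPf dn0) /=.
    have := flux0 (delta T u).
    rewrite (sum_flag_delta (fun T p => dot (zeta T) (barycenter T - p)) TT uT) => ->//.
    - move=> T1 u1 T2 u2 TT1 uT1 nb1; have [TT2 uT2 _ _] := nb1.
      rewrite (flag_delta_boundary d0 hOmega hTh TT uT (hD SD) nb1).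
      by rewrite (flag_delta_boundary d0 hOmega hTh TT uT (hD SD) (neighbour_sym TT1 uT1 nb1)) addr0.
    - move=> T1 u1 _ _ _; rewrite /flag_delta; case: eqP => //= ->; case: eqP => //= ->.
      by rewrite SD.
  have [TT' uT' T'T SE] := nb; have nb' := neighbour_sym TT uT nb.
  rewrite cS// SE cS//; congr (_ * _).
  have := flux0 (fun T1 u1 => delta T u T1 u1 - delta T' u' T1 u1).
  under eq_bigr do under eq_bigr do rewrite mulrBl.
  under eq_bigr do rewrite sumrB.
  rewrite sumrB.
  rewrite (sum_flag_delta (fun T p => dot (zeta T) (barycenter T - p)) TT uT).
  rewrite (sum_flag_delta (fun T p => dot (zeta T) (barycenter T - p)) TT' uT').
  move=> E; apply/eqP; rewrite -subr_eq0; apply/eqP; apply: E.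
    move=> T1 u1 T2 u2 TT1 uT1 nb1.
    rewrite (flag_delta_neighbour d0 hTh TT uT TT1 uT1 nb nb1).
    rewrite (flag_delta_neighbour d0 hTh TT' uT' TT1 uT1 nb' nb1).
    by rewrite addrC addrA subrK subrr.
  move=> T1 u1 TT1 uT1 bS _.
  rewrite (flag_delta_interior d0 hOmega hTh TT1 uT1 bS nb).
  by rewrite (flag_delta_interior d0 hOmega hTh TT1 uT1 bS nb') subr0.
have vD := CR_field_in d0 hOmega hTh hD hGammaD cg.
have vE := CR_field_ae hTh c zeta.
exists (CR_field Th c zeta).
  split=> //; apply/(Pi_h_eq0 hOmega hTh) => T TT.
  rewrite (average_of_affine hTh TT (tame_CR_field hTh c zeta).1 (vE T TT)).
  by rewrite cE subrr dot0r.
split=> // T TT; exists (affine (c T) (zeta T)).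
  exact/(restricts_affineP hTh _ TT (vE T TT)).
by apply: filterS (zE T TT) => x h /h ->; rewrite grad_affine.
Qed.

(** The only elementwise shape with divergence g and zero averages is
    (gamma_T / d) (x - x_T) on T, with the same flux through all sides of T.
    Testing g with the basis function of a side shows that these fluxes are
    opposite across an interior side and zero on a Neumann side. *)
Lemma orthogonal_is_div g : Lk Omega Th 0 g ->
  (forall v, CRD v -> inner Omega g (Pi_h Th v) = 0) ->
  exists2 y, ker_Pi_hv Omega Th RTN y & is_div Omega y g.
Proof.
move=> Lg go; have [gamma gE] := Lk0_data Lg; have [[mg _] _] := Lg.
have value0 w :
    (forall T u T' u', T \in Th -> u \in T -> neighbour Th T u T' u' ->
       w T u = w T' u') ->
    (forall T u, T \in Th -> u \in T -> (T `\ u)%fset \in D -> w T u = 0) ->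
    \sum_(T <- Th) \sum_(p <- T) w T p * (volume T * gamma T) = 0.
  move=> wn wD; have cg := CR_of_values_compatible d0 hTh wn wD.
  have vD := CR_field_in d0 hOmega hTh hD hGammaD cg.
  have E := go _ vD.
  rewrite (inner_Pi_h _ mg gE) in E.
  apply: (@mulfI _ (d.+1%:R^-1)); first by rewrite invr_neq0// pnatr_eq0.
  rewrite mulr0 -[RHS]E mulr_sumr big_seq [RHS]big_seq; apply: eq_bigr => T TT.
  set v := CR_field _ _ _.
  have -> : average T v = \sum_(p <- T) w T p / d.+1%:R.
    rewrite -(CR_of_values_barycenter hTh w TT).
    apply: (average_of_affine hTh TT); last exact: (CR_field_ae hTh _ _ TT).
    by case: (tame_CR_field hTh (CR_of_values_c w) (CR_of_values_g w)).
  by rewrite -!mulr_suml; ring.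
pose a (T : simplex) : 'rV[R]_d := 0; pose b T := gamma T / d%:R.
have fluxE T u : RT_flux T (a T) (b T) u = gamma T / (d%:R * d.+1%:R).
  by rewrite /RT_flux /a /b dot0r subr0 -mulrA -invfM.
have ab : RT_compatible Omega Th D a b.
  split=> [T u T' u' TT uT nb|T u TT uT bS SD].
    rewrite !fluxE !mulrA -mulrDl; apply/eqP; rewrite mulf_eq0; apply/orP; left.
    have [TT' uT' T'T SE] := nb; have nb' := neighbour_sym TT uT nb.
    have := value0 (fun T1 u1 => delta T u T1 u1 + delta T' u' T1 u1).
    under eq_bigr do under eq_bigr do rewrite mulrDl.
    under eq_bigr do rewrite big_split.
    rewrite big_split/=.
    rewrite (sum_flag_delta (fun T _ => volume T * gamma T) TT uT).
    rewrite (sum_flag_delta (fun T _ => volume T * gamma T) TT' uT').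
    move=> E; apply/eqP; apply: E.
      move=> T1 u1 T2 u2 TT1 uT1 nb1.
      rewrite (flag_delta_neighbour d0 hTh TT uT TT1 uT1 nb nb1).
      by rewrite (flag_delta_neighbour d0 hTh TT' uT' TT1 uT1 nb' nb1) addrC.
    move=> T1 u1 TT1 uT1 SD.
    rewrite (flag_delta_interior d0 hOmega hTh TT1 uT1 (hD SD) nb).
    by rewrite (flag_delta_interior d0 hOmega hTh TT1 uT1 (hD SD) nb') addr0.
  rewrite fluxE; have := value0 (delta T u).
  rewrite (sum_flag_delta (fun T _ => volume T * gamma T) TT uT) => E.
  have /eqP : volume T * gamma T = 0.
    apply: E => [T1 u1 T2 u2 TT1 uT1 nb1|T1 u1 _ _ SD1].
      rewrite (flag_delta_boundary d0 hOmega hTh TT uT bS nb1).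
      by rewrite (flag_delta_boundary d0 hOmega hTh TT uT bS (neighbour_sym TT1 uT1 nb1)).
    rewrite /flag_delta; case: eqP => //= E1; case: eqP => //= E2.
    by move: SD1 SD; rewrite E1 E2 => ->.
  by rewrite mulf_eq0 (negPf (volume_neq0 TT)) => /eqP ->; rewrite mul0r.
have yN := RT_field_in d0 hOmega hTh hGammaN ab.
have yE := RT_field_ae hTh a b.
have my j := (tame_RT_field hTh a b j).1.
exists (RT_field Th a b).
  split=> //; apply/(Pi_hv_eq0 hOmega hTh) => T j TT.
  by rewrite (average_RT hTh TT (my j) (yE T TT)) mxE.
have [_ ydiv] := is_div_of_compatible_fluxes d0 hOmega hTh my yE ab.1.
have tp : tame (pieces Th (fun T _ => d%:R * b T)).
  by apply: (tame_pieces hTh) => T; exact: tame_cst.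
have gp : g = pieces Th (fun T _ => d%:R * b T) %[ae mu in Omega].
  apply: (pieces_ae_Omega hTh (F := fun T _ => d%:R * b T)) => T TT.
  by apply: filterS (gE T TT) => x h /h ->; rewrite /b mulrC divfK.
split; first exact: (L2_tame_ae hOmega mg tp gp).
move=> phi tphi; rewrite ydiv//; congr (- _); apply: ae_eq_Int.
- exact: (bounded_measurable_Omega hOmega).1.
- have [tf _ _ _ _] := test_function_estimates tphi.
  by apply: measurable_funTS; apply: measurable_funM; [exact: tp.1|exact: tf.1].
- have [tf _ _ _ _] := test_function_estimates tphi.
  by apply: measurable_funTS; apply: measurable_funM; [|exact: tf.1].
- by apply: filterS gp => x h /h ->.
Qed.

End orthogonality.

Theorem theorem3p1 (R : realType) (d : nat) (hd : (0 < d)%N)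
    (Omega : set 'rV[R]_d) (Th : {fset {fset 'rV[R]_d}})
    (GammaD GammaN : set 'rV[R]_d)
    (hOmega : bounded_lipschitz_domain Omega)
    (hTh : regular_triangulation Omega Th)
    (hGamma : boundary_partition Omega Th GammaD GammaN) :
  orth_complement (innerv Omega) (Lkv Omega Th 0 d)
      [set Pi_hv Th y | y in RT_N Omega Th GammaN] =
    [set z | exists2 v, ker_Pi_h Omega Th (CR_D Omega Th GammaD) v
                      & is_grad_h Omega Th v z]
  /\
  [set g | exists2 y, ker_Pi_hv Omega Th (RT_N Omega Th GammaN) y
                    & is_div Omega y g] =
    orth_complement (inner Omega) (Lk Omega Th 0)
      [set Pi_h Th v | v in CR_D Omega Th GammaD].
Proof.
have [D [hD hGD hGN]] := hGamma; split; apply/seteqP; split.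
- move=> z [Lz zo]; apply: (orthogonal_is_grad hd hOmega hTh hD hGD hGN Lz) => y yN.
  by apply: zo; exists y.
- move=> z [v vD zv]; split; first by case: zv.
  by move=> _ [y yN <-]; exact: (grad_ker_orthogonal hd hOmega hTh hD hGD hGN vD zv yN).
- move=> g [y yN yg].
  have [Lg go] := div_ker_orthogonal hd hOmega hTh hD hGD hGN yN yg.
  by split=> // _ [v vD <-]; exact: go.
- move=> g [Lg go]; apply: (orthogonal_is_div hd hOmega hTh hD hGD hGN Lg) => v vD.
  by apply: go; exists v.
Qed.
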